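(* Let $(c(\mathbf r,t),Q(\mathbf r,t))$ be a solution on $[0,T]$ of the gradient flow system of the context, with $c\in C^6(\Omega\times[0,T])$ and $Q\in C^4(\Omega\times[0,T])$. Let $(c^n,Q^n)$ be the solution at $t^n=n\,\delta t\le T$ of the fully discrete scheme $$\frac{c^{n+1}-c^n}{\delta t}=-\hat{\mathscr{G}}\Big(\frac{\partial\Xi}{\partial c}(c^{n+1},Q^{n+1})+2(c_{00}-\gamma)c^n+L_c[c^{n+1},Q^{n+1}]\Big)\quad\text{at interior nodes},$$ $$\frac{Q_{ij}^{n+1}-Q_{ij}^n}{\delta t}=-\mathscr{P}\Big(\frac{\partial\Xi}{\partial Q_{ij}}(c^{n+1},Q^{n+1})+2c_{02}Q_{ij}^n+L_{Q_{ij}}[c^{n+1},Q^{n+1}]\Big)\quad\text{at interior nodes},$$ $$\frac{D_{\mathbf n}c^{n+1}-D_{\mathbf n}c^n}{\delta t}=-\Delta_hc^{n+1}\quad\text{at boundary nodes},$$ with boundary-node values $c_{\mathrm{bnd}},Q_{\mathrm{bnd}}$, started from the exact initial values ($c^0,Q^0$ and $D_{\mathbf n}c^0$ are those of $c(\cdot,0),Q(\cdot,0)$). With $\eta^n=c(\cdot,t^n)-c^n$, $R^n=Q(\cdot,t^n)-Q^n$ and $$\varepsilon^n=h^2\sum_P\big(|\eta^n|_P^2+|R^n|_P^2\big)+h\sum_\sigma(D_{\mathbf n}\eta^n)_\sigma^2,$$ the error satisfies $$\varepsilon^n\le C(\delta t^2+h^4),$$ where the constant $C$ does not depend on $n,\delta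 t,h$; it depends on $T$, the coefficients $c_{02},c_{40}$, and the maximum of the derivatives of $c,Q_{ij}$ in $\Omega\times[0,T]$.
   Context: Gradient flow system on $\Omega=[0,L]^2$: for a scalar $c$ and a symmetric traceless $2\times2$ tensor $Q$, in $\Omega$, $$\partial_tc=-\mathscr{G}\Big(\frac{\partial\Xi}{\partial c}+2c_{00}c-2c_{20}\Delta c-c_{23}\partial_{ij}Q_{ij}+2c_{40}\Delta^2c\Big),$$ $$\partial_tQ_{ij}=-\mathscr{P}\Big(\frac{\partial\Xi}{\partial Q_{ij}}+2c_{02}Q_{ij}-2c_{21}\Delta Q_{ij}-2c_{22}\partial_{ik}Q_{kj}-c_{23}\partial_{ij}c\Big),$$ and on $\partial\Omega$: $c=c_{\mathrm{bnd}}$, $Q=Q_{\mathrm{bnd}}$ (time independent), $\partial_t(\partial_{\mathbf n}c)=-\Delta c$, with $\mathbf n$ the outward normal. Repeated indices are summed. $\mathscr{G}A=A-\frac1{L^2}\int_\Omega A\,\mathrm d\mathbf r$, $(\mathscr{P}Q)_{ij}=\frac12(Q_{ij}+Q_{ji})-\frac12\delta_{ij}Q_{kk}$. Quasi-entropy: $M,\nu>0$; $q(S)=-\log\det(S+I/2)+\log\det(I/2)$ for symmetric traceless $S$ with eigenvalues in $(-1/2,1/2)$; $\Xi(c,Q)=c\log c+(M-c)\log(1-c/M)+c\nu q(Q/c)$, with $\frac{\partial\Xi}{\partial c}=\log\frac{Mc}{M-c}+\nu q(Q/c)+\frac\nu c(\frac Qc+\frac I2)^{-1}_{ij}Q_{ij}$,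 $\frac{\partial\Xi}{\partial Q_{ij}}=-\nu(\frac Qc+\frac I2)^{-1}_{ij}$ defined for $0<c<M$, eigenvalues of $Q$ in $(-c/2,c/2)$; exact and numerical solutions take such values in the interior of $\Omega$ (resp. at interior nodes). Coefficients are real with $c_{40},c_{21},c_{22}>0$, $c_{20}<0$; $\gamma\ge c_{00}$ and $\gamma\ge\big(\min\{c_{20}-\frac{c_{23}^2}{4c_{22}},0\}\big)^2/(4c_{40})$. Grid: $\Omega$ is divided uniformly into $N^2$ square cells, $h=L/N$; node $(l,m)$ is $(lh,mh)$, $0\le l,m\le N$, interior if $1\le l,m\le N-1$, otherwise boundary. Boundary cells $\sigma$ are the $4N$ grid edges on $\partial\Omega$. Ghost nodes $(-1,m),(N+1,m),(l,-1),(l,N+1)$ carry values of $c$; $(D^x_{\mathbf n}v)_{0,m}=\frac{v_{-1,m}-v_{1,m}}{2h}$, $(D^x_{\mathbf n}v)_{N,m}=\frac{v_{N+1,m}-v_{N-1,m}}{2h}$, $(D^y_{\mathbf n}v)_{l,0}=\frac{v_{l,-1}-v_{l,1}}{2h}$, $(D^y_{\mathbf n}v)_{l,N}=\frac{v_{l,N+1}-v_{l,N-1}}{2h}$. $D_{\mathbf n}$ means $D_{\mathbf n}^x$ on vertical and $D_{\mathbf n}^y$ on horizontal sides (both at corners). $\sum_P$ sums over interior nodes; $\sum_\sigma u_\sigma$ sums over boundary cells, $u_\sigma$ being the average of $u$ over the two endpoints of $\sigma$ (in $(D_{\mathbf n}u)_\sigma^2$, the average of the squares). For the exact solution, ghost-node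 values are those of a $C^6$ extension of $c$ to $[-h,L+h]^2$ (with derivatives controlled as on $\Omega$). Differences: $(D_{11}u)_{l,m}=h^{-2}(u_{l-1,m}-2u_{l,m}+u_{l+1,m})$, $D_{22}$ similarly in $m$; $(D_{12}u)_{l,m}=(D_{21}u)_{l,m}=\frac1{4h^2}(u_{l-1,m-1}+u_{l+1,m+1}-u_{l-1,m+1}-u_{l+1,m-1})$; $\Delta_h=D_{11}+D_{22}$, $\Delta_h^2=D_{11}D_{11}+2D_{11}D_{22}+D_{22}D_{22}$. $L_c[c,Q]=2\gamma c-2c_{20}D_{kk}c-c_{23}D_{ij}Q_{ij}+2c_{40}\Delta_h^2c$; $L_{Q_{ij}}[c,Q]=-2c_{21}D_{kk}Q_{ij}-2c_{22}D_{ik}Q_{kj}-c_{23}D_{ij}c$; $\hat{\mathscr{G}}A=A-\frac1{\#P}\sum_PA_P$ with $\#P$ the number of interior nodes. *)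

(* Defs.v *)
From HB Require Import structures.
From mathcomp Require Import all_boot all_order all_algebra.
From mathcomp Require Import all_classical all_reals all_analysis.

Set Implicit Arguments.
Unset Strict Implicit.
Unset Printing Implicit Defensive.

Import Order.TTheory GRing.Theory Num.Theory.
Import numFieldNormedType.Exports.

Local Open Scope classical_set_scope.
Local Open Scope ring_scope.

(* ---- Space-time functions u x y t and their partial derivatives ---- *)

(* [Space 0] is x, [Space 1] is y. *)
Inductive axis := Space of 'I_2 | Time.

Definition slice (R : realType) (d : axis) (u : R -> R -> R -> R)
    (x y t : R) : R -> R :=
  match d with
  | Space i => if i == 0 then fun s => u s y t else fun s => u x s t
  | Time => fun s => u x y s
  end.

Definition axis_coord (R : realType) (d : axis) (x y t : R) : R :=
  match d with
  | Space i => if i == 0 then x else y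
  | Time => t
  end.

Definition pd (R : realType) (d : axis) (u : R -> R -> R -> R) :
    R -> R -> R -> R :=
  fun x y t => derive1 (slice d u x y t) (axis_coord d x y t).

Definition pds (R : realType) (s : seq axis) (u : R -> R -> R -> R) :
    R -> R -> R -> R :=
  foldr (@pd R) u s.

(* A function of class C^k on the closed box [0,L]^2 x [0,T] is represented
   by a C^k function on the whole of R^3 restricting to it: on a closed box
   this is the same as having continuous derivatives of order at most k up to
   the boundary, and the derivatives on the box do not depend on the
   representative. *)
Definition classC (R : realType) (k : nat) (u : R -> R -> R -> R) : Prop :=
  forall s : seq axis, (size s <= k)%N ->
    continuous (fun p : R * R * R => pds s u p.1.1 p.1.2 p.2) /\
    ((size s < k)%N -> forall (d : axis) (x y t : R),
       derivable (slice d (pds s u) x y t) (axis_coord d x y t) 1).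

Definition derivs_le (R : realType) (k : nat) (u : R -> R -> R -> R)
    (a b T K : R) : Prop :=
  forall s : seq axis, (0 < size s <= k)%N ->
  forall x y t : R, a <= x <= b -> a <= y <= b -> 0 <= t <= T ->
    `|pds s u x y t| <= K.

Definition tcomp (R : realType) (Q : R -> R -> R -> 'M[R]_2) (i j : 'I_2) :
    R -> R -> R -> R :=
  fun x y t => Q x y t i j.

Definition lap (R : realType) (u : R -> R -> R -> R) : R -> R -> R -> R :=
  fun x y t => \sum_(k < 2) pd (Space k) (pd (Space k) u) x y t.

(* ---- Model ---- *)

Record model (R : realType) := Model {
  mL : R; mM : R; mnu : R;
  c00 : R; c02 : R; c20 : R; c21 : R; c22 : R; c23 : R; c40 : R;
  mgamma : R }.

Definition model_ok (R : realType) (p : model R) : Prop :=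
  [/\ 0 < mL p, 0 < mM p & 0 < mnu p] /\
  [/\ 0 < c40 p, 0 < c21 p, 0 < c22 p & c20 p < 0] /\
  c00 p <= mgamma p /\
  (Num.min (c20 p - c23 p ^+ 2 / (4 * c22 p)) 0) ^+ 2 / (4 * c40 p)
    <= mgamma p.

Definition sym_traceless (R : realType) (A : 'M[R]_2) : Prop :=
  A^T = A /\ \tr A = 0.

Definition admissible (R : realType) (M : R) (c : R) (Q : 'M[R]_2) : Prop :=
  0 < c < M /\ forall a : R, eigenvalue Q a -> - (c / 2) < a < c / 2.

Definition quasi_entropy (R : realType) (S : 'M[R]_2) : R :=
  - ln (\det (S + (2^-1)%:M)) + ln (\det ((2^-1)%:M : 'M[R]_2)).

Definition dXi_dc (R : realType) (p : model R) (c : R) (Q : 'M[R]_2) : R :=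
  let B := invmx (c^-1 *: Q + (2^-1)%:M) in
  ln (mM p * c / (mM p - c)) + mnu p * quasi_entropy (c^-1 *: Q)
  + mnu p / c * (\sum_(i < 2) \sum_(j < 2) B i j * Q i j).

Definition dXi_dQ (R : realType) (p : model R) (c : R) (Q : 'M[R]_2) :
    'M[R]_2 :=
  - (mnu p *: invmx (c^-1 *: Q + (2^-1)%:M)).

Definition projP (R : realType) (A : 'M[R]_2) : 'M[R]_2 :=
  2^-1 *: (A + A^T) - (2^-1 * \tr A)%:M.

(* ---- Continuous problem ---- *)

(* Mean over the open square: the singular potential is only defined there,
   and the boundary is Lebesgue-negligible. *)
Definition mean_square (R : realType) (L : R) (A : R -> R -> R) : R :=
  (L ^+ 2)^-1 *
  \int[(@lebesgue_measure R \x @lebesgue_measure R)%E]_(z in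
         `]0, L[%classic `*` `]0, L[%classic) A z.1 z.2.

Definition projG (R : realType) (L : R) (A : R -> R -> R) : R -> R -> R :=
  fun x y => A x y - mean_square L A.

Definition chem_c (R : realType) (p : model R) (c : R -> R -> R -> R)
    (Q : R -> R -> R -> 'M[R]_2) (x y t : R) : R :=
  dXi_dc p (c x y t) (Q x y t) + 2 * c00 p * c x y t
  - 2 * c20 p * lap c x y t
  - c23 p * (\sum_(i < 2) \sum_(j < 2)
               pd (Space i) (pd (Space j) (tcomp Q i j)) x y t)
  + 2 * c40 p * lap (lap c) x y t.

Definition chem_Q (R : realType) (p : model R) (c : R -> R -> R -> R)
    (Q : R -> R -> R -> 'M[R]_2) (x y t : R) : 'M[R]_2 :=
  dXi_dQ p (c x y t) (Q x y t) +
  \matrix_(i, j) (2 * c02 p * Q x y t i j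
    - 2 * c21 p * lap (tcomp Q i j) x y t
    - 2 * c22 p * (\sum_(k < 2)
                     pd (Space i) (pd (Space k) (tcomp Q k j)) x y t)
    - c23 p * pd (Space i) (pd (Space j) c) x y t).

(* Outward normal derivatives on the vertical sides x = 0, x = L and on the
   horizontal sides y = 0, y = L. *)
Definition dnx (R : realType) (u : R -> R -> R -> R) : R -> R -> R -> R :=
  fun x y t => if x == 0 then - pd (Space 0) u x y t
               else pd (Space 0) u x y t.
Definition dny (R : realType) (u : R -> R -> R -> R) : R -> R -> R -> R :=
  fun x y t => if y == 0 then - pd (Space 1) u x y t
               else pd (Space 1) u x y t.

Definition exact_solution (R : realType) (p : model R) (T : R)
    (cbnd : R -> R -> R) (Qbnd : R -> R -> 'M[R]_2)
    (c : R -> R -> R -> R) (Q : R -> R -> R -> 'M[R]_2) : Prop :=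
  let L := mL p in
  [/\ (forall x y t : R, 0 <= x <= L -> 0 <= y <= L -> 0 <= t <= T ->
         sym_traceless (Q x y t)),
      (forall x y t : R, 0 < x < L -> 0 < y < L -> 0 <= t <= T ->
         [/\ admissible (mM p) (c x y t) (Q x y t),
             pd Time c x y t =
               - projG L (fun x' y' => chem_c p c Q x' y' t) x y
           & \matrix_(i, j) pd Time (tcomp Q i j) x y t =
               - projP (chem_Q p c Q x y t)]),
      (forall x y t : R, 0 <= x <= L -> 0 <= y <= L -> 0 <= t <= T ->
         (x == 0) || (x == L) || (y == 0) || (y == L) ->
         c x y t = cbnd x y /\ Q x y t = Qbnd x y),
      (forall x y t : R, (x == 0) || (x == L) -> 0 <= y <= L -> 0 <= t <= T ->
         pd Time (dnx c) x y t = - lap c x y t)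
    & (forall x y t : R, (y == 0) || (y == L) -> 0 <= x <= L -> 0 <= t <= T ->
         pd Time (dny c) x y t = - lap c x y t)].

(* ---- Grid functions ---- *)

(* A grid function is indexed by integers (l, m); l, m = -1 and N + 1 are the
   ghost nodes, other values outside 0 .. N are never used. *)
Definition grid_fun (R : realType) := int -> int -> R.
Definition grid_tens (R : realType) := int -> int -> 'M[R]_2.

Definition gcomp (R : realType) (Q : grid_tens R) (i j : 'I_2) : grid_fun R :=
  fun l m => Q l m i j.

Definition interior_node (N : nat) (l m : int) : bool :=
  (0 < l < N%:Z) && (0 < m < N%:Z).
Definition grid_node (N : nat) (l m : int) : bool :=
  (0 <= l <= N%:Z) && (0 <= m <= N%:Z).
Definition boundary_node (N : nat) (l m : int) : bool :=
  grid_node N l m && ~~ interior_node N l m.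

Definition DD (R : realType) (h : R) (i j : 'I_2) (u : grid_fun R) :
    grid_fun R :=
  fun l m =>
  if i == j then
    if i == 0 then (u (l - 1) m - 2 * u l m + u (l + 1) m) / h ^+ 2
    else (u l (m - 1) - 2 * u l m + u l (m + 1)) / h ^+ 2
  else (u (l - 1) (m - 1) + u (l + 1) (m + 1)
        - u (l - 1) (m + 1) - u (l + 1) (m - 1)) / (4 * h ^+ 2).

Definition lap_h (R : realType) (h : R) (u : grid_fun R) : grid_fun R :=
  fun l m => \sum_(k < 2) DD h k k u l m.

Definition bilap_h (R : realType) (h : R) (u : grid_fun R) : grid_fun R :=
  fun l m => DD h 0 0 (DD h 0 0 u) l m + 2 * DD h 0 0 (DD h 1 1 u) l m
             + DD h 1 1 (DD h 1 1 u) l m.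

(* [Dnx] is meant at l = 0 and l = N, [Dny] at m = 0 and m = N. *)
Definition Dnx (R : realType) (h : R) (N : nat) (u : grid_fun R) :
    grid_fun R :=
  fun l m => (if l == 0 then u (-1) m - u 1 m
              else u (N%:Z + 1) m - u (N%:Z - 1) m) / (2 * h).
Definition Dny (R : realType) (h : R) (N : nat) (u : grid_fun R) :
    grid_fun R :=
  fun l m => (if m == 0 then u l (-1) - u l 1
              else u l (N%:Z + 1) - u l (N%:Z - 1)) / (2 * h).

Definition sumP (R : realType) (N : nat) (u : grid_fun R) : R :=
  \sum_(1 <= l < N) \sum_(1 <= m < N) u l%:Z m%:Z.

(* Sum over the 4N boundary edges of the endpoint averages of [(D_n u)^2];
   each edge uses the normal derivative of its own side. *)
Definition sum_sigma_Dn2 (R : realType) (h : R) (N : nat) (u : grid_fun R) :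
    R :=
  \sum_(0 <= k < N)
    ((Dnx h N u 0 k%:Z ^+ 2 + Dnx h N u 0 k.+1%:Z ^+ 2) / 2
   + (Dnx h N u N%:Z k%:Z ^+ 2 + Dnx h N u N%:Z k.+1%:Z ^+ 2) / 2
   + (Dny h N u k%:Z 0 ^+ 2 + Dny h N u k.+1%:Z 0 ^+ 2) / 2
   + (Dny h N u k%:Z N%:Z ^+ 2 + Dny h N u k.+1%:Z N%:Z ^+ 2) / 2).

Definition projG_h (R : realType) (N : nat) (A : grid_fun R) : grid_fun R :=
  fun l m => A l m - sumP N A / (N.-1 ^ 2)%:R.

Definition L_c (R : realType) (p : model R) (h : R) (c : grid_fun R)
    (Q : grid_tens R) : grid_fun R :=
  fun l m => 2 * mgamma p * c l m
    - 2 * c20 p * (\sum_(k < 2) DD h k k c l m)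
    - c23 p * (\sum_(i < 2) \sum_(j < 2) DD h i j (gcomp Q i j) l m)
    + 2 * c40 p * bilap_h h c l m.

Definition L_Q (R : realType) (p : model R) (h : R) (c : grid_fun R)
    (Q : grid_tens R) : grid_tens R :=
  fun l m => \matrix_(i, j)
   (- (2 * c21 p * (\sum_(k < 2) DD h k k (gcomp Q i j) l m))
    - 2 * c22 p * (\sum_(k < 2) DD h i k (gcomp Q k j) l m)
    - c23 p * DD h i j c l m).

Definition sample (R : realType) (V : Type) (h t : R) (u : R -> R -> R -> V) :
    int -> int -> V :=
  fun l m => u (l%:~R * h) (m%:~R * h) t.

Definition scheme_step (R : realType) (p : model R) (N : nat) (dt : R)
    (c0 : grid_fun R) (Q0 : grid_tens R) (c1 : grid_fun R) (Q1 : grid_tens R) :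
    Prop :=
  let h := mL p / N%:R in
  [/\ (forall l m : int, interior_node N l m ->
         (c1 l m - c0 l m) / dt =
         - projG_h N (fun l' m' =>
             dXi_dc p (c1 l' m') (Q1 l' m')
             + 2 * (c00 p - mgamma p) * c0 l' m'
             + L_c p h c1 Q1 l' m') l m),
      (forall l m : int, interior_node N l m ->
         dt^-1 *: (Q1 l m - Q0 l m) =
         - projP (dXi_dQ p (c1 l m) (Q1 l m)
                  + (2 * c02 p) *: Q0 l m + L_Q p h c1 Q1 l m)),
      (forall l m : int, (l == 0) || (l == N%:Z) -> 0 <= m <= N%:Z ->
         (Dnx h N c1 l m - Dnx h N c0 l m) / dt = - lap_h h c1 l m)
    & (forall l m : int, (m == 0) || (m == N%:Z) -> 0 <= l <= N%:Z ->
         (Dny h N c1 l m - Dny h N c0 l m) / dt = - lap_h h c1 l m)].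

Definition discrete_solution (R : realType) (p : model R) (T : R)
    (cbnd : R -> R -> R) (Qbnd : R -> R -> 'M[R]_2)
    (c : R -> R -> R -> R) (Q : R -> R -> R -> 'M[R]_2)
    (N : nat) (dt : R) (cn : nat -> grid_fun R) (Qn : nat -> grid_tens R) :
    Prop :=
  let h := mL p / N%:R in
  [/\ (forall l m : int, grid_node N l m ->
         cn 0%N l m = sample h 0 c l m /\ Qn 0%N l m = sample h 0 Q l m) /\
      (forall l m : int, (l == 0) || (l == N%:Z) -> 0 <= m <= N%:Z ->
         Dnx h N (cn 0%N) l m = Dnx h N (sample h 0 c) l m) /\
      (forall l m : int, (m == 0) || (m == N%:Z) -> 0 <= l <= N%:Z ->
         Dny h N (cn 0%N) l m = Dny h N (sample h 0 c) l m),
      (forall (n : nat) (l m : int), n%:R * dt <= T -> grid_node N l m ->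
         sym_traceless (Qn n l m)),
      (forall (n : nat) (l m : int), n%:R * dt <= T -> interior_node N l m ->
         admissible (mM p) (cn n l m) (Qn n l m)),
      (forall (n : nat) (l m : int), n%:R * dt <= T -> boundary_node N l m ->
         cn n l m = cbnd (l%:~R * h) (m%:~R * h) /\
         Qn n l m = Qbnd (l%:~R * h) (m%:~R * h))
    & (forall n : nat, n.+1%:R * dt <= T ->
         scheme_step p N dt (cn n) (Qn n) (cn n.+1) (Qn n.+1))].

Definition error_energy (R : realType) (h : R) (N : nat)
    (eta : grid_fun R) (r : grid_tens R) : R :=
  h ^+ 2 * sumP N (fun l m =>
     eta l m ^+ 2 + \sum_(i < 2) \sum_(j < 2) r l m i j ^+ 2)
  + h * sum_sigma_Dn2 h N eta.

(* Main.v *)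
(* The error is estimated by a discrete energy argument, which meets two
   obstacles.  The exact mass is conserved for the integral but not for the
   nodal sum, so that the unknown mean of the chemical potential does not drop
   out; and nothing in the hypotheses keeps c uniformly away from 0 and M, where
   the entropy is singular.

   The equation for Q bounds 4 S / (1 - 4 |S|^2), S = Q / c, hence keeps S
   uniformly inside its domain.  The equation for c then bounds the oscillation
   in space of log (M c / (M - c)), and the time-independent boundary value cb
   makes c(x, t) comparable to cb and M - c(x, t) to M - cb.  With
   eps = cb (M - cb) / M, the solution stays at distance of order eps from 0 and
   M, and varies by O(eps).

   The error is measured from (c + w, Q + W), where w, W = O(h^2) vanish on the
   boundary together with the normal differences of w, and w compensates the
   defect of nodal mass, which is O(h^2) by the trapezoidal rule.  If
   eps > Lam h^6, w is a multiple of (1 - cos)(1 - cos): interpolating between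
   c(t) - c(0) = O(eps) and bounded sixth derivatives gives |w| << eps and
   w^2 = O(eps h^4).  If eps <= Lam h^6, take c + w = c(0) and Q + W = (c(0)/c) Q,
   which leaves S unchanged; all differences are then small because eps is.

   The three-point inequality for Bregman divergences makes the entropy terms
   monotone up to O(h^4), summation by parts makes the linear terms coercive, the
   boundary terms being those of the dynamic boundary condition, and the discrete
   Gronwall lemma concludes. *)
Require Import Defs.
From HB Require Import structures.
From mathcomp Require Import all_boot all_order all_algebra.
From mathcomp Require Import all_classical all_reals all_analysis.
From mathcomp Require Import ring lra zify.

Set Implicit Arguments.
Unset Strict Implicit.
Unset Printing Implicit Defensive.

Import Order.TTheory GRing.Theory Num.Theory.
Import numFieldNormedType.Exports.

Local Open Scope ring_scope.

(** * Taylor estimates and interpolation of derivatives *)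

(** No constant may contain 1 / eps, so every use of the entropy has to be paid for by a power of
    eps. The entropy of the exact solution is evaluated at (c, Q), while it is tested against the
    error measured from (c + w, Q + W); the price is the Bregman divergence between the two. The
    Hessian of the scalar part is of size 1 / eps, so a small w costs about w^2 / eps. This is why
    O(h^4) in the end requires w^2 = O(eps h^4) and not merely w = O(h^2).

    The exponent 6 of the threshold comes from interpolation: with a step B h, second derivatives of
    the increment are of order eps / (B h)^2 + (B h)^4, so the mass defect is of order eps / B^2 +
    B^4 h^6. It is a small fraction of eps when B is large and h^6 is small against eps. Below the
    threshold w is O(h^6), and even the division by h^4 in the discrete bilaplacian leaves O(h^2).

    The difference between the continuous and the discrete mean of the chemical potential is never
    estimated: it is constant in space and is paired with an error of zero nodal sum. The weights 1
    + dt in Young's inequality leave the time step unrestricted. *)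

Lemma is_derive_continuous (R : realType) (f : R -> R) (df x : R) :
  is_derive x 1 f df -> {for x, continuous f}.
Proof. by case=> dfx _; apply/differentiable_continuous/derivable1_diffP. Qed.

Lemma mean_value_bound_on (R : realType) (f df : R -> R) (x y B : R) :
  (forall z : R, Num.min x y <= z <= Num.max x y -> is_derive z 1 f (df z)) ->
  (forall z, Num.min x y <= z <= Num.max x y -> `|df z| <= B) ->
  `|f y - f x| <= B * `|y - x|.
Proof.
wlog xy : x y / x <= y.
  move=> H; case/orP: (le_total x y) => [|yx dfE dfB]; first exact: H.
  by rewrite distrC [`|y - x|]distrC; apply: H => // z; rewrite minC maxC;
    [exact: dfE|exact: dfB].
rewrite min_l// max_r// => dfE dfB.
have dI z : z \in `]x, y[%R -> is_derive z 1 f (df z).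
  by rewrite in_itv /= => zxy; apply: dfE; move: zxy; lra.
have cI : {within `[x, y], continuous f}%classic.
  apply: continuous_in_subspaceT => z; rewrite inE /= in_itv /= => zxy.
  exact: is_derive_continuous (dfE z zxy).
have [z zxy ->] := MVT_segment xy dI cI.
by rewrite normrM ler_wpM2r// dfB//; move: zxy; rewrite in_itv.
Qed.

Lemma mean_value_bound (R : realType) (f df : R -> R) (x y B : R) :
  (forall z : R, is_derive z 1 f (df z)) ->
  (forall z, Num.min x y <= z <= Num.max x y -> `|df z| <= B) ->
  `|f y - f x| <= B * `|y - x|.
Proof. by move=> dfE; apply: mean_value_bound_on. Qed.

(* The missing factor 1/n! is irrelevant: only the order in y - x matters. *)
Lemma taylor_bound_on (R : realType) (n : nat) (f : nat -> R -> R) (a b K : R) :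
  (forall k (z : R), (k < n)%N -> a <= z <= b ->
     is_derive z 1 (f k) (f k.+1 z)) ->
  (forall z, a <= z <= b -> `|f n z| <= K) ->
  forall x y, a <= x <= b -> a <= y <= b ->
  `|f 0%N y - \sum_(k < n) f k x * (y - x) ^+ k / k`!%:R| <= K * `|y - x| ^+ n.
Proof.
elim: n f => [|n IH] f df fK x y xab yab.
  by rewrite big_ord0 subr0 expr0 mulr1; exact: fK.
(* As a function of the endpoint the remainder vanishes at [x], and its derivative is the remainder
   of order n for the shifted family [f k.+1]; the mean value inequality then closes the
   induction. *)
set r := fun z => f 0%N z - \sum_(k < n.+1) f k x * (z - x) ^+ k / k`!%:R.
set dr := fun z => f 1%N z - \sum_(k < n) f k.+1 x * (z - x) ^+ k / k`!%:R.
have drE (z : R) : a <= z <= b -> is_derive z 1 r (dr z).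
  move=> zab.
  apply: is_deriveB; first exact: df.
  rewrite (_ : (fun z => _) = \sum_(k < n.+1)
      (fun z : R => f k x * (z - x) ^+ k / k`!%:R)); last first.
    by apply/funext => w; rewrite fct_sumE.
  rewrite (_ : \sum_(k < n) _ = \sum_(k < n.+1)
      (f k x * (k%:R * (z - x) ^+ k.-1) / k`!%:R)); last first.
    rewrite big_ord_recl /= mul0r mulr0 mul0r add0r.
    apply: eq_bigr => k _; rewrite /bump /= add1n factS natrM invfM.
    rewrite -!mulrA; congr (_ * _).
    rewrite [RHS]mulrCA; congr (_ * _).
    by rewrite mulrA divff ?mul1r// pnatr_eq0.
  apply: is_derive_sum => k.
  have -> : (fun z0 : R => f k x * (z0 - x) ^+ k / k`!%:R) =
      (f k x / k`!%:R) \*: ((fun z0 : R => z0 - x) ^+ k).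
    by apply/funext => w /=; rewrite exprfctE /GRing.scale /= mulrAC.
  apply: is_derive_eq.
  rewrite /GRing.scale /= subr0 mulr1 mulrAC; congr (_ * _ * _).
have rx : r x = 0.
  rewrite /r big_ord_recl /= expr0 mulr1 divr1 big1 ?addr0 ?subrr// => k _.
  by rewrite expr0n /= mulr0 mul0r.
have sub (z : R) : Num.min x y <= z <= Num.max x y -> a <= z <= b.
  move=> zxy; have /andP[zl zu] := zxy; move: zl zu xab yab.
  by case: (leP x y) => _; lra.
have := mean_value_bound_on (B := K * `|y - x| ^+ n) (fun z zxy => drE z (sub z zxy)).
rewrite rx subr0 -mulrA -exprSr; apply => z zxy; have zab := sub z zxy.
have zxyx : `|z - x| <= `|y - x|.
  have /andP[zl zu] := zxy; move: zl zu.
  by case: (leP x y) => xy zl zu; [rewrite !ger0_norm|rewrite !ler0_norm]; lra.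
have K0 : 0 <= K by apply: le_trans (fK x xab).
apply: le_trans (IH (fun k => f k.+1) _ fK x z xab zab) _.
  by move=> k w kn wab; exact: df.
by rewrite ler_wpM2l// lerXn2r// ?nnegrE.
Qed.

Lemma taylor_bound (R : realType) (n : nat) (f : nat -> R -> R) (a b K : R) :
  (forall k (z : R), (k < n)%N -> is_derive z 1 (f k) (f k.+1 z)) ->
  (forall z, a <= z <= b -> `|f n z| <= K) ->
  forall x y, a <= x <= b -> a <= y <= b ->
  `|f 0%N y - \sum_(k < n) f k x * (y - x) ^+ k / k`!%:R| <= K * `|y - x| ^+ n.
Proof. by move=> df; apply: taylor_bound_on => k z kn _; exact: df. Qed.

Definition dif1 (R : realType) (h : R) (f : R -> R) (x : R) : R :=
  (f (x + h) - f (x - h)) / (2 * h).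
Definition dif2 (R : realType) (h : R) (f : R -> R) (x : R) : R :=
  (f (x - h) - 2 * f x + f (x + h)) / h ^+ 2.

Section one_variable.
Variables (R : realType) (f : nat -> R -> R) (a b h x K : R).
Hypotheses (h0 : 0 < h) (xl : a <= x - h) (xu : x + h <= b).

Let hN0 : h != 0. Proof. by rewrite gt_eqF. Qed.
Let bx : a <= x <= b. Proof. by move: h0 xl xu; lra. Qed.
Let bxm : a <= x - h <= b. Proof. by move: h0 xl xu; lra. Qed.
Let bxp : a <= x + h <= b. Proof. by move: h0 xl xu; lra. Qed.
Let xmx : x - h - x = - h. Proof. by ring. Qed.
Let xpx : x + h - x = h. Proof. by ring. Qed.

Lemma dif1_consistent :
  (forall k (z : R), (k < 3)%N -> is_derive z 1 (f k) (f k.+1 z)) ->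
  (forall z, a <= z <= b -> `|f 3 z| <= K) ->
  `|dif1 h (f 0%N) x - f 1%N x| <= K * h ^+ 2.
Proof.
move=> df fK.
have := taylor_bound df fK bx bxm; have := taylor_bound df fK bx bxp.
rewrite !big_ord_recl !big_ord0 /= xmx xpx normrN (gtr0_norm h0).
rewrite /bump /= !factS fact0.
set p := f 0%N (x + h); set m := f 0%N (x - h) => Hp Hm.
have -> : dif1 h (f 0%N) x - f 1%N x = (p - m - 2 * h * f 1%N x) / (2 * h).
  by rewrite /dif1 -/p -/m; field.
have h2 : 0 < 2 * h by rewrite mulr_gt0.
rewrite normrM normfV (gtr0_norm h2) ler_pdivrMr//.
have -> : K * h ^+ 2 * (2 * h) = K * h ^+ 3 + K * h ^+ 3 by ring.
apply: le_trans (lerD Hp Hm).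
rewrite -[X in _ <= _ + X]normrN; apply: le_trans (ler_normD _ _).
rewrite le_eqVlt; apply/orP; left; apply/eqP; congr `| _ |; by field.
Qed.

(** For places where no consistency is sought: in a mixed difference, the quotient in one variable
    is a smooth function of the other, and its derivatives have to be bounded uniformly in [h]. *)
Lemma dif1_bounded :
  (forall z : R, is_derive z 1 (f 0%N) (f 1%N z)) ->
  (forall z, a <= z <= b -> `|f 1%N z| <= K) ->
  `|dif1 h (f 0%N) x| <= K.
Proof.
move=> df fK; rewrite /dif1.
have h2 : 0 < 2 * h by rewrite mulr_gt0.
rewrite normrM normfV (gtr0_norm h2) ler_pdivrMr//.
have -> : 2 * h = `|x + h - (x - h)| by rewrite gtr0_norm; move: h0; lra.
apply: mean_value_bound => // z; rewrite min_l ?max_r; [|move: h0; lra..].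
by move=> zx; apply: fK; move: zx xl xu; lra.
Qed.

Lemma dif2_consistent :
  (forall k (z : R), (k < 4)%N -> is_derive z 1 (f k) (f k.+1 z)) ->
  (forall z, a <= z <= b -> `|f 4 z| <= K) ->
  `|dif2 h (f 0%N) x - f 2 x| <= 2 * K * h ^+ 2.
Proof.
move=> df fK.
have := taylor_bound df fK bx bxm; have := taylor_bound df fK bx bxp.
rewrite !big_ord_recl !big_ord0 /= xmx xpx normrN (gtr0_norm h0).
rewrite /bump /= !factS fact0.
set p := f 0%N (x + h); set m := f 0%N (x - h) => Hp Hm.
have -> : dif2 h (f 0%N) x - f 2 x = (p + m - 2 * f 0%N x - h ^+ 2 * f 2 x) / h ^+ 2.
  by rewrite /dif2 -/p -/m; field.
have h2 : 0 < h ^+ 2 by rewrite exprn_gt0.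
rewrite normrM normfV (gtr0_norm h2) ler_pdivrMr//.
have -> : 2 * K * h ^+ 2 * h ^+ 2 = K * h ^+ 4 + K * h ^+ 4 by ring.
apply: le_trans (lerD Hp Hm).
apply: le_trans (ler_normD _ _).
rewrite le_eqVlt; apply/orP; left; apply/eqP; congr `| _ |; by field.
Qed.

Lemma dif2_bounded :
  (forall k (z : R), (k < 2)%N -> is_derive z 1 (f k) (f k.+1 z)) ->
  (forall z, a <= z <= b -> `|f 2 z| <= K) ->
  `|dif2 h (f 0%N) x| <= 2 * K.
Proof.
move=> df fK.
have := taylor_bound df fK bx bxm; have := taylor_bound df fK bx bxp.
rewrite !big_ord_recl !big_ord0 /= xmx xpx normrN (gtr0_norm h0).
rewrite /bump /= !factS fact0.
set p := f 0%N (x + h); set m := f 0%N (x - h) => Hp Hm.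
have h2 : 0 < h ^+ 2 by rewrite exprn_gt0.
rewrite /dif2 -/p -/m normrM normfV (gtr0_norm h2) ler_pdivrMr//.
have -> : 2 * K * h ^+ 2 = K * h ^+ 2 + K * h ^+ 2 by ring.
apply: le_trans (lerD Hp Hm).
apply: le_trans (ler_normD _ _).
rewrite le_eqVlt; apply/orP; left; apply/eqP; congr `| _ |; by field.
Qed.

End one_variable.

(* From the one-sided six-point quotient for the second derivative, with weights
   15/4, -77/6, 107/6, -13, 61/12, -5/6. *)
Lemma second_derivative_interpolation (R : realType) (f : nat -> R -> R)
    (a b s x K A : R) :
  (forall k (z : R), (k < 6)%N -> is_derive z 1 (f k) (f k.+1 z)) ->
  (forall z, a <= z <= b -> `|f 6 z| <= K) ->
  (forall z, a <= z <= b -> `|f 0%N z| <= A) ->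
  0 < s -> 10 * s <= b - a -> a <= x <= b ->
  `|f 2 x| <= 60 * A / s ^+ 2 + 50 * 5 ^+ 6 * K * s ^+ 4.
Proof.
move=> df fK fA s0 sab xab.
(* The five further nodes lie on the side of [x] that contains at least half of the interval: [t] is
   [s] or [- s], and 10 s <= b - a makes five steps fit. *)
have [t [tN0 [t2 [tn tx]]]] : exists t : R, t != 0 /\ t ^+ 2 = s ^+ 2 /\ `|t| = s /\
    forall k : R, 0 <= k <= 5 -> a <= x + k * t <= b.
  case: (lerP x ((a + b) / 2)) => xm.
    exists s; rewrite gt_eqF// gtr0_norm//; do 3 split => //.
    move=> k /andP[k0 k5].
    have : k * s <= 5 * s by rewrite ler_pM2r.
    have : 0 <= k * s by rewrite mulr_ge0// ltW.
    by move: xab; lra.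
  exists (- s); rewrite oppr_eq0 gt_eqF// sqrrN normrN gtr0_norm//; do 3 split => //.
  move=> k /andP[k0 k5].
  have : k * s <= 5 * s by rewrite ler_pM2r.
  have : 0 <= k * s by rewrite mulr_ge0// ltW.
  by rewrite mulrN; move: xab; lra.
have T (k : nat) : (k <= 5)%N -> `|f 0%N (x + k%:R * t) -
    \sum_(j < 6) f j x * (k%:R * t) ^+ j / j`!%:R| <= K * (5 * s) ^+ 6.
  move=> k5; have kR : 0 <= (k%:R : R) <= 5 by rewrite ler0n ler_nat.
  have xk : a <= x + k%:R * t <= b by exact: tx.
  have := taylor_bound df fK xab xk.
  rewrite (_ : x + k%:R * t - x = k%:R * t); last by ring.
  move=> /le_trans; apply.
  have K0 : 0 <= K by apply: le_trans (fK x xab).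
  rewrite ler_wpM2l// lerXn2r// ?nnegrE ?mulr_ge0// ?(ltW s0)//.
  rewrite normrM tn ler_wpM2r// ?(ltW s0)//.
  by rewrite ger0_norm ?ler0n// ler_nat.
have F (k : nat) : (k <= 5)%N -> `|f 0%N (x + k%:R * t)| <= A.
  by move=> k5; apply/fA/tx; rewrite ler0n ler_nat.
have := T 1%N isT; have := T 2 isT; have := T 3 isT; have := T 4 isT; have := T 5 isT.
have := F 0%N isT; have := F 1%N isT; have := F 2 isT; have := F 3 isT.
have := F 4 isT; have := F 5 isT.
rewrite mul0r addr0 !big_ord_recl !big_ord0 /= /bump /= !factS fact0.
set y0 := f 0%N x; set y1 := f 0%N (x + 1%:R * t); set y2 := f 0%N (x + 2 * t).
set y3 := f 0%N (x + 3 * t); set y4 := f 0%N (x + 4 * t); set y5 := f 0%N (x + 5 * t).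
move=> F5 F4 F3 F2 F1 F0.
set r5 := (X in `|X| <= _); move=> T5; set r4 := (X in `|X| <= _); move=> T4.
set r3 := (X in `|X| <= _); move=> T3; set r2 := (X in `|X| <= _); move=> T2.
set r1 := (X in `|X| <= _); move=> T1.
have s2 : 0 < s ^+ 2 by rewrite exprn_gt0.
(* The weights annihilate the monomials of degree 0, 1, 3, 4 and 5. Their absolute values add up to
   less than 54, and to less than 50 without the node [x], which has no remainder: hence the
   constants 60 and 50. *)
have E : f 2 x * s ^+ 2 = (15 / 4 * y0 - 77 / 6 * y1 + 107 / 6 * y2 - 13 * y3
   + 61 / 12 * y4 - 5 / 6 * y5) - (- (77 / 6) * r1 + 107 / 6 * r2 - 13 * r3
   + 61 / 12 * r4 - 5 / 6 * r5).
  by rewrite -t2 /r1 /r2 /r3 /r4 /r5 -/y0; field.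
rewrite -(ler_pM2r s2) -{1}(gtr0_norm s2) -normrM E.
have -> : (60 * A / s ^+ 2 + 50 * 5 ^+ 6 * K * s ^+ 4) * s ^+ 2 =
    60 * A + 50 * (K * (5 * s) ^+ 6).
  by field; rewrite gt_eqF.
move: T1 T2 T3 T4 T5 F0 F1 F2 F3 F4 F5; set W := K * _.
rewrite !ler_norml; set P5 := r5; set P4 := r4; set P3 := r3; set P2 := r2.
set P1 := r1.
lra.
Qed.

(** One Taylor step of length [s] towards the larger half of the interval; [s] stays free, to be
    chosen so as to balance the two terms. *)
Lemma first_derivative_interpolation (R : realType) (f : nat -> R -> R)
    (a b s x K A : R) :
  (forall k (z : R), (k < 2)%N -> is_derive z 1 (f k) (f k.+1 z)) ->
  (forall z, a <= z <= b -> `|f 2 z| <= K) ->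
  (forall z, a <= z <= b -> `|f 0%N z| <= A) ->
  0 < s -> 2 * s <= b - a -> a <= x <= b ->
  `|f 1%N x| <= 2 * A / s + K * s.
Proof.
move=> df fK fA s0 sab xab.
have [y [yab yx]] : exists y, a <= y <= b /\ `|y - x| = s.
  case: (lerP x ((a + b) / 2)) => xm.
    exists (x + s); split; first by lra.
    by rewrite (_ : _ - _ = s) ?gtr0_norm//; ring.
  exists (x - s); split; first by lra.
  by rewrite (_ : _ - _ = - s) ?normrN ?gtr0_norm//; ring.
have := taylor_bound df fK xab yab.
rewrite !big_ord_recl big_ord0 /= /bump /= fact0 expr0 mulr1 !divr1 addr0 yx.
move=> T.
rewrite -(ler_pM2r s0) -{1}yx -normrM.
have -> : (2 * A / s + K * s) * s = 2 * A + K * s ^+ 2 by field; rewrite gt_eqF.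
have -> : f 1%N x * (y - x) = f 0%N y - f 0%N x -
  (f 0%N y - (f 0%N x + f 1%N x * (y - x))) by ring.
apply: le_trans (ler_normB _ _) _; rewrite lerD//.
apply: le_trans (ler_normB _ _) _.
by rewrite (_ : 2 * A = A + A) ?lerD ?fA//; ring.
Qed.

Section linear_combinations.
Variables (R : realType) (f g k : R -> R) (df dg dk c x : R).
Hypotheses (fE : is_derive x 1 f df) (gE : is_derive x 1 g dg).
Hypothesis (kE : is_derive x 1 k dk).

Lemma is_derive_comb2 :
  is_derive x 1 (fun z => (f z - g z) / c) ((df - dg) / c).
Proof.
rewrite (_ : (fun z => _) = c^-1 \*: (f - g)); last first.
  by apply/funext => z; rewrite /= /GRing.scale /= mulrC.
by apply: is_derive_eq; rewrite /GRing.scale /= mulrC.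
Qed.

Lemma is_derive_comb3 :
  is_derive x 1 (fun z => (f z - 2 * g z + k z) / c) ((df - 2 * dg + dk) / c).
Proof.
rewrite (_ : (fun z => _) = c^-1 \*: (f - 2 \*: g + k)); last first.
  by apply/funext => z; rewrite /= /GRing.scale /= mulrC.
by apply: is_derive_eq; rewrite /GRing.scale /= mulrC.
Qed.

End linear_combinations.

Section two_variables.
Variables (R : realType) (G : nat -> nat -> R -> R -> R).
Variables (a0 a1 b0 b1 h a b K : R).
Hypotheses (h0 : 0 < h).
Hypotheses (al : a0 <= a - h) (au : a + h <= a1).
Hypotheses (bl : b0 <= b - h) (bu : b + h <= b1).

(** [G k j] is the derivative taken k times in x and then j times in y. The quotient in y is formed
    first, so that its x-derivatives are again quotients of the [G k 0]. The opposite order of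
    derivatives is reached by exchanging the variables. *)
Lemma dif1_dif1_consistent :
  (forall k (x y : R), (k < 3)%N ->
     is_derive x 1 (fun x => G k 0 x y) (G k.+1 0 x y)) ->
  (forall k j (x y : R), (k + j < 4)%N ->
     is_derive y 1 (G k j x) (G k j.+1 x y)) ->
  (forall x y, a0 <= x <= a1 -> b0 <= y <= b1 -> `|G 3 1 x y| <= K) ->
  (forall x y, a0 <= x <= a1 -> b0 <= y <= b1 -> `|G 1 3 x y| <= K) ->
  `|dif1 h (fun x => dif1 h (G 0%N 0%N x) b) a - G 1%N 1%N a b|
    <= 2 * K * h ^+ 2.
Proof.
move=> dA dB K31 K13.
pose g k x := dif1 h (G k 0 x) b.
have aa : a0 <= a <= a1 by move: h0 al au; lra.
have A1 : `|dif1 h (g 0%N) a - g 1%N a| <= K * h ^+ 2.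
  apply: (dif1_consistent h0 al au) => [k z k3|z zB].
    by apply: is_derive_comb2; exact: dA.
  apply: (dif1_bounded h0 bl bu (f := fun j => G 3 j z)) => [w|w wB].
    exact: dB.
  exact: K31.
have A2 : `|g 1%N a - G 1%N 1%N a b| <= K * h ^+ 2.
  apply: (dif1_consistent h0 bl bu (f := fun j => G 1%N j a)) => [k w k3|w wB].
    by apply: dB.
  exact: K13.
rewrite (_ : dif1 h _ a - _ = (dif1 h (g 0%N) a - g 1%N a) + (g 1%N a - G 1%N 1%N a b));
  last by rewrite /g; ring.
apply: le_trans (ler_normD _ _) _.
by rewrite (_ : 2 * K * h ^+ 2 = K * h ^+ 2 + K * h ^+ 2) ?lerD//; ring.
Qed.

Lemma dif2_dif2_consistent :
  (forall k (x y : R), (k < 4)%N ->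
     is_derive x 1 (fun x => G k 0 x y) (G k.+1 0 x y)) ->
  (forall k j (x y : R), (k + j < 6)%N ->
     is_derive y 1 (G k j x) (G k j.+1 x y)) ->
  (forall x y, a0 <= x <= a1 -> b0 <= y <= b1 -> `|G 4 2 x y| <= K) ->
  (forall x y, a0 <= x <= a1 -> b0 <= y <= b1 -> `|G 2 4 x y| <= K) ->
  `|dif2 h (fun x => dif2 h (G 0%N 0%N x) b) a - G 2 2 a b|
    <= 6 * K * h ^+ 2.
Proof.
move=> dA dB K42 K24.
pose g k x := dif2 h (G k 0 x) b.
have aa : a0 <= a <= a1 by move: h0 al au; lra.
have A1 : `|dif2 h (g 0%N) a - g 2 a| <= 2 * (2 * K) * h ^+ 2.
  apply: (dif2_consistent h0 al au) => [k z k3|z zB].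
    by apply: is_derive_comb3; exact: dA.
  apply: (dif2_bounded h0 bl bu (f := fun j => G 4 j z)) => [j w j2|w wB].
    by apply: dB; lia.
  exact: K42.
have A2 : `|g 2 a - G 2 2 a b| <= 2 * K * h ^+ 2.
  apply: (dif2_consistent h0 bl bu (f := fun j => G 2 j a)) => [k w k3|w wB].
    by apply: dB.
  exact: K24.
rewrite (_ : dif2 h _ a - _ = (dif2 h (g 0%N) a - g 2 a) + (g 2 a - G 2 2 a b));
  last by rewrite /g; ring.
apply: le_trans (ler_normD _ _) _.
rewrite (_ : 6 * K * h ^+ 2 = 2 * (2 * K) * h ^+ 2 + 2 * K * h ^+ 2) ?lerD//.
by ring.
Qed.

End two_variables.

(** * Partial derivatives of space-time functions *)

Notation sx := (Defs.Space 0).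
Notation sy := (Defs.Space 1).

Lemma sum_ord2 (R : nmodType) (F : 'I_2 -> R) : \sum_(k < 2) F k = F 0 + F 1.
Proof.
rewrite !big_ord_recl big_ord0 addr0; congr (F _ + F _); exact: val_inj.
Qed.

Section classC_calculus.
Variable R : realType.
Implicit Types (u v : R -> R -> R -> R) (s : seq axis) (d : axis).

Lemma pds_cat s s' u : pds (s ++ s') u = pds s (pds s' u).
Proof. exact: foldr_cat. Qed.

Lemma classC_pds k s u :
  (size s <= k)%N -> classC k u -> classC (k - size s) (pds s u).
Proof.
move=> sk cu s' ss'; rewrite -pds_cat.
have /cu[c d] : (size (s' ++ s) <= k)%N by rewrite size_cat; lia.
by split => // ss'' d' x y t; apply: d; rewrite size_cat; lia.
Qed.

Lemma classCW k k' u : (k' <= k)%N -> classC k u -> classC k' u.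
Proof.
move=> kk cu s ss; have [c d] := cu s (leq_trans ss kk); split=> // ss' d' x y t.
by apply: d; lia.
Qed.

Lemma classC_continuous k u :
  classC k u -> continuous (fun q : R * R * R => u q.1.1 q.1.2 q.2).
Proof. by move=> /(_ [::])[]. Qed.

Lemma classC_derivable k u d (x y t : R) : (0 < k)%N -> classC k u ->
  derivable (slice d u x y t) (axis_coord d x y t) 1.
Proof. by move=> k0 /(_ [::] isT)[_ /(_ k0)]; exact. Qed.

Lemma is_derive_pd k u d (x y t : R) : (0 < k)%N -> classC k u ->
  is_derive (axis_coord d x y t) 1 (slice d u x y t) (pd d u x y t).
Proof.
move=> k0 cu; rewrite /pd derive1E; apply/derivableP.
exact: classC_derivable k0 cu.
Qed.

Lemma is_derive_pdx k u (x y t : R) : (0 < k)%N -> classC k u ->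
  is_derive x 1 (fun z => u z y t) (pd sx u x y t).
Proof. by move=> k0 cu; exact: (@is_derive_pd _ _ sx x y t k0 cu). Qed.

Lemma is_derive_pdy k u (x y t : R) : (0 < k)%N -> classC k u ->
  is_derive y 1 (fun z => u x z t) (pd sy u x y t).
Proof. by move=> k0 cu; exact: (@is_derive_pd _ _ sy x y t k0 cu). Qed.

Lemma is_derive_pdt k u (x y t : R) : (0 < k)%N -> classC k u ->
  is_derive t 1 (fun z => u x y z) (pd Time u x y t).
Proof. by move=> k0 cu; exact: (@is_derive_pd _ _ Time x y t k0 cu). Qed.

Lemma pdD k u v d : (0 < k)%N -> classC k u -> classC k v ->
  pd d (fun x y t => u x y t + v x y t) =
  fun x y t => pd d u x y t + pd d v x y t.
Proof.
move=> k0 cu cv; apply/funext => x; apply/funext => y; apply/funext => t.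
rewrite /pd !derive1E.
have dU := @classC_derivable _ _ d x y t k0 cu.
have dV := @classC_derivable _ _ d x y t k0 cv.
rewrite -deriveD// (_ : slice _ _ _ _ _ = slice d u x y t + slice d v x y t)//.
by case: d {dU dV} => [i|] //=; case: ifP.
Qed.

Lemma lapE u : lap u = fun x y t => pd sx (pd sx u) x y t
  + pd sy (pd sy u) x y t.
Proof.
apply/funext => x; apply/funext => y; apply/funext => t.
exact: sum_ord2.
Qed.

(** The two mixed terms are kept apart because [pds] records the order of differentiation; in
    [bilap_consistent] each of them is compared with one copy of the same mixed difference. *)
Lemma lap_lapE u : classC 4 u -> lap (lap u) = fun x y t =>
  pds [:: sx; sx; sx; sx] u x y t
  + pds [:: sx; sx; sy; sy] u x y t
  + (pds [:: sy; sy; sx; sx] u x y t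
  + pds [:: sy; sy; sy; sy] u x y t).
Proof.
move=> cu; rewrite !lapE.
have c00 := @classC_pds 4 [:: sx; sx] u isT cu.
have c11 := @classC_pds 4 [:: sy; sy] u isT cu.
have c00' i := @classC_pds 2 [:: Defs.Space i] _ isT c00.
have c11' i := @classC_pds 2 [:: Defs.Space i] _ isT c11.
rewrite (@pdD 2 _ _ sx isT c00 c11) (@pdD 2 _ _ sy isT c00 c11).
by rewrite (@pdD 1 _ _ sx isT (c00' 0) (c11' 0)) (@pdD 1 _ _ sy isT (c00' 1) (c11' 1)).
Qed.

End classC_calculus.

(** * Consistency of the difference operators *)

Lemma is_derive_addr (R : realType) (f : R -> R) (x b df : R) :
  is_derive (x + b) 1 f df -> is_derive x 1 (fun z => f (z + b)) df.
Proof.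
move=> fE; have sE : is_derive x 1 (fun z : R => z + b) 1.
  by apply: is_derive_eq; rewrite addr0.
have := @is_derive1_comp _ f (fun z : R => z + b) x df 1 fE sE.
by rewrite mulr1.
Qed.

Lemma is_derive_addl (R : realType) (f : R -> R) (x b df : R) :
  is_derive (b + x) 1 f df -> is_derive x 1 (fun z => f (b + z)) df.
Proof.
rewrite addrC => /is_derive_addr; congr is_derive.
by apply/funext => z; rewrite addrC.
Qed.

Section backward_difference.
Variables (R : realType) (f : nat -> R -> R) (a b t dt K : R).
Hypotheses (dt0 : 0 < dt) (al : a <= t) (bu : t + dt <= b).

Lemma backward_consistent :
  (forall k (z : R), (k < 2)%N -> is_derive z 1 (f k) (f k.+1 z)) ->
  (forall z, a <= z <= b -> `|f 2 z| <= K) ->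
  `|(f 0%N (t + dt) - f 0%N t) / dt - f 1%N (t + dt)| <= K * dt.
Proof.
move=> df fK.
have tab : a <= t <= b by move: dt0 al bu; lra.
have sab : a <= t + dt <= b by move: dt0 al bu; lra.
have := taylor_bound df fK sab tab.
rewrite !big_ord_recl big_ord0 /= /bump /= fact0 expr0 mulr1 !divr1 addr0.
rewrite (_ : t - (t + dt) = - dt); last by ring.
rewrite normrN (gtr0_norm dt0) => T.
have -> : (f 0%N (t + dt) - f 0%N t) / dt - f 1%N (t + dt) =
    - (f 0%N t - (f 0%N (t + dt) + f 1%N (t + dt) * - dt)) / dt.
  by field; rewrite gt_eqF.
rewrite normrM normrN normfV (gtr0_norm dt0) ler_pdivrMr//.
by rewrite -mulrA -expr2.
Qed.

Lemma backward_bounded :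
  (forall z : R, is_derive z 1 (f 0%N) (f 1%N z)) ->
  (forall z, a <= z <= b -> `|f 1%N z| <= K) ->
  `|(f 0%N (t + dt) - f 0%N t) / dt| <= K.
Proof.
move=> df fK; rewrite normrM normfV (gtr0_norm dt0) ler_pdivrMr//.
rewrite -{2}(gtr0_norm dt0) (_ : dt = t + dt - t); last by ring.
rewrite (_ : t + (t + dt - t) = t + dt); last by ring.
apply: mean_value_bound => // z.
rewrite min_l ?max_r; [|move: dt0; lra..] => zt; apply: fK.
by move: dt0 al bu zt; lra.
Qed.

End backward_difference.

Section grid_differences.
Variables (R : realType) (u : R -> R -> R -> R) (h t : R).
Implicit Types l m : int.

Let shiftB (l : int) : (l - 1)%:~R * h = l%:~R * h - h.
Proof. by rewrite intrB mulrBl mul1r. Qed.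
Let shiftD (l : int) : (l + 1)%:~R * h = l%:~R * h + h.
Proof. by rewrite intrD mulrDl mul1r. Qed.

Lemma DD00E (g : grid_fun R) l m :
  DD h 0 0 g l m = (g (l - 1) m - 2 * g l m + g (l + 1) m) / h ^+ 2.
Proof. by rewrite /DD !eqxx. Qed.

Lemma DD11E (g : grid_fun R) l m :
  DD h 1 1 g l m = (g l (m - 1) - 2 * g l m + g l (m + 1)) / h ^+ 2.
Proof. by rewrite /DD eqxx. Qed.

Lemma DDCE (i j : 'I_2) (g : grid_fun R) l m : i != j ->
  DD h i j g l m = (g (l - 1) (m - 1) + g (l + 1) (m + 1)
        - g (l - 1) (m + 1) - g (l + 1) (m - 1)) / (4 * h ^+ 2).
Proof. by rewrite /DD => /negbTE->. Qed.

Lemma DD00_sample l m :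
  DD h 0 0 (sample h t u) l m = dif2 h (fun x => u x (m%:~R * h) t) (l%:~R * h).
Proof. by rewrite DD00E /sample shiftB shiftD. Qed.

Lemma DD11_sample l m :
  DD h 1 1 (sample h t u) l m = dif2 h (fun y => u (l%:~R * h) y t) (m%:~R * h).
Proof. by rewrite DD11E /sample shiftB shiftD. Qed.

Lemma DDC_sample (i j : 'I_2) l m : i != j -> h != 0 ->
  DD h i j (sample h t u) l m =
  dif1 h (fun x => dif1 h (fun y => u x y t) (m%:~R * h)) (l%:~R * h).
Proof.
move=> ij h0; rewrite DDCE// /sample !shiftB !shiftD /dif1.
by field.
Qed.

(** Iterating the second difference along one axis is a mixed second difference of (a, b) |-> u (a +
    b) y t, so that the two-variable estimate also covers the pure fourth differences. *)
Lemma DD0000_sample l m :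
  DD h 0 0 (DD h 0 0 (sample h t u)) l m =
  dif2 h (fun a => dif2 h (fun b => u (a + b) (m%:~R * h) t) 0) (l%:~R * h).
Proof.
by rewrite DD00E !DD00_sample shiftB shiftD /dif2 !addr0 !add0r.
Qed.

Lemma DD0011_sample l m :
  DD h 0 0 (DD h 1 1 (sample h t u)) l m =
  dif2 h (fun a => dif2 h (fun b => u a b t) (m%:~R * h)) (l%:~R * h).
Proof. by rewrite DD00E !DD11_sample shiftB shiftD. Qed.

Lemma DD1111_sample l m :
  DD h 1 1 (DD h 1 1 (sample h t u)) l m =
  dif2 h (fun a => dif2 h (fun b => u (l%:~R * h) (a + b) t) 0) (m%:~R * h).
Proof.
by rewrite DD11E !DD11_sample shiftB shiftD /dif2 !addr0 !add0r.
Qed.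

Lemma dif2C (g : R -> R -> R) x y : h != 0 ->
  dif2 h (fun a => dif2 h (g a) y) x = dif2 h (fun b => dif2 h (g^~ b) x) y.
Proof. by move=> h0; rewrite /dif2; field. Qed.

Lemma dif1C (g : R -> R -> R) x y : h != 0 ->
  dif1 h (fun a => dif1 h (g a) y) x = dif1 h (fun b => dif1 h (g^~ b) x) y.
Proof. by move=> h0; rewrite /dif1; field. Qed.

End grid_differences.

Section truncation.
Variables (R : realType) (u : R -> R -> R -> R) (n : nat) (a b T K h t : R).
Hypotheses (cu : classC n u) (uK : derivs_le n u a b T K).
Hypotheses (h0 : 0 < h) (t0T : 0 <= t <= T).

Lemma is_derive_pdsx s (x y w : R) : (size s < n)%N ->
  is_derive x 1 (fun z => pds s u z y w) (pds (sx :: s) u x y w).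
Proof.
move=> sn; apply: (@is_derive_pdx _ (n - size s)); first by rewrite subn_gt0.
exact: classC_pds (ltnW sn) cu.
Qed.

Lemma is_derive_pdsy s (x y w : R) : (size s < n)%N ->
  is_derive y 1 (fun z => pds s u x z w) (pds (sy :: s) u x y w).
Proof.
move=> sn; apply: (@is_derive_pdy _ (n - size s)); first by rewrite subn_gt0.
exact: classC_pds (ltnW sn) cu.
Qed.

Lemma is_derive_pdst s (x y w : R) : (size s < n)%N ->
  is_derive w 1 (fun z => pds s u x y z) (pds (Time :: s) u x y w).
Proof.
move=> sn; apply: (@is_derive_pdt _ (n - size s)); first by rewrite subn_gt0.
exact: classC_pds (ltnW sn) cu.
Qed.

Variables x y : R.
Hypotheses (xl : a <= x - h) (xu : x + h <= b).
Hypotheses (yl : a <= y - h) (yu : y + h <= b).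

Let xab : a <= x <= b. Proof. by move: h0 xl xu; lra. Qed.
Let yab : a <= y <= b. Proof. by move: h0 yl yu; lra. Qed.
Let hN0 : h != 0. Proof. by rewrite gt_eqF. Qed.

Lemma dif2x_consistent : (4 <= n)%N ->
  `|dif2 h (fun x => u x y t) x - pds [:: sx; sx] u x y t| <= 2 * K * h ^+ 2.
Proof.
move=> n4; apply: (dif2_consistent h0 xl xu
    (f := fun k z => pds (nseq k sx) u z y t)) => [k z k4|z zab].
  apply: is_derive_pdsx.
  rewrite size_nseq.
  exact: leq_trans n4.
by apply: uK => //; rewrite n4.
Qed.

Lemma dif2y_consistent : (4 <= n)%N ->
  `|dif2 h (fun y => u x y t) y - pds [:: sy; sy] u x y t| <= 2 * K * h ^+ 2.
Proof.
move=> n4; apply: (dif2_consistent h0 yl yu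
    (f := fun k z => pds (nseq k sy) u x z t)) => [k z k4|z zab].
  by apply: is_derive_pdsy; rewrite size_nseq; exact: leq_trans k4 n4.
by apply: uK => //; rewrite n4.
Qed.

Lemma dif1xy_consistent : (4 <= n)%N ->
  `|dif1 h (fun x => dif1 h (fun y => u x y t) y) x - pds [:: sy; sx] u x y t|
    <= 2 * K * h ^+ 2.
Proof.
move=> n4; apply: (dif1_dif1_consistent h0 xl xu yl yu
    (G := fun k j x y => pds (nseq j sy ++ nseq k sx) u x y t))
    => [k x' y' k4|k j x' y' kj|x' y' xB yB|x' y' xB yB].
- by apply: is_derive_pdsx; rewrite size_nseq; exact: leq_trans k4 (leq_trans (isT : (3 <= 4)%N) n4).
- by apply: is_derive_pdsy; rewrite size_cat !size_nseq addnC; exact: leq_trans kj n4.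
- by apply: uK => //; rewrite n4.
- by apply: uK => //; rewrite n4.
Qed.

Lemma dif1yx_consistent : (4 <= n)%N ->
  `|dif1 h (fun x => dif1 h (fun y => u x y t) y) x - pds [:: sx; sy] u x y t|
    <= 2 * K * h ^+ 2.
Proof.
move=> n4; rewrite dif1C//; apply: (dif1_dif1_consistent h0 yl yu xl xu
    (G := fun k j y x => pds (nseq j sx ++ nseq k sy) u x y t))
    => [k x' y' k4|k j x' y' kj|x' y' xB yB|x' y' xB yB].
- by apply: is_derive_pdsy; rewrite size_nseq; exact: leq_trans k4 (leq_trans (isT : (3 <= 4)%N) n4).
- by apply: is_derive_pdsx; rewrite size_cat !size_nseq addnC; exact: leq_trans kj n4.
- by apply: uK => //; rewrite n4.
- by apply: uK => //; rewrite n4.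
Qed.

Lemma dif2xy_consistent : (6 <= n)%N ->
  `|dif2 h (fun x => dif2 h (fun y => u x y t) y) x
     - pds [:: sy; sy; sx; sx] u x y t| <= 6 * K * h ^+ 2.
Proof.
move=> n4; apply: (dif2_dif2_consistent h0 xl xu yl yu
    (G := fun k j x y => pds (nseq j sy ++ nseq k sx) u x y t))
    => [k x' y' k4|k j x' y' kj|x' y' xB yB|x' y' xB yB].
- by apply: is_derive_pdsx; rewrite size_nseq; exact: leq_trans k4 (leq_trans (isT : (4 <= 6)%N) n4).
- by apply: is_derive_pdsy; rewrite size_cat !size_nseq addnC; exact: leq_trans kj n4.
- by apply: uK => //; rewrite n4.
- by apply: uK => //; rewrite n4.
Qed.

Lemma dif2yx_consistent : (6 <= n)%N ->
  `|dif2 h (fun x => dif2 h (fun y => u x y t) y) x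
     - pds [:: sx; sx; sy; sy] u x y t| <= 6 * K * h ^+ 2.
Proof.
move=> n4; rewrite dif2C//; apply: (dif2_dif2_consistent h0 yl yu xl xu
    (G := fun k j y x => pds (nseq j sx ++ nseq k sy) u x y t))
    => [k x' y' k4|k j x' y' kj|x' y' xB yB|x' y' xB yB].
- by apply: is_derive_pdsy; rewrite size_nseq; exact: leq_trans k4 (leq_trans (isT : (4 <= 6)%N) n4).
- by apply: is_derive_pdsx; rewrite size_cat !size_nseq addnC; exact: leq_trans kj n4.
- by apply: uK => //; rewrite n4.
- by apply: uK => //; rewrite n4.
Qed.

Lemma dif2xx_consistent : (6 <= n)%N -> a <= x - 2 * h -> x + 2 * h <= b ->
  `|dif2 h (fun z => dif2 h (fun z' => u (z + z') y t) 0) x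
     - pds [:: sx; sx; sx; sx] u x y t| <= 6 * K * h ^+ 2.
Proof.
move=> n6 l2 u2; pose G := fun k j a' b' => pds (nseq (j + k) sx) u (a' + b') y t.
have bl : - h <= 0 - h by rewrite sub0r.
have bu : 0 + h <= h by rewrite add0r.
have H : `|dif2 h (fun z => dif2 h (fun z' => u (z + z') y t) 0) x - pds [:: sx; sx; sx; sx] u (x + 0) y t| <= 6 * K * h ^+ 2.
  apply: (@dif2_dif2_consistent _ G _ _ _ _ _ _ _ K h0 (lexx _) (lexx _) bl bu).
  - move=> k a' b' k4; have sz : (size (nseq k sx) < n)%N.
      by rewrite size_nseq; exact: leq_trans k4 (leq_trans (isT : (4 <= 6)%N) n6).
    exact: (is_derive_addr (f := fun z => pds (nseq k sx) u z y t) (is_derive_pdsx _ _ _ sz)).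
  - move=> k j a' b' kj; have sz : (size (nseq (j + k) sx) < n)%N.
      by rewrite size_nseq addnC; exact: leq_trans kj n6.
    exact: (is_derive_addl (f := fun z => pds (nseq (j + k) sx) u z y t) (is_derive_pdsx _ _ _ sz)).
  - by move=> a' b' aB bB; apply: uK => //; move: l2 u2 aB bB; lra.
  - by move=> a' b' aB bB; apply: uK => //; move: l2 u2 aB bB; lra.
by move: H; rewrite addr0.
Qed.

Lemma dif2yy_consistent : (6 <= n)%N -> a <= y - 2 * h -> y + 2 * h <= b ->
  `|dif2 h (fun z => dif2 h (fun z' => u x (z + z') t) 0) y
     - pds [:: sy; sy; sy; sy] u x y t| <= 6 * K * h ^+ 2.
Proof.
move=> n6 l2 u2; pose G := fun k j a' b' => pds (nseq (j + k) sy) u x (a' + b') t.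
have bl : - h <= 0 - h by rewrite sub0r.
have bu : 0 + h <= h by rewrite add0r.
have H : `|dif2 h (fun z => dif2 h (fun z' => u x (z + z') t) 0) y - pds [:: sy; sy; sy; sy] u x (y + 0) t| <= 6 * K * h ^+ 2.
  apply: (@dif2_dif2_consistent _ G _ _ _ _ _ _ _ K h0 (lexx _) (lexx _) bl bu).
  - move=> k a' b' k4; have sz : (size (nseq k sy) < n)%N.
      by rewrite size_nseq; exact: leq_trans k4 (leq_trans (isT : (4 <= 6)%N) n6).
    exact: (is_derive_addr (f := fun z => pds (nseq k sy) u x z t) (is_derive_pdsy _ _ _ sz)).
  - move=> k j a' b' kj; have sz : (size (nseq (j + k) sy) < n)%N.
      by rewrite size_nseq addnC; exact: leq_trans kj n6.
    exact: (is_derive_addl (f := fun z => pds (nseq (j + k) sy) u x z t) (is_derive_pdsy _ _ _ sz)).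
  - by move=> a' b' aB bB; apply: uK => //; move: l2 u2 aB bB; lra.
  - by move=> a' b' aB bB; apply: uK => //; move: l2 u2 aB bB; lra.
by move: H; rewrite addr0.
Qed.

End truncation.

Lemma ord2P (i : 'I_2) : i = 0 \/ i = 1.
Proof. by case: i => [[|[|//]] ilt]; [left|right]; apply: val_inj. Qed.

Lemma derivs_leW (R : realType) (k k' : nat) (u : R -> R -> R -> R)
    (a b a' b' T K K' : R) : (k' <= k)%N -> a <= a' -> b' <= b -> K <= K' ->
  derivs_le k u a b T K -> derivs_le k' u a' b' T K'.
Proof.
move=> kk aa bb KK uK s /andP[s0 sk] x y t xB yB tB.
apply: le_trans KK; apply: uK => //; first by rewrite s0 (leq_trans sk).
  by move: aa bb xB; lra.
by move: aa bb yB; lra.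
Qed.

Lemma norm_add_le (R : realDomainType) (x y a b : R) :
  `|x| <= a -> `|y| <= b -> `|x + y| <= a + b.
Proof. by move=> xa yb; apply: le_trans (ler_normD _ _) _; exact: lerD. Qed.

Lemma norm_sub_le (R : realDomainType) (x y a b : R) :
  `|x| <= a -> `|y| <= b -> `|x - y| <= a + b.
Proof. by move=> xa yb; apply: le_trans (ler_normB _ _) _; exact: lerD. Qed.

Lemma norm_mul_le (R : realDomainType) (x y a b : R) :
  `|x| <= a -> `|y| <= b -> `|x * y| <= a * b.
Proof. by move=> xa yb; rewrite normrM ler_pM. Qed.

Section node_truncation.
Variables (R : realType) (u : R -> R -> R -> R) (n : nat) (a b T K h t : R).
Hypotheses (cu : classC n u) (uK : derivs_le n u a b T K).
Hypotheses (h0 : 0 < h) (t0T : 0 <= t <= T).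
Variables l m : int.
Let x := l%:~R * h.
Let y := m%:~R * h.
Hypotheses (xl : a <= x - h) (xu : x + h <= b).
Hypotheses (yl : a <= y - h) (yu : y + h <= b).

Lemma DD_consistent (i j : 'I_2) : (4 <= n)%N ->
  `|DD h i j (sample h t u) l m
     - pd (Defs.Space i) (pd (Defs.Space j) u) x y t| <= 2 * K * h ^+ 2.
Proof.
have hN0 : h != 0 by rewrite gt_eqF.
move=> n4; have [->|->] := ord2P i; have [->|->] := ord2P j.
- by rewrite DD00_sample; exact: (dif2x_consistent cu uK).
- rewrite (DDC_sample _ _ _ _ (isT : 0 != 1 :> 'I_2) hN0).
  exact: (dif1yx_consistent cu uK h0 t0T xl xu yl yu n4).
- rewrite (DDC_sample _ _ _ _ (isT : 1 != 0 :> 'I_2) hN0).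
  exact: (dif1xy_consistent cu uK h0 t0T xl xu yl yu n4).
- by rewrite DD11_sample; exact: (dif2y_consistent cu uK).
Qed.

Lemma lap_consistent : (4 <= n)%N ->
  `|lap_h h (sample h t u) l m - lap u x y t| <= 4 * K * h ^+ 2.
Proof.
move=> n4; rewrite /lap_h /lap !sum_ord2.
rewrite (_ : 4 * K * h ^+ 2 = 2 * K * h ^+ 2 + 2 * K * h ^+ 2); last by ring.
by rewrite opprD addrACA; apply: norm_add_le; exact: DD_consistent.
Qed.

Lemma bilap_consistent : (6 <= n)%N ->
  a <= x - 2 * h -> x + 2 * h <= b -> a <= y - 2 * h -> y + 2 * h <= b ->
  `|bilap_h h (sample h t u) l m - lap (lap u) x y t| <= 24 * K * h ^+ 2.
Proof.
move=> n6 xl2 xu2 yl2 yu2.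
rewrite /bilap_h DD0000_sample DD0011_sample DD1111_sample -/x -/y.
rewrite lap_lapE; last exact: classCW (leq_trans (isT : (4 <= 6)%N) n6) cu.
have Hxx := dif2xx_consistent cu uK h0 t0T yl yu n6 xl2 xu2.
have Hyy := dif2yy_consistent cu uK h0 t0T xl xu n6 yl2 yu2.
have Hxy := dif2xy_consistent cu uK h0 t0T xl xu yl yu n6.
have Hyx := dif2yx_consistent cu uK h0 t0T xl xu yl yu n6.
move: Hxx Hyy Hxy Hyx.
set A := dif2 _ _ _; set B := dif2 _ _ _; set C := dif2 _ _ _.
set a1 := pds _ _ _ _ _; set b1 := pds _ _ _ _ _.
set c1 := pds _ _ _ _ _; set d1 := pds _ _ _ _ _.
move=> HA HB HC HD.
rewrite (_ : A + 2 * C + B - (a1 + d1 + (c1 + b1)) =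
  (A - a1) + (C - d1) + (C - c1) + (B - b1)); last by ring.
rewrite (_ : 24 * K * h ^+ 2 = 6 * K * h ^+ 2 + 6 * K * h ^+ 2
  + 6 * K * h ^+ 2 + 6 * K * h ^+ 2); last by ring.
exact: norm_add_le (norm_add_le (norm_add_le HA HD) HC) HB.
Qed.

End node_truncation.

Section normal_derivative_truncation.
Variables (R : realType) (c : R -> R -> R -> R) (a b T K h t dt : R).
Hypotheses (cc : classC 4 c) (cK : derivs_le 4 c a b T K).
Hypotheses (h0 : 0 < h) (dt0 : 0 < dt) (t0 : 0 <= t) (tT : t + dt <= T).
Variables x y : R.
Hypotheses (xab : a <= x <= b) (yab : a <= y <= b).

(** The time quotient is formed first: its third x-derivative is bounded uniformly in [dt] by a
    mixed derivative of order 4, which gives the error in h^2; the remaining time error is that of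
    the quotient of d_x c. Time derivatives stay outermost, as in the boundary condition for
    [dnx]. *)
Lemma dif1x_time_consistent : a <= x - h -> x + h <= b ->
  `|dif1 h (fun z => (c z y (t + dt) - c z y t) / dt) x
     - pds [:: Time; sx] c x y (t + dt)| <= K * (h ^+ 2 + dt).
Proof.
move=> xl xu.
pose g k z := (pds (nseq k sx) c z y (t + dt) - pds (nseq k sx) c z y t) / dt.
have H1 : `|dif1 h (g 0%N) x - g 1%N x| <= K * h ^+ 2.
  apply: (dif1_consistent h0 xl xu) => [k z k3|z zab].
    by apply: is_derive_comb2; apply: (is_derive_pdsx cc);
      rewrite size_nseq; exact: leq_trans k3 (isT : (3 <= 4)%N).
  apply: (@backward_bounded _ (fun j s => pds (nseq j Time ++ nseq 3 sx) c z y s) 0 T _ _ _ dt0 t0 tT).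
    by move=> s; exact: (is_derive_pdst cc (s := nseq 3 sx)).
  by move=> s sT; exact: cK.
have H2 : `|g 1%N x - pds [:: Time; sx] c x y (t + dt)| <= K * dt.
  apply: (@backward_consistent _ (fun j s => pds (nseq j Time ++ nseq 1 sx) c x y s) 0 T _ _ _ dt0 t0 tT).
    move=> k s k2; apply: (is_derive_pdst cc).
    by rewrite size_cat !size_nseq addn1 ltnS; exact: leq_trans k2 (isT : (2 <= 3)%N).
  by move=> s sT; exact: cK.
rewrite mulrDr (_ : _ - _ = (dif1 h (g 0%N) x - g 1%N x) +
  (g 1%N x - pds [:: Time; sx] c x y (t + dt))); last by rewrite /g /=; ring.
exact: norm_add_le.
Qed.

Lemma dif1y_time_consistent : a <= y - h -> y + h <= b ->
  `|dif1 h (fun z => (c x z (t + dt) - c x z t) / dt) y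
     - pds [:: Time; sy] c x y (t + dt)| <= K * (h ^+ 2 + dt).
Proof.
move=> yl yu.
pose g k z := (pds (nseq k sy) c x z (t + dt) - pds (nseq k sy) c x z t) / dt.
have H1 : `|dif1 h (g 0%N) y - g 1%N y| <= K * h ^+ 2.
  apply: (dif1_consistent h0 yl yu) => [k z k3|z zab].
    by apply: is_derive_comb2; apply: (is_derive_pdsy cc);
      rewrite size_nseq; exact: leq_trans k3 (isT : (3 <= 4)%N).
  apply: (@backward_bounded _ (fun j s => pds (nseq j Time ++ nseq 3 sy) c x z s) 0 T _ _ _ dt0 t0 tT).
    by move=> s; exact: (is_derive_pdst cc (s := nseq 3 sy)).
  by move=> s sT; exact: cK.
have H2 : `|g 1%N y - pds [:: Time; sy] c x y (t + dt)| <= K * dt.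
  apply: (@backward_consistent _ (fun j s => pds (nseq j Time ++ nseq 1 sy) c x y s) 0 T _ _ _ dt0 t0 tT).
    move=> k s k2; apply: (is_derive_pdst cc).
    by rewrite size_cat !size_nseq addn1 ltnS; exact: leq_trans k2 (isT : (2 <= 3)%N).
  by move=> s sT; exact: cK.
rewrite mulrDr (_ : _ - _ = (dif1 h (g 0%N) y - g 1%N y) +
  (g 1%N y - pds [:: Time; sy] c x y (t + dt))); last by rewrite /g /=; ring.
exact: norm_add_le.
Qed.

Lemma time_consistent : `|(c x y (t + dt) - c x y t) / dt - pd Time c x y (t + dt)|
  <= K * dt.
Proof.
apply: (@backward_consistent _ (fun j s => pds (nseq j Time) c x y s) 0 T _ _ _ dt0 t0 tT).
  move=> k s k2; apply: (is_derive_pdst cc).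
  by rewrite size_nseq; exact: leq_trans k2 (isT : (2 <= 4)%N).
by move=> s sT; exact: cK.
Qed.

Lemma time_lipschitz : `|c x y (t + dt) - c x y t| <= K * dt.
Proof.
have := @backward_bounded _ (fun j s => pds (nseq j Time) c x y s) 0 T t dt K dt0 t0 tT.
rewrite /= normrM normfV (gtr0_norm dt0) ler_pdivrMr//; apply.
  by move=> s; exact: (is_derive_pdst cc (s := [::])).
by move=> s sT; exact: (cK (s := [:: Time])).
Qed.

Lemma pd_dnx : pd Time (dnx c) x y t =
  if x == 0 then - pds [:: Time; sx] c x y t else pds [:: Time; sx] c x y t.
Proof.
have -> : pd Time (dnx c) x y t =
  derive1 (fun s => if x == 0 then - pd sx c x y s else pd sx c x y s) t by [].
case: ifP => // _; rewrite derive1E.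
have d := @is_derive_pdst _ c 4 cc [:: sx] x y t isT.
have dN := @is_deriveN _ _ _ (fun s => pds [:: sx] c x y s) t 1 _ d.
exact: derive_val.
Qed.

Lemma pd_dny : pd Time (dny c) x y t =
  if y == 0 then - pds [:: Time; sy] c x y t else pds [:: Time; sy] c x y t.
Proof.
have -> : pd Time (dny c) x y t =
  derive1 (fun s => if y == 0 then - pd sy c x y s else pd sy c x y s) t by [].
case: ifP => // _; rewrite derive1E.
have d := @is_derive_pdst _ c 4 cc [:: sy] x y t isT.
have dN := @is_deriveN _ _ _ (fun s => pds [:: sy] c x y s) t 1 _ d.
exact: derive_val.
Qed.

End normal_derivative_truncation.

Section grid_normal_derivative.
Variables (R : realType) (c : R -> R -> R -> R) (L T K t dt : R) (N : nat).
Let h := L / N%:R.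
Hypotheses (L0 : 0 < L) (N0 : (0 < N)%N).
Hypotheses (cc : classC 4 c) (cK : derivs_le 4 c (- h) (L + h) T K).
Hypotheses (dt0 : 0 < dt) (t0 : 0 <= t) (tT : t + dt <= T).

Lemma mesh_gt0 : 0 < h. Proof. by rewrite divr_gt0// ltr0n. Qed.

Lemma mesh_N : (N%:Z)%:~R * h = L.
Proof.
by rewrite /h mulrCA -pmulrn divff ?mulr1// pnatr_eq0 -lt0n.
Qed.

Lemma mesh_in (m : int) : 0 <= m <= N%:Z -> 0 <= m%:~R * h <= L.
Proof.
move=> /andP[m0 mN]; rewrite -mesh_N mulr_ge0 ?ler0z ?(ltW mesh_gt0)//=.
by rewrite ler_pM2r ?mesh_gt0// ler_int.
Qed.

Lemma Dnx_time_consistent (l m : int) :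
  (l == 0) || (l == N%:Z) -> 0 <= m <= N%:Z ->
  `|(Dnx h N (sample h (t + dt) c) l m - Dnx h N (sample h t c) l m) / dt
    - pd Time (dnx c) (l%:~R * h) (m%:~R * h) (t + dt)| <= K * (h ^+ 2 + dt).
Proof.
move=> lB mB; have hgt := mesh_gt0; have mI := mesh_in mB.
have yab : - h <= m%:~R * h <= L + h by move: mI hgt; lra.
have xab : - h <= l%:~R * h - h /\ l%:~R * h + h <= L + h.
  by case/orP: lB => /eqP ->; rewrite ?mesh_N; split; move: hgt L0; lra.
have xab' : - h <= l%:~R * h <= L + h by move: xab hgt; lra.
have := dif1x_time_consistent cc cK hgt dt0 t0 tT xab' yab xab.1 xab.2.
rewrite pd_dnx//.
case/orP: lB => /eqP ->.
  rewrite !mul0r eqxx => H; rewrite /Dnx eqxx /sample mulrN1z mul1r mulN1r.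
  apply: le_trans H; rewrite le_eqVlt; apply/orP; left; apply/eqP.
  rewrite -[RHS]normrN; congr `| _ |; rewrite /dif1 sub0r add0r; field.
  by rewrite !gt_eqF ?addr_gt0.
rewrite mesh_N gt_eqF// => H; rewrite /Dnx /sample !intrD !mulrDl mesh_N mul1r.
rewrite (_ : (N%:Z == 0) = false); last by rewrite gt_eqF.
apply: le_trans H; rewrite le_eqVlt; apply/orP; left; apply/eqP.
congr `| _ |; rewrite /dif1 mulrN1z mulN1r; field.
by rewrite !gt_eqF ?addr_gt0.
Qed.

Lemma Dny_time_consistent (l m : int) :
  (m == 0) || (m == N%:Z) -> 0 <= l <= N%:Z ->
  `|(Dny h N (sample h (t + dt) c) l m - Dny h N (sample h t c) l m) / dt
    - pd Time (dny c) (l%:~R * h) (m%:~R * h) (t + dt)| <= K * (h ^+ 2 + dt).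
Proof.
move=> mB lB; have hgt := mesh_gt0; have lI := mesh_in lB.
have xab : - h <= l%:~R * h <= L + h by move: lI hgt; lra.
have yab : - h <= m%:~R * h - h /\ m%:~R * h + h <= L + h.
  by case/orP: mB => /eqP ->; rewrite ?mesh_N; split; move: hgt L0; lra.
have yab' : - h <= m%:~R * h <= L + h by move: yab hgt; lra.
have := dif1y_time_consistent cc cK hgt dt0 t0 tT xab yab' yab.1 yab.2.
rewrite pd_dny//.
case/orP: mB => /eqP ->.
  rewrite !mul0r eqxx => H; rewrite /Dny eqxx /sample mulrN1z mul1r mulN1r.
  apply: le_trans H; rewrite le_eqVlt; apply/orP; left; apply/eqP.
  rewrite -[RHS]normrN; congr `| _ |; rewrite /dif1 sub0r add0r; field.
  by rewrite !gt_eqF ?addr_gt0.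
rewrite mesh_N gt_eqF// => H; rewrite /Dny /sample !intrD !mulrDl mesh_N mul1r.
rewrite (_ : (N%:Z == 0) = false); last by rewrite gt_eqF.
apply: le_trans H; rewrite le_eqVlt; apply/orP; left; apply/eqP.
congr `| _ |; rewrite /dif1 mulrN1z mulN1r; field.
by rewrite !gt_eqF ?addr_gt0.
Qed.

End grid_normal_derivative.

(** * The entropy *)

Section traceless.
Variable R : realType.
Implicit Types (Q S : 'M[R]_2) (c : R).

Definition sqn Q : R := Q 0 0 ^+ 2 + Q 0 1 ^+ 2.

Lemma matrix2P (A B : 'M[R]_2) : A 0 0 = B 0 0 -> A 0 1 = B 0 1 ->
  A 1 0 = B 1 0 -> A 1 1 = B 1 1 -> A = B.
Proof.
move=> h1 h2 h3 h4; apply/matrixP => i j.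
by have [->|->] := ord2P i; have [->|->] := ord2P j.
Qed.

Lemma det2 (A : 'M[R]_2) : \det A = A 0 0 * A 1 1 - A 0 1 * A 1 0.
Proof.
rewrite (expand_det_row _ 0) sum_ord2 /cofactor !det_mx11 !mxE /=.
rewrite (_ : lift 0 0 = 1); last exact: val_inj.
rewrite (_ : lift 1 0 = 0); last exact: val_inj.
by rewrite addn0 expr0 mul1r add0n expr1 mulN1r mulrN.
Qed.

Lemma sym_tracelessP Q : sym_traceless Q <-> Q 1 0 = Q 0 1 /\ Q 1 1 = - Q 0 0.
Proof.
split=> [[QT tQ]|[Q1 Q2]].
  split; first by rewrite -[in LHS]QT mxE.
  by move: tQ; rewrite /mxtrace sum_ord2 => /eqP; rewrite addrC addr_eq0 => /eqP.
split; first by apply: matrix2P; rewrite !mxE.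
by rewrite /mxtrace sum_ord2 Q2 subrr.
Qed.

Lemma sqn_ge0 Q : 0 <= sqn Q. Proof. by rewrite addr_ge0 ?sqr_ge0. Qed.

(* [gap c Q] is 4 det(Q/c + I/2) *)
Definition gap c Q : R := 1 - 4 * sqn Q / c ^+ 2.

Lemma admissible_gap (M c : R) Q :
  sym_traceless Q -> admissible M c Q -> 0 < gap c Q.
Proof.
move=> /sym_tracelessP[Q10 Q11] [/andP[c0 _] ev].
(* A symmetric traceless 2 x 2 matrix has the eigenvalues r and - r, with r^2 = [sqn Q]. *)
pose r := Num.sqrt (sqn Q).
have r2 : r ^+ 2 = sqn Q by rewrite sqr_sqrtr ?sqn_ge0.
have /ev/andP[_ rc] : eigenvalue Q r.
  rewrite /eigenvalue /eigenspace kermx_eq0 row_free_unit unitmxE det2.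
  rewrite !mxE /= !mulr1n !mulr0n Q10 Q11 !subr0.
  rewrite (_ : (Q 0 0 - r) * _ - _ = 0) ?unitr0//.
  rewrite (_ : _ - _ = r ^+ 2 - sqn Q); last by rewrite /sqn; ring.
  by rewrite r2 subrr.
rewrite /gap subr_gt0 ltr_pdivrMr ?exprn_gt0// mul1r -r2.
rewrite (_ : 4 * r ^+ 2 = (2 * r) ^+ 2); last by ring.
rewrite ltrXn2r// ?nnegrE ?mulr_ge0 ?sqrtr_ge0 ?(ltW c0)//.
by move: rc; lra.
Qed.

Lemma inverse_entry (c a b X : R) : c != 0 -> X != 0 ->
  4 * (a ^+ 2 + b ^+ 2) = (1 - X) * c ^+ 2 ->
  (c^-1 * a + 2^-1) * (4 / X * (2^-1 - c^-1 * a))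
    + (c^-1 * b + 0) * (4 / X * (0 - c^-1 * b)) = 1.
Proof.
move=> c0 X0 E.
transitivity (4 / X * (1 / 4 - (a ^+ 2 + b ^+ 2) / c ^+ 2)).
  by field; apply/andP.
rewrite (_ : a ^+ 2 + b ^+ 2 = (1 - X) * c ^+ 2 / 4); last by rewrite -E; field.
by field; apply/andP.
Qed.

Section formulas.
Variables (p : model R) (c : R) (Q : 'M[R]_2).
Hypotheses (c0 : 0 < c) (stQ : sym_traceless Q) (X0 : 0 < gap c Q).
Let X := gap c Q.

Let Q10 : Q 1 0 = Q 0 1. Proof. by have /sym_tracelessP[] := stQ. Qed.
Let Q11 : Q 1 1 = - Q 0 0. Proof. by have /sym_tracelessP[] := stQ. Qed.
Let cN0 : c != 0. Proof. by rewrite gt_eqF. Qed.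
Let XN0 : X != 0. Proof. by rewrite gt_eqF. Qed.
Let sqnE : 4 * sqn Q = (1 - X) * c ^+ 2.
Proof. by rewrite /X /gap; field. Qed.

Lemma det_shifted : \det (c^-1 *: Q + (2^-1)%:M) = X / 4.
Proof.
rewrite det2 !mxE /= !mulr1n !mulr0n Q10 Q11 /X /gap /sqn.
by field.
Qed.

(** By Cayley-Hamilton S = Q / c has a scalar square, S^2 = (sqn Q / c^2) I, so (I/2 + S)(I/2 - S)
    is the scalar matrix (X / 4) I. *)
Lemma invmx_shifted :
  invmx (c^-1 *: Q + (2^-1)%:M) = (4 / X) *: ((2^-1)%:M - c^-1 *: Q).
Proof.
set A := (_ + _); set B := RHS.
have uA : A \in unitmx.
  by rewrite unitmxE det_shifted unitfE mulf_neq0// invr_neq0.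
suff AB : A *m B = 1%:M by rewrite -[LHS]mulmx1 -AB mulKmx.
have E : 4 * (Q 0 0 ^+ 2 + Q 0 1 ^+ 2) = (1 - X) * c ^+ 2 by exact: sqnE.
apply: matrix2P; rewrite !mxE sum_ord2 !mxE /= !mulr1n !mulr0n ?Q10 ?Q11;
  move: cN0 XN0 E.
- exact: inverse_entry.
- by move: X => Y ? ? _; field; apply/andP.
- by move: X => Y ? ? _; field; apply/andP.
- move=> c1 X1 E; rewrite addrC; apply: inverse_entry => //.
  by rewrite sqrrN.
Qed.

Lemma quasi_entropyE : quasi_entropy (c^-1 *: Q) = - ln X.
Proof.
rewrite /quasi_entropy det_shifted.
rewrite (_ : \det ((2^-1)%:M : 'M[R]_2) = 4^-1); last first.
  by rewrite det_scalar; field.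
by rewrite ln_div ?posrE// lnV ?posrE// opprB addrC addrA addNr add0r.
Qed.

Definition logit (M c : R) : R := ln (M * c / (M - c)).

Lemma dXi_dcE : dXi_dc p c Q =
  logit (mM p) c + mnu p * (- ln X - 8 * (sqn Q / c ^+ 2) / X).
Proof.
rewrite /dXi_dc quasi_entropyE invmx_shifted -/(logit _ _).
set S := (\sum_(i < 2) _).
have -> : S = - (8 * sqn Q / (c * X)).
  rewrite /S !sum_ord2 !mxE /= !mulr1n !mulr0n Q10 Q11 /sqn.
  by move: X XN0 => Y Y0; field; apply/andP.
by move: X XN0 => Y Y0; field; apply/andP.
Qed.

Lemma dXi_dQE i j : dXi_dQ p c Q i j =
  - (mnu p * (4 / X * ((i == j)%:R / 2 - Q i j / c))).
Proof.
by rewrite /dXi_dQ invmx_shifted !mxE -[_ *+ (i == j)]mulr_natl [c^-1 * _]mulrC.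
Qed.

End formulas.

(** Bregman divergence of q(S) = - log(1 - 4 sqn S) with base point Q / c and end point Q' / c'; 8 S
    / gap is the gradient of q in the two free entries of S. *)
Definition entropy_breg (c : R) Q (c' : R) Q' : R :=
  - ln (gap c' Q') + ln (gap c Q)
  - 8 / gap c Q * (Q 0 0 / c * (Q' 0 0 / c' - Q 0 0 / c)
                   + Q 0 1 / c * (Q' 0 1 / c' - Q 0 1 / c)).

(** With ln z <= z - 1 at the quotient z of the two gaps, what is left is the concavity of S |-> 1 -
    4 sqn S, whose defect is exactly 4 sqn (S' - S). *)
Lemma entropy_breg_ge0 c Q c' Q' : 0 < c -> 0 < c' ->
  0 < gap c Q -> 0 < gap c' Q' -> 0 <= entropy_breg c Q c' Q'.
Proof.
move=> c0 c0' X0 X0'; rewrite /entropy_breg.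
have XX : 0 < gap c' Q' / gap c Q by rewrite divr_gt0.
have : ln (gap c' Q' / gap c Q) <= gap c' Q' / gap c Q - 1.
  have := @le_ln1Dx R (gap c' Q' / gap c Q - 1).
  by rewrite [1 + _]addrC subrK; apply; lra.
rewrite ln_div ?posrE// => H.
suff : 8 / gap c Q * (Q 0 0 / c * (Q' 0 0 / c' - Q 0 0 / c)
    + Q 0 1 / c * (Q' 0 1 / c' - Q 0 1 / c)) <= 1 - gap c' Q' / gap c Q by lra.
rewrite -(ler_pM2r X0) mulrBl divfK ?gt_eqF// mul1r mulrAC divfK ?gt_eqF//.
rewrite -subr_ge0 /gap /sqn.
set a := Q 0 0; set b := Q 0 1; set a' := Q' 0 0; set b' := Q' 0 1.
rewrite (_ : _ - _ = 4 * ((a' / c' - a / c) ^+ 2 + (b' / c' - b / c) ^+ 2)).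
  by rewrite mulr_ge0// addr_ge0 ?sqr_ge0.
by field; rewrite !gt_eqF.
Qed.

Lemma logit_monotone (M c c' : R) : 0 < c < M -> 0 < c' < M -> c <= c' ->
  logit M c <= logit M c'.
Proof.
move=> c0 c0' cc; rewrite ler_ln ?posrE; first last.
- by rewrite divr_gt0 ?mulr_gt0//; lra.
- by rewrite divr_gt0 ?mulr_gt0//; lra.
rewrite ler_pdivrMr; last by lra.
rewrite mulrAC ler_pdivlMr; last by lra.
rewrite -subr_ge0 (_ : M * c' * (M - c) - M * c * (M - c') = M ^+ 2 * (c' - c)).
  by rewrite mulr_ge0 ?sqr_ge0 ?subr_ge0.
by ring.
Qed.

(* If [b] is not between [c] and [c'] the product is nonnegative; otherwise
   both factors are controlled by their values at [c']. *)
Lemma logit_three_point (M c b c' : R) : 0 < c < M -> 0 < b < M -> 0 < c' < M ->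
  - (`|logit M c - logit M c'| * `|c' - c|) <=
  (logit M c - logit M b) * (c' - b).
Proof.
move=> cM bM cM'; have mono := @logit_monotone M.
case: (lerP b c) => bc; case: (lerP b c') => bc'.
- apply: (@le_trans _ _ 0); first by rewrite oppr_le0 mulr_ge0.
  by rewrite mulr_ge0 ?subr_ge0// mono.
- have h1 := mono _ _ bM cM bc; have h2 := mono _ _ cM' bM (ltW bc').
  rewrite lerNl -mulrN opprB; apply: ler_pM; rewrite ?subr_ge0 ?(ltW bc')//.
    by rewrite (le_trans _ (ler_norm _))// lerB.
  by rewrite distrC (le_trans _ (ler_norm _))// lerB.
- have h1 := mono _ _ cM bM (ltW bc); have h2 := mono _ _ bM cM' bc'.
  rewrite lerNl -mulNr opprB; apply: ler_pM; rewrite ?subr_ge0//.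
    by rewrite distrC (le_trans _ (ler_norm _))// lerB.
  by rewrite (le_trans _ (ler_norm _))// lerB// ltW.
- apply: (@le_trans _ _ 0); first by rewrite oppr_le0 mulr_ge0.
  rewrite -mulrNN !opprB mulr_ge0 ?subr_ge0 ?(ltW bc')//.
  exact: mono cM bM (ltW bc).
Qed.

(* Three-point identity of Bregman divergences for the perspective c q(Q/c),
   combined with the scalar estimate for the logarithmic part. *)
Lemma entropy_three_point (p : model R) (c b c' : R) (Q B Q' : 'M[R]_2) :
  sym_traceless Q -> sym_traceless B -> sym_traceless Q' ->
  0 < c < mM p -> 0 < b < mM p -> 0 < c' < mM p -> 0 < mnu p ->
  0 < gap c Q -> 0 < gap b B -> 0 < gap c' Q' ->
  - (`|logit (mM p) c - logit (mM p) c'| * `|c' - c|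
     + mnu p * (c' * entropy_breg c Q c' Q')) <=
  (dXi_dc p c Q - dXi_dc p b B) * (c' - b)
  + \sum_(i < 2) \sum_(j < 2)
      (dXi_dQ p c Q i j - dXi_dQ p b B i j) * (Q' i j - B i j).
Proof.
move=> sQ sB sQ' cM bM cM' nu0 XQ XB XQ'.
have c0 : 0 < c by case/andP: cM.
have b0 : 0 < b by case/andP: bM.
have c0' : 0 < c' by case/andP: cM'.
have g1 := entropy_breg_ge0 b0 c0' XB XQ'.
have g2 := entropy_breg_ge0 c0 b0 XQ XB.
have L := logit_three_point cM bM cM'.
rewrite !sum_ord2 !dXi_dcE// !dXi_dQE//=.
have [Q10 Q11] := (sym_tracelessP Q).1 sQ.
have [B10 B11] := (sym_tracelessP B).1 sB.
have [Q10' Q11'] := (sym_tracelessP Q').1 sQ'.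
rewrite Q10 Q11 B10 B11 Q10' Q11'.
have H : 0 <= mnu p * (c' * entropy_breg b B c' Q' + b * entropy_breg c Q b B).
  by rewrite mulr_ge0 ?(ltW nu0)// addr_ge0 ?mulr_ge0// ltW.
set RHS := (X in _ <= X).
(* The Bregman divergence of the perspective (c, Q) |-> c q(Q / c) is that of q between the
   quotients, weighted by the value of c at the end point: this is the origin of the weights c', b
   and c'. *)
have -> : RHS = (logit (mM p) c - logit (mM p) b) * (c' - b)
  + mnu p * (c' * entropy_breg b B c' Q' + b * entropy_breg c Q b B)
  - mnu p * (c' * entropy_breg c Q c' Q').
  rewrite /RHS /entropy_breg /sqn.
  move: (gap c Q) (gap b B) (gap c' Q') XQ XB XQ' => X Y Z X0 Y0 Z0.
  move: (ln X) (ln Y) (ln Z) (logit (mM p) c) (logit (mM p) b) => x y z u v.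
  by field; rewrite !gt_eqF.
by move: H L; lra.
Qed.

End traceless.

(** * Discrete summation by parts *)

Section interior_sums.
Variables (R : realType) (N : nat).
Implicit Types u v : grid_fun R.

Lemma interior_nat (l m : nat) : (1 <= l < N)%N -> (1 <= m < N)%N ->
  interior_node N l%:Z m%:Z.
Proof. by move=> lN mN; rewrite /interior_node !ltz_nat lN mN. Qed.

Lemma eq_sumP u v : (forall l m, interior_node N l m -> u l m = v l m) ->
  sumP N u = sumP N v.
Proof.
move=> uv; apply: eq_big_nat => l lN; apply: eq_big_nat => m mN.
exact/uv/interior_nat.
Qed.

Lemma ler_sumP u v : (forall l m, interior_node N l m -> u l m <= v l m) ->
  sumP N u <= sumP N v.
Proof.
move=> uv; apply: ler_sum_nat => l lN; apply: ler_sum_nat => m mN.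
exact/uv/interior_nat.
Qed.

Lemma sumPD u v : sumP N (fun l m => u l m + v l m) = sumP N u + sumP N v.
Proof.
by rewrite /sumP -big_split; apply: eq_bigr => l _; rewrite -big_split.
Qed.

Lemma sumPZ (a : R) u : sumP N (fun l m => a * u l m) = a * sumP N u.
Proof.
by rewrite /sumP mulr_sumr; apply: eq_bigr => l _; rewrite mulr_sumr.
Qed.

Lemma sumPN u : sumP N (fun l m => - u l m) = - sumP N u.
Proof.
rewrite -mulN1r -sumPZ; apply: eq_sumP => l m _; by rewrite mulN1r.
Qed.

Lemma sumPB u v : sumP N (fun l m => u l m - v l m) = sumP N u - sumP N v.
Proof. by rewrite sumPD sumPN. Qed.

Lemma sumP_const (a : R) : sumP N (fun _ _ => a) = (N.-1 ^ 2)%:R * a.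
Proof.
rewrite /sumP !sumr_const_nat -mulrnA.
by rewrite mulr_natl subn1 expnS expn1.
Qed.

Lemma sumP_ge0 u : (forall l m, interior_node N l m -> 0 <= u l m) ->
  0 <= sumP N u.
Proof.
move=> u0; rewrite -[X in X <= _](mulr0 (N.-1 ^ 2)%:R) -sumP_const.
exact: ler_sumP.
Qed.

Lemma sumP_projG_h u : (1 < N)%N -> sumP N (projG_h N u) = 0.
Proof.
move=> N1; rewrite /projG_h sumPB sumP_const mulrCA divff ?mulr1 ?subrr//.
by rewrite pnatr_eq0 -lt0n expn_gt0 -subn1 subn_gt0 N1.
Qed.

End interior_sums.

Section cell_sums.
Variables (R : realType) (N : nat).
Hypothesis N1 : (1 < N)%N.
Implicit Types F : grid_fun R.

(** Cells are indexed by their lower left node. *)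
Definition sumC F : R := \sum_(0 <= l < N) \sum_(0 <= m < N) F l%:Z m%:Z.

Lemma sumCD F G : sumC (fun l m => F l m + G l m) = sumC F + sumC G.
Proof.
by rewrite /sumC -big_split; apply: eq_bigr => l _; rewrite -big_split.
Qed.

Lemma sum_shift0 (f : nat -> R) : f 0%N = 0 ->
  \sum_(0 <= l < N) f l = \sum_(1 <= l < N) f l.
Proof. by move=> f0; rewrite big_ltn ?f0 ?add0r// (ltn_trans _ N1). Qed.

Lemma sum_shift1 (f : nat -> R) : f N = 0 ->
  \sum_(0 <= l < N) f l.+1 = \sum_(1 <= l < N) f l.
Proof.
move=> fN; rewrite -(big_add1 _ _ 0 N.+1 xpredT f) big_nat_recr //= ?fN ?addr0//.
exact: ltnW.
Qed.

Definition vanish_bnd F := forall l m, boundary_node N l m -> F l m = 0.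

Lemma boundary_l0 (m : nat) : (m <= N)%N -> boundary_node N 0 m%:Z.
Proof. by move=> mN; rewrite /boundary_node /grid_node /interior_node ltxx !lez_nat mN. Qed.
Lemma boundary_lN (m : nat) : (m <= N)%N -> boundary_node N N%:Z m%:Z.
Proof.
by move=> mN; rewrite /boundary_node /grid_node /interior_node ltxx andbF !lez_nat mN leqnn.
Qed.
Lemma boundary_m0 (l : nat) : (l <= N)%N -> boundary_node N l%:Z 0.
Proof.
by move=> lN; rewrite /boundary_node /grid_node /interior_node ltxx andbF !lez_nat lN.
Qed.
Lemma boundary_mN (l : nat) : (l <= N)%N -> boundary_node N l%:Z N%:Z.
Proof.
by move=> lN; rewrite /boundary_node /grid_node /interior_node ltxx !andbF !lez_nat lN leqnn.
Qed.

Let SE (l : nat) : (l%:Z + 1) = l.+1%:Z. Proof. by rewrite -PoszD addn1. Qed.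

(** For [F] vanishing on the boundary, the sum over all cells of the value at any one of the four
    corners is the interior sum. These four lemmas turn sums over nodes into sums over cells, which
    does the work of summation by parts. *)
Lemma sumC00 F : vanish_bnd F -> sumC F = sumP N F.
Proof.
move=> F0; rewrite /sumC sum_shift0; last first.
  by apply: big1_seq => m; rewrite mem_index_iota => /andP[_ /ltnW mN]; exact/F0/boundary_l0.
apply: eq_big_nat => l /andP[_ /ltnW lN].
by apply: (@sum_shift0 (fun m => F l%:Z m%:Z)); exact/F0/boundary_m0.
Qed.

Lemma sumC10 F : vanish_bnd F -> sumC (fun l m => F (l + 1) m) = sumP N F.
Proof.
move=> F0; rewrite /sumC; under eq_bigr do rewrite SE.
rewrite (@sum_shift1 (fun l => \sum_(0 <= m < N) F l%:Z m%:Z)); last first.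
  by apply: big1_seq => m; rewrite mem_index_iota => /andP[_ /ltnW mN]; exact/F0/boundary_lN.
apply: eq_big_nat => l /andP[_ /ltnW lN].
by apply: (@sum_shift0 (fun m => F l%:Z m%:Z)); exact/F0/boundary_m0.
Qed.

Lemma sumC01 F : vanish_bnd F -> sumC (fun l m => F l (m + 1)) = sumP N F.
Proof.
move=> F0; rewrite /sumC.
under eq_bigr do under eq_bigr do rewrite SE.
rewrite sum_shift0; last first.
  by apply: big1_seq => m; rewrite mem_index_iota => /andP[_ mN]; exact/F0/boundary_l0.
apply: eq_big_nat => l /andP[_ /ltnW lN].
by apply: (@sum_shift1 (fun m => F l%:Z m%:Z)); exact/F0/boundary_mN.
Qed.

Lemma sumC11 F : vanish_bnd F -> sumC (fun l m => F (l + 1) (m + 1)) = sumP N F.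
Proof.
move=> F0; rewrite /sumC.
under eq_bigr => l _ do rewrite SE; under eq_bigr do under eq_bigr do rewrite SE.
rewrite (@sum_shift1 (fun l => \sum_(0 <= m < N) F l%:Z m.+1%:Z)); last first.
  by apply: big1_seq => m; rewrite mem_index_iota => /andP[_ mN]; exact/F0/boundary_lN.
apply: eq_big_nat => l /andP[_ /ltnW lN].
by apply: (@sum_shift1 (fun m => F l%:Z m%:Z)); exact/F0/boundary_mN.
Qed.

(* On a cell with corner (l, m), the forward differences of p in x and of q in
   y, averaged over opposite edges, have product symbol sin a sin b, which is
   the symbol of the wide mixed difference. *)
Lemma mixed_form_ge0 (h : R) (p q : grid_fun R) : h != 0 ->
  vanish_bnd p -> vanish_bnd q ->
  0 <= sumP N (fun l m => - (DD h 0 0 p l m * p l m + DD h 0 1 q l m * p l m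
    + DD h 1 0 p l m * q l m + DD h 1 1 q l m * q l m)).
Proof.
move=> h0 p0 q0.
pose X l m := (p (l + 1) m - p l m + (p (l + 1) (m + 1) - p l (m + 1))) / 2.
pose Y l m := (q l (m + 1) - q l m + (q (l + 1) (m + 1) - q (l + 1) m)) / 2.
pose S l m := ((p (l + 1) m - p l m) ^+ 2 + (p (l + 1) (m + 1) - p l (m + 1)) ^+ 2) / 2
  + ((q l (m + 1) - q l m) ^+ 2 + (q (l + 1) (m + 1) - q (l + 1) m) ^+ 2) / 2
  + 2 * X l m * Y l m.
have S0 : 0 <= sumC S.
  apply: sumr_ge0 => l _; apply: sumr_ge0 => m _; rewrite /S.
  set P1 := p _ _ - p _ _; set P2 := p _ _ - p _ (_ + 1).
  set Q1 := q _ _ - q _ _; set Q2 := q (_ + 1) (_ + 1) - q (_ + 1) _.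
  rewrite /X /Y -/P1 -/P2 -/Q1 -/Q2.
  rewrite (_ : _ + _ = ((P1 + P2) / 2 + (Q1 + Q2) / 2) ^+ 2
     + ((P1 - P2) / 2) ^+ 2 + ((Q1 - Q2) / 2) ^+ 2); last by field.
  by rewrite !addr_ge0 ?sqr_ge0.
(* [S] is split according to the corner that carries the undifferenced factor p or q. Each piece is
   written at that corner, so it vanishes on the boundary and may be shifted. *)
pose A00 l m := (p l m * (p l m - p (l + 1) m - Y l m)
  + q l m * (q l m - q l (m + 1) - X l m)) / 2.
pose A10 l m := (p l m * (p l m - p (l - 1) m + Y (l - 1) m)
  + q l m * (q l m - q l (m + 1) - X (l - 1) m)) / 2.
pose A01 l m := (p l m * (p l m - p (l + 1) m - Y l (m - 1))
  + q l m * (q l m - q l (m - 1) + X l (m - 1))) / 2.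
pose A11 l m := (p l m * (p l m - p (l - 1) m + Y (l - 1) (m - 1))
  + q l m * (q l m - q l (m - 1) + X (l - 1) (m - 1))) / 2.
have V (F : grid_fun R) (f g : int -> int -> R) :
    (forall l m, F l m = (p l m * f l m + q l m * g l m) / 2) -> vanish_bnd F.
  by move=> FE l m lm; rewrite FE p0// q0// !mul0r addr0 mul0r.
have h2 : 0 < h ^+ 2 by rewrite exprn_even_gt0.
rewrite -(pmulr_rge0 _ h2) -sumPZ.
suff -> : sumP N (fun l m => h ^+ 2 * - (DD h 0 0 p l m * p l m + DD h 0 1 q l m * p l m
    + DD h 1 0 p l m * q l m + DD h 1 1 q l m * q l m)) = sumC S by [].
transitivity (sumP N A00 + sumP N A10 + sumP N A01 + sumP N A11).
  rewrite -!sumPD; apply: eq_sumP => l m _.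
  rewrite DD00E DD11E !DDCE// /A00 /A10 /A01 /A11 /X /Y !subrK.
  by field.
rewrite -(sumC00 (V _ _ _ (fun l m => erefl (A00 l m)))).
rewrite -(sumC10 (V _ _ _ (fun l m => erefl (A10 l m)))).
rewrite -(sumC01 (V _ _ _ (fun l m => erefl (A01 l m)))).
rewrite -(sumC11 (V _ _ _ (fun l m => erefl (A11 l m)))).
rewrite -!sumCD; congr sumC; apply/funext => l; apply/funext => m.
rewrite /S /A00 /A10 /A01 /A11 /X /Y !addrK.
by field.
Qed.

End cell_sums.

Section green.
Variables (R : realType) (N : nat) (h : R).
Hypotheses (N1 : (1 < N)%N) (h0 : 0 < h).
Let hN0 : h != 0. Proof. by rewrite gt_eqF. Qed.

Lemma lap_hE (u : grid_fun R) l m : lap_h h u l m = DD h 0 0 u l m + DD h 1 1 u l m.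
Proof. exact: sum_ord2. Qed.

Lemma bilap_hE (u : grid_fun R) l m : bilap_h h u l m = lap_h h (lap_h h u) l m.
Proof.
rewrite /bilap_h lap_hE [in RHS]DD00E [in RHS]DD11E !lap_hE.
by rewrite !DD00E !DD11E ?DD00E; field.
Qed.

(** The summand is the increment of the discrete Wronskian [tau], so the sum telescopes; as [e]
    vanishes at the ends, only its first interior values survive. *)
Lemma green1 (e g : int -> R) : e 0 = 0 -> e N%:Z = 0 ->
  \sum_(1 <= l < N) ((g (l%:Z - 1) - 2 * g l%:Z + g (l%:Z + 1)) * e l%:Z
     - g l%:Z * (e (l%:Z - 1) - 2 * e l%:Z + e (l%:Z + 1)))
  = g 0 * e 1 + g N%:Z * e (N%:Z - 1).
Proof.
move=> e0 eN; pose tau (l : nat) := g l%:Z * e (l%:Z - 1) - g (l%:Z - 1) * e l%:Z.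
rewrite (eq_bigr (fun l => tau l.+1 - tau l)); last first.
  move=> l _; rewrite /tau (_ : l.+1%:Z = l%:Z + 1) ?addrK; first by ring.
  by rewrite -PoszD addn1.
rewrite telescope_sumr ?(ltnW N1)// /tau subrr e0 eN.
by ring.
Qed.

Lemma green2 (e g : grid_fun R) : vanish_bnd N e ->
  h ^+ 2 * sumP N (fun l m => lap_h h g l m * e l m - g l m * lap_h h e l m)
  = \sum_(1 <= k < N) (g 0 k%:Z * e 1 k%:Z + g N%:Z k%:Z * e (N%:Z - 1) k%:Z
      + (g k%:Z 0 * e k%:Z 1 + g k%:Z N%:Z * e k%:Z (N%:Z - 1))).
Proof.
move=> e0.
pose ax l m := (g (l - 1) m - 2 * g l m + g (l + 1) m) * e l m
     - g l m * (e (l - 1) m - 2 * e l m + e (l + 1) m).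
pose ay l m := (g l (m - 1) - 2 * g l m + g l (m + 1)) * e l m
     - g l m * (e l (m - 1) - 2 * e l m + e l (m + 1)).
rewrite -sumPZ (@eq_sumP _ _ _ (fun l m => ax l m + ay l m)); last first.
  by move=> l m _; rewrite !lap_hE !DD00E !DD11E /ax /ay; field.
rewrite sumPD big_split; congr (_ + _).
  rewrite /sumP exchange_big_nat; apply: eq_big_nat => m /andP[_ mN].
  apply: (@green1 (e^~ m%:Z) (g^~ m%:Z)).
    exact/e0/boundary_l0/ltnW.
  exact/e0/boundary_lN/ltnW.
apply: eq_big_nat => m /andP[_ mN]; apply: (@green1 (e m%:Z) (g m%:Z)).
  exact/e0/boundary_m0/ltnW.
exact/e0/boundary_mN/ltnW.
Qed.

End green.

Lemma int_side (N k : nat) : (1 <= k < N)%N ->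
  [/\ 0 <= k%:Z <= N%:Z, 0 <= k%:Z - 1 <= N%:Z & 0 <= k%:Z + 1 <= N%:Z].
Proof. by move=> kN; split; lia. Qed.

Lemma int_boundary (N : nat) (l m : int) : 0 <= l <= N%:Z -> 0 <= m <= N%:Z ->
  [|| l == 0, l == N%:Z, m == 0 | m == N%:Z] -> boundary_node N l m.
Proof. by rewrite /boundary_node /grid_node /interior_node; lia. Qed.

Section linear_form.
Variables (R : realType) (p : model R) (N : nat) (h : R).
Hypotheses (N1 : (1 < N)%N) (h0 : 0 < h).
Let hN0 : h != 0. Proof. by rewrite gt_eqF. Qed.

Definition side_flux (F : grid_fun R) (D D' : grid_fun R) (k : nat) : R :=
  F 0 k%:Z * D 0 k%:Z + F N%:Z k%:Z * D N%:Z k%:Z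
  + (F k%:Z 0 * D' k%:Z 0 + F k%:Z N%:Z * D' k%:Z N%:Z).

(** On a side the tangential second difference of [e] vanishes, so [lap_h] involves only the ghost
    value and the first interior value; eliminating the ghost value through the normal difference
    gives these relations. *)
Lemma boundary_lap (e : grid_fun R) (k : nat) : vanish_bnd N e -> (1 <= k < N)%N ->
  [/\ e 1 k%:Z = h ^+ 2 / 2 * lap_h h e 0 k%:Z - h * Dnx h N e 0 k%:Z,
      e (N%:Z - 1) k%:Z = h ^+ 2 / 2 * lap_h h e N%:Z k%:Z - h * Dnx h N e N%:Z k%:Z,
      e k%:Z 1 = h ^+ 2 / 2 * lap_h h e k%:Z 0 - h * Dny h N e k%:Z 0
    & e k%:Z (N%:Z - 1) = h ^+ 2 / 2 * lap_h h e k%:Z N%:Z - h * Dny h N e k%:Z N%:Z].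
Proof.
move=> e0 kN; have [k0 k1 k2] := int_side kN.
have N00 : 0 <= 0%:Z <= N%:Z by [].
have NNN : 0 <= N%:Z <= N%:Z by rewrite lexx andbT.
have NZ : (N%:Z == 0) = false by rewrite eqz_nat gtn_eqF// ltnW.
have z1 (j : int) : 0 <= j <= N%:Z -> e 0 j = 0.
  by move=> jN; apply/e0/int_boundary; rewrite ?eqxx.
have z2 (j : int) : 0 <= j <= N%:Z -> e N%:Z j = 0.
  by move=> jN; apply/e0/int_boundary; rewrite ?eqxx ?orbT.
have z3 (j : int) : 0 <= j <= N%:Z -> e j 0 = 0.
  by move=> jN; apply/e0/int_boundary; rewrite ?eqxx ?orbT.
have z4 (j : int) : 0 <= j <= N%:Z -> e j N%:Z = 0.
  by move=> jN; apply/e0/int_boundary; rewrite ?eqxx ?orbT.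
rewrite !lap_hE !DD00E !DD11E /Dnx /Dny eqxx NZ !add0r !(z1, z2, z3, z4)//.
by split; field.
Qed.

(** Inserting [boundary_lap] into Green's formula leaves, besides the flux of [lap_h] against the
    normal difference, the squares of [lap_h] on the sides with the factor h^2 / 2; they have the
    good sign and are dropped. *)
Lemma bilap_form (e : grid_fun R) : vanish_bnd N e ->
  - (\sum_(1 <= k < N) h * side_flux (lap_h h e) (Dnx h N e) (Dny h N e) k)
  <= h ^+ 2 * sumP N (fun l m => bilap_h h e l m * e l m - lap_h h e l m ^+ 2).
Proof.
move=> e0; rewrite (@eq_sumP _ _ _ (fun l m => lap_h h (lap_h h e) l m * e l m
   - lap_h h e l m * lap_h h e l m)); last first.
  by move=> l m _; rewrite bilap_hE// expr2.
rewrite green2// -sumrN; apply: ler_sum_nat => k kN.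
have [-> -> -> ->] := boundary_lap e0 kN.
rewrite /side_flux -subr_ge0.
set a := lap_h _ _ _ _; set b := lap_h _ _ _ _; set c := lap_h _ _ _ _.
set d := lap_h _ _ _ _.
rewrite (_ : _ - _ = h ^+ 2 / 2 * (a ^+ 2 + b ^+ 2 + c ^+ 2 + d ^+ 2)); last by ring.
by rewrite mulr_ge0 ?divr_ge0 ?sqr_ge0 ?addr_ge0 ?sqr_ge0.
Qed.

Definition linear_form (e : grid_fun R) (r : grid_tens R) : grid_fun R :=
  fun l m => L_c p h e r l m * e l m
    + \sum_(i < 2) \sum_(j < 2) L_Q p h e r l m i j * r l m i j.

Lemma DD_lin (i j : 'I_2) (f g : grid_fun R) (b : R) l m :
  DD h i j (fun l m => f l m + b * g l m) l m = DD h i j f l m + b * DD h i j g l m.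
Proof. by rewrite /DD; case: ifP => _; [case: ifP => _|]; field. Qed.

(* The cross terms in c23 are absorbed by completing the square in the field
   r_ij + c23 / (2 c22) delta_ij e. *)
Lemma linear_form_ge (e : grid_fun R) (r : grid_tens R) : model_ok p ->
  vanish_bnd N e -> (forall i j, vanish_bnd N (gcomp r i j)) ->
  - (2 * c40 p * \sum_(1 <= k < N) h * side_flux (lap_h h e) (Dnx h N e) (Dny h N e) k)
  <= h ^+ 2 * sumP N (linear_form e r).
Proof.
move=> [_ [[c40p c21p c22p c20n] [_ gam]]] e0 r0.
pose b := c23 p / (2 * c22 p).
pose b' := c23 p ^+ 2 / (4 * c22 p).
have h2 : 0 < h ^+ 2 by rewrite exprn_gt0.
pose form (P Q : grid_fun R) := fun l m => - (DD h 0 0 P l m * P l m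
  + DD h 0 1 Q l m * P l m + DD h 1 0 P l m * Q l m + DD h 1 1 Q l m * Q l m).
pose z : grid_fun R := fun _ _ => 0.
have z0 : vanish_bnd N z by [].
(* The c22 term couples the entries of one column, so [mixed_form_ge0] is applied to the pairs (u 0
   j, u 1 j). The shift by a multiple of the identity reproduces the c23 terms. *)
pose u i j : grid_fun R := fun l m => gcomp r i j l m + (b *+ (i == j)) * e l m.
have u0 i j : vanish_bnd N (u i j).
  by move=> l m lm; rewrite /u r0// e0// mulr0 addr0.
have fpos P Q : vanish_bnd N P -> vanish_bnd N Q -> 0 <= sumP N (form P Q).
  by move=> P0 Q0; exact: mixed_form_ge0.
(* What remains for [e] alone is a quadratic form in (e, lap_h e), with c20 lowered by [b'], the
   cost of completing the square. The second lower bound on gamma in [model_ok] is its discriminant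
   condition. *)
pose quad l m := 2 * mgamma p * e l m ^+ 2
  - 2 * (c20 p - b') * (e l m * lap_h h e l m) + 2 * c40 p * lap_h h e l m ^+ 2.
have quad0 : 0 <= sumP N quad.
  apply: sumP_ge0 => l m _; rewrite /quad.
  set x := e l m; set y := lap_h _ _ _ _; set k := c20 p - b'.
  have kneg : k < 0.
    rewrite /k subr_lt0; apply: lt_le_trans c20n _.
    by rewrite /b' divr_ge0 ?sqr_ge0// mulr_ge0// ltW.
  have kg : k ^+ 2 / (4 * c40 p) <= mgamma p.
    by move: gam; rewrite -/b' -/k min_l// ltW.
  have : k ^+ 2 / (4 * c40 p) * x ^+ 2 <= mgamma p * x ^+ 2.
    by rewrite ler_wpM2r ?sqr_ge0.
  have E : k ^+ 2 / (4 * c40 p) * x ^+ 2 - k * (x * y) + c40 p * y ^+ 2 =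
     c40 p * (y - k * x / (2 * c40 p)) ^+ 2 by field; rewrite gt_eqF.
  have : 0 <= c40 p * (y - k * x / (2 * c40 p)) ^+ 2.
    by rewrite mulr_ge0 ?sqr_ge0// ltW.
  by rewrite -E; lra.
have bil := bilap_form e0.
have main : sumP N (linear_form e r) = sumP N quad
   + 2 * c40 p * sumP N (fun l m => bilap_h h e l m * e l m - lap_h h e l m ^+ 2)
   + 2 * c21 p * (sumP N (form (gcomp r 0 0) z) + sumP N (form z (gcomp r 0 0))
       + (sumP N (form (gcomp r 0 1) z) + sumP N (form z (gcomp r 0 1)))
       + (sumP N (form (gcomp r 1 0) z) + sumP N (form z (gcomp r 1 0)))
       + (sumP N (form (gcomp r 1 1) z) + sumP N (form z (gcomp r 1 1))))
   + 2 * c22 p * (sumP N (form (u 0 0) (u 1 0)) + sumP N (form (u 0 1) (u 1 1))).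
  rewrite -!sumPZ -!sumPD -!sumPZ -!sumPD; apply: eq_sumP => l m _.
  have DDz i j : DD h i j z l m = 0.
    by rewrite /DD /z; case: ifP => _; [case: ifP => _|]; rewrite !(addr0, subr0, mulr0) mul0r.
  have DDs f : DD h 1 0 f l m = DD h 0 1 f l m by rewrite !DDCE.
  rewrite /linear_form /L_c /L_Q /quad /form /u !lap_hE !DDz !DD_lin !sum_ord2 !mxE.
  rewrite !sum_ord2 /= !DDs /gcomp /z /b /b' !mulr1n !mulr0n.
  by field; rewrite gt_eqF.
have P1 : 0 <= sumP N (form (gcomp r 0 0) z) by apply: fpos.
have P2 : 0 <= sumP N (form z (gcomp r 0 0)) by apply: fpos.
have P3 : 0 <= sumP N (form (gcomp r 0 1) z) by apply: fpos.
have P4 : 0 <= sumP N (form z (gcomp r 0 1)) by apply: fpos.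
have P5 : 0 <= sumP N (form (gcomp r 1 0) z) by apply: fpos.
have P6 : 0 <= sumP N (form z (gcomp r 1 0)) by apply: fpos.
have P7 : 0 <= sumP N (form (gcomp r 1 1) z) by apply: fpos.
have P8 : 0 <= sumP N (form z (gcomp r 1 1)) by apply: fpos.
have P9 := fpos _ _ (u0 0 0) (u0 1 0); have P10 := fpos _ _ (u0 0 1) (u0 1 1).
rewrite main; have c2 : 0 <= 2 * c40 p by rewrite mulr_ge0// ltW.
set B := sumP N (fun l m => _ - _) in bil *.
have H2 : - (2 * c40 p * \sum_(1 <= k < N) h * side_flux (lap_h h e) (Dnx h N e) (Dny h N e) k)
    <= h ^+ 2 * (2 * c40 p * B) by rewrite mulrCA -mulrN ler_wpM2l.
have H1 : 0 <= h ^+ 2 * sumP N quad by rewrite mulr_ge0// ltW.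
apply: le_trans H2 _; rewrite ler_wpM2l ?(ltW h2)//.
set A3 := 2 * c21 p * _; set A4 := 2 * c22 p * _.
have H3 : 0 <= A3 by rewrite /A3 mulr_ge0 ?addr_ge0 ?mulr_ge0// ltW.
have H4 : 0 <= A4 by rewrite /A4 mulr_ge0 ?addr_ge0 ?mulr_ge0// ltW.
move: quad0 H3 H4; move: (sumP N quad) (2 * c40 p * B) A3 A4 => x y u' v'.
by lra.
Qed.

End linear_form.

(** * The discrete energy inequality *)

Section trapezoid_sums.
Variables (R : realType) (N : nat).
Hypothesis N0 : (0 < N)%N.
Implicit Types f g : nat -> R.

Definition trap f : R := \sum_(0 <= k < N) (f k + f k.+1) / 2.

Lemma trapE f : trap f = f 0%N / 2 + \sum_(1 <= k < N) f k + f N / 2.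
Proof.
rewrite /trap -mulr_suml big_split /=.
rewrite [in X in X + _]big_ltn// -(big_add1 _ _ 0 N.+1 xpredT f).
rewrite (big_nat_recr N)//=; set S := \sum_(1 <= k < N) f k.
by field.
Qed.

Lemma trap_comb f g (a b d : R) :
  trap (fun k => a * f k - b * g k - d) = a * trap f - b * trap g - N%:R * d.
Proof.
rewrite /trap !mulr_sumr (_ : N%:R * d = \sum_(0 <= k < N) d); last first.
  by rewrite sumr_const_nat subn0 mulr_natl.
by rewrite -!sumrB; apply: eq_bigr => k _; field.
Qed.

Lemma sum_sigma_trap (h : R) (e : grid_fun R) : sum_sigma_Dn2 h N e =
  trap (fun k => Dnx h N e 0 k%:Z ^+ 2) + trap (fun k => Dnx h N e N%:Z k%:Z ^+ 2)
  + trap (fun k => Dny h N e k%:Z 0 ^+ 2) + trap (fun k => Dny h N e k%:Z N%:Z ^+ 2).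
Proof. by rewrite /sum_sigma_Dn2 /trap -!big_split. Qed.

End trapezoid_sums.

(* Young's inequality with weights chosen so that the coefficient of [v1 ^+ 2]
   stays positive for every time step. *)
Definition young (R : realType) (dt C1 tau v1 v0 : R) : R :=
  (2 * (1 + dt))^-1 * v1 ^+ 2 - (1 + C1 * dt) ^+ 2 / 2 * v0 ^+ 2
  - (1 + dt) * dt * tau ^+ 2 / 2.

Lemma young_le (R : realType) (dt C1 tau v1 v0 a r : R) :
  0 < dt -> `|a| <= C1 -> `|r| <= tau ->
  young dt C1 tau v1 v0 <= v1 * (v1 - v0) + dt * (a * v0 * v1) - dt * (r * v1).
Proof.
move=> dt0 aC rt; rewrite /young.
have C0 : 0 <= C1 by apply: le_trans aC.
have t0 : 0 <= tau by apply: le_trans rt.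
have d1 : 0 < 1 + dt by rewrite addr_gt0.
have k1 : 0 <= C1 * dt by rewrite mulr_ge0// ltW.
have H1 : `|v0 * v1 * (1 - a * dt)| <= v1 ^+ 2 / 2 + (1 + C1 * dt) ^+ 2 / 2 * v0 ^+ 2.
  have : `|1 - a * dt| <= 1 + C1 * dt.
    apply: le_trans (ler_normB _ _) _; rewrite normr1 lerD2l normrM.
    by rewrite (gtr0_norm dt0) ler_pM2r.
  rewrite !normrM -[v1 ^+ 2]real_normK ?num_real// -[v0 ^+ 2]real_normK ?num_real//.
  move: (`|v0|) (`|v1|) (normr_ge0 v0) (normr_ge0 v1) => x y x0 y0 H.
  apply: le_trans (_ : x * y * (1 + C1 * dt) <= _).
    by rewrite ler_wpM2l ?mulr_ge0.
  have := sqr_ge0 (y - (1 + C1 * dt) * x); rewrite sqrrB exprMn.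
  move: (1 + C1 * dt) => k; rewrite -mulr_natr; lra.
have H2 : r * v1 <= v1 ^+ 2 / (2 * (1 + dt)) + (1 + dt) * tau ^+ 2 / 2.
  have rr : r ^+ 2 <= tau ^+ 2.
    by rewrite -[r ^+ 2]real_normK ?num_real// lerXn2r// nnegrE.
  have : (1 + dt) * r ^+ 2 <= (1 + dt) * tau ^+ 2 by rewrite ler_pM2l.
  have : 0 <= (v1 - (1 + dt) * r) ^+ 2 / (2 * (1 + dt)).
    by rewrite divr_ge0 ?sqr_ge0// mulr_ge0// ltW.
  rewrite (_ : (v1 - (1 + dt) * r) ^+ 2 / (2 * (1 + dt)) =
    v1 ^+ 2 / (2 * (1 + dt)) - r * v1 + (1 + dt) * r ^+ 2 / 2); first by lra.
  by field; rewrite gt_eqF.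
have H3 : dt * (r * v1) <= dt * (v1 ^+ 2 / (2 * (1 + dt)) + (1 + dt) * tau ^+ 2 / 2).
  by rewrite ler_pM2l.
have H4 := le_trans (ler_norm _) H1.
apply: (@le_trans _ _ (v1 ^+ 2 - (v1 ^+ 2 / 2 + (1 + C1 * dt) ^+ 2 / 2 * v0 ^+ 2)
   - dt * (v1 ^+ 2 / (2 * (1 + dt)) + (1 + dt) * tau ^+ 2 / 2))).
  rewrite le_eqVlt; apply/orP; left; apply/eqP.
  by field; rewrite gt_eqF.
rewrite (_ : v1 * (v1 - v0) + dt * (a * v0 * v1) - dt * (r * v1) =
  v1 ^+ 2 - v0 * v1 * (1 - a * dt) - dt * (r * v1)); last by ring.
by rewrite !lerB.
Qed.

(** [projP] is the orthogonal projection onto symmetric traceless matrices, hence self-adjoint, and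
    it fixes [Q]. *)
Lemma projP_pairing (R : realType) (V Q : 'M[R]_2) : sym_traceless Q ->
  \sum_(i < 2) \sum_(j < 2) projP V i j * Q i j =
  \sum_(i < 2) \sum_(j < 2) V i j * Q i j.
Proof.
move=> /sym_tracelessP[s10 s11].
rewrite !sum_ord2 /projP !mxE /mxtrace sum_ord2 s10 s11 /= !mulr1n !mulr0n.
by field.
Qed.

Section energy_step.
Variables (R : realType) (p : model R) (N : nat) (h : R).
Hypotheses (N1 : (1 < N)%N) (h0 : 0 < h) (hp : model_ok p).

(** With the weight 2 c40 on the boundary, the flux produced by the bilaplacian cancels against the
    dynamic boundary condition. *)
Definition energy (e : grid_fun R) (r : grid_tens R) : R :=
  h ^+ 2 * sumP N (fun l m => e l m ^+ 2 + \sum_(i < 2) \sum_(j < 2) r l m i j ^+ 2)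
  + 2 * c40 p * h * sum_sigma_Dn2 h N e.

Variables (e0 e1 : grid_fun R) (r0 r1 : grid_tens R).
Variables (A tc : grid_fun R) (B tq : grid_tens R) (lam dt tau G C1 : R).
Variables (tx ty : grid_fun R).
Hypotheses (dt0 : 0 < dt).
Hypotheses (ev : vanish_bnd N e1) (rv : forall i j, vanish_bnd N (gcomp r1 i j)).
Hypothesis r1s : forall l m, interior_node N l m -> sym_traceless (r1 l m).
Hypothesis mass : sumP N e1 = 0.
Hypothesis ceq : forall l m, interior_node N l m ->
  (e1 l m - e0 l m) / dt = - (A l m + 2 * (c00 p - mgamma p) * e0 l m
    + L_c p h e1 r1 l m) + lam + tc l m.
Hypothesis qeq : forall l m, interior_node N l m ->
  dt^-1 *: (r1 l m - r0 l m) =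
  - projP (B l m + (2 * c02 p) *: r0 l m + L_Q p h e1 r1 l m) + tq l m.
Hypothesis mono : forall l m, interior_node N l m ->
  - G <= A l m * e1 l m + \sum_(i < 2) \sum_(j < 2) B l m i j * r1 l m i j.
Hypothesis xeq : forall l m : int, (l == 0) || (l == N%:Z) -> 0 <= m <= N%:Z ->
  (Dnx h N e1 l m - Dnx h N e0 l m) / dt = - lap_h h e1 l m + tx l m.
Hypothesis yeq : forall l m : int, (m == 0) || (m == N%:Z) -> 0 <= l <= N%:Z ->
  (Dny h N e1 l m - Dny h N e0 l m) / dt = - lap_h h e1 l m + ty l m.
Hypothesis tcb : forall l m, interior_node N l m -> `|tc l m| <= tau.
Hypothesis tqb : forall l m i j, interior_node N l m -> `|tq l m i j| <= tau.
Hypothesis txb : forall l m : int, (l == 0) || (l == N%:Z) -> 0 <= m <= N%:Z ->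
  `|tx l m| <= tau.
Hypothesis tyb : forall l m : int, (m == 0) || (m == N%:Z) -> 0 <= l <= N%:Z ->
  `|ty l m| <= tau.
Hypotheses (C1c : `|2 * (c00 p - mgamma p)| <= C1) (C1q : `|2 * c02 p| <= C1).

Let Y := young dt C1 tau.
Let dtN0 : dt != 0. Proof. by rewrite gt_eqF. Qed.
Let hN0 : h != 0. Proof. by rewrite gt_eqF. Qed.

Lemma interior_step l m : interior_node N l m ->
  Y (e1 l m) (e0 l m) + \sum_(i < 2) \sum_(j < 2) Y (r1 l m i j) (r0 l m i j)
  <= dt * (G - linear_form p h e1 r1 l m + lam * e1 l m).
Proof.
move=> lm.
have Yc := young_le (e1 l m) (e0 l m) dt0 C1c (tcb lm).
have Yq i j := young_le (r1 l m i j) (r0 l m i j) dt0 C1q (tqb i j lm).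
have Ec : e1 l m - e0 l m = dt * (- (A l m + 2 * (c00 p - mgamma p) * e0 l m
    + L_c p h e1 r1 l m) + lam + tc l m).
  by rewrite -ceq//; field.
have Eq : r1 l m - r0 l m = dt *: (- projP (B l m + (2 * c02 p) *: r0 l m
    + L_Q p h e1 r1 l m) + tq l m).
  by rewrite -qeq// scalerA divff ?scale1r.
have Eij i j : r1 l m i j - r0 l m i j = dt * (- projP (B l m + (2 * c02 p) *: r0 l m
    + L_Q p h e1 r1 l m) i j + tq l m i j).
  by move: Eq => /matrixP/(_ i j); rewrite !mxE.
have S : \sum_(i < 2) \sum_(j < 2) (r1 l m i j * (r1 l m i j - r0 l m i j)
    + dt * (2 * c02 p * r0 l m i j * r1 l m i j) - dt * (tq l m i j * r1 l m i j))
  = - dt * \sum_(i < 2) \sum_(j < 2) ((B l m i j + L_Q p h e1 r1 l m i j) * r1 l m i j).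
  have := projP_pairing (B l m + (2 * c02 p) *: r0 l m + L_Q p h e1 r1 l m) (r1s lm).
  rewrite !sum_ord2 !Eij; move: (projP _) => V; move: (L_Q p h e1 r1 l m) => LQ.
  rewrite !mxE => H.
  transitivity (- dt * (V 0 0 * r1 l m 0 0 + V 0 1 * r1 l m 0 1
    + (V 1 0 * r1 l m 1 0 + V 1 1 * r1 l m 1 1)) + dt * (2 * c02 p) *
    (r0 l m 0 0 * r1 l m 0 0 + r0 l m 0 1 * r1 l m 0 1
    + (r0 l m 1 0 * r1 l m 1 0 + r0 l m 1 1 * r1 l m 1 1))); first by ring.
  by rewrite H; ring.
have M := mono lm.
apply: (@le_trans _ _ (e1 l m * (e1 l m - e0 l m)
    + dt * (2 * (c00 p - mgamma p) * e0 l m * e1 l m) - dt * (tc l m * e1 l m)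
  + \sum_(i < 2) \sum_(j < 2) (r1 l m i j * (r1 l m i j - r0 l m i j)
    + dt * (2 * c02 p * r0 l m i j * r1 l m i j) - dt * (tq l m i j * r1 l m i j)))).
  by rewrite lerD// ler_sum// => i _; rewrite ler_sum.
rewrite S Ec /linear_form.
rewrite [X in - dt * X](_ : _ = \sum_(i < 2) \sum_(j < 2) B l m i j * r1 l m i j
  + \sum_(i < 2) \sum_(j < 2) L_Q p h e1 r1 l m i j * r1 l m i j); last first.
  by rewrite -big_split; apply: eq_bigr => i _; rewrite -big_split; apply: eq_bigr => j _;
     rewrite mulrDl.
move: M; set b := \sum_(i < 2) \sum_(j < 2) B l m i j * _.
set q := \sum_(i < 2) \sum_(j < 2) L_Q _ _ _ _ _ _ _ _ * _ => M.
have M' : dt * - G <= dt * (A l m * e1 l m + b) by rewrite ler_pM2l.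
rewrite -subr_ge0 (_ : _ - _ = dt * (A l m * e1 l m + b) - dt * - G); last by ring.
by rewrite subr_ge0.
Qed.

Lemma boundary_step (D1 D0 g t : R) : (D1 - D0) / dt = - g + t -> `|t| <= tau ->
  Y D1 D0 <= - dt * (g * D1).
Proof.
(* There is no reaction term on the boundary: [young_le] is used with a = 0, but with the same [C1],
   so that interior and boundary terms carry the same weights. *)
move=> E tt; have a0 : `|0 : R| <= C1 by rewrite normr0; apply: le_trans C1q.
apply: le_trans (young_le D1 D0 dt0 a0 tt) _.
have -> : D1 - D0 = dt * (- g + t) by rewrite -E; field.
rewrite mul0r mul0r mulr0 addr0 le_eqVlt; apply/orP; left; apply/eqP; ring.
Qed.

(* At a corner both normal derivatives see the same discrete Laplacian, which
   is 2 (D_x + D_y) / h there. *)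
Lemma corner_step (Dx Dy Dx0 Dy0 g t s : R) : (Dx - Dx0) / dt = - g + t ->
  (Dy - Dy0) / dt = - g + s -> `|t| <= tau -> `|s| <= tau ->
  g = 2 * (Dx + Dy) / h -> Y Dx Dx0 + Y Dy Dy0 <= 0.
Proof.
move=> Ex Ey tt ss gE.
apply: le_trans (lerD (boundary_step Ex tt) (boundary_step Ey ss)) _.
rewrite -mulrDr -mulrDr gE mulNr oppr_le0 mulr_ge0 ?(ltW dt0)//.
rewrite (_ : 2 * (Dx + Dy) / h * (Dx + Dy) = 2 * (Dx + Dy) ^+ 2 / h); last by field; rewrite gt_eqF.
by rewrite divr_ge0 ?(ltW h0)// mulr_ge0 ?sqr_ge0.
Qed.

(** The trapezoidal weights give each corner one half from either adjacent side, and [corner_step]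
    makes the sum of the two nonpositive; only the nodes 1 <= k < N leave a flux. *)
Lemma boundary_sum_step :
  trap N (fun k => Y (Dnx h N e1 0 k%:Z) (Dnx h N e0 0 k%:Z))
  + trap N (fun k => Y (Dnx h N e1 N%:Z k%:Z) (Dnx h N e0 N%:Z k%:Z))
  + trap N (fun k => Y (Dny h N e1 k%:Z 0) (Dny h N e0 k%:Z 0))
  + trap N (fun k => Y (Dny h N e1 k%:Z N%:Z) (Dny h N e0 k%:Z N%:Z))
  <= - dt * \sum_(1 <= k < N) side_flux N (lap_h h e1) (Dnx h N e1) (Dny h N e1) k.
Proof.
have N00 : 0 <= 0%:Z <= N%:Z by [].
have NNN : 0 <= N%:Z <= N%:Z by rewrite lexx andbT.
have NZ : (N%:Z == 0) = false by rewrite eqz_nat gtn_eqF// ltnW.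
have z1 (j : int) : 0 <= j <= N%:Z -> e1 0 j = 0.
  by move=> jN; apply/ev/int_boundary; rewrite ?eqxx.
have z2 (j : int) : 0 <= j <= N%:Z -> e1 N%:Z j = 0.
  by move=> jN; apply/ev/int_boundary; rewrite ?eqxx ?orbT.
have z3 (j : int) : 0 <= j <= N%:Z -> e1 j 0 = 0.
  by move=> jN; apply/ev/int_boundary; rewrite ?eqxx ?orbT.
have z4 (j : int) : 0 <= j <= N%:Z -> e1 j N%:Z = 0.
  by move=> jN; apply/ev/int_boundary; rewrite ?eqxx ?orbT.
have N10 : 0 <= N%:Z - 1 <= N%:Z by move: N1; clear; lia.
have N11 : 0 <= 1%:Z <= N%:Z by move: N1; clear; lia.
rewrite !trapE ?(ltnW N1)//.
have o0 : (0 == 0 :> int) || (0 == N%:Z) by rewrite eqxx.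
have oN : (N%:Z == 0 :> int) || (N%:Z == N%:Z) by rewrite eqxx orbT.
have gE l m : lap_h h e1 l m = (e1 (l - 1) m - 2 * e1 l m + e1 (l + 1) m) / h ^+ 2
   + (e1 l (m - 1) - 2 * e1 l m + e1 l (m + 1)) / h ^+ 2.
  by rewrite lap_hE DD00E DD11E.
have c00 := corner_step (xeq o0 N00) (yeq o0 N00) (txb o0 N00) (tyb o0 N00).
have c0N := corner_step (xeq o0 NNN) (yeq oN N00) (txb o0 NNN) (tyb oN N00).
have cN0 := corner_step (xeq oN N00) (yeq o0 NNN) (txb oN N00) (tyb o0 NNN).
have cNN := corner_step (xeq oN NNN) (yeq oN NNN) (txb oN NNN) (tyb oN NNN).
have Z := (z1 0 N00, z1 1 N11, z1 N%:Z NNN, z1 (N%:Z - 1) N10, z2 0 N00, z2 1 N11,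
  z2 N%:Z NNN, z2 (N%:Z - 1) N10, z3 1 N11, z3 (N%:Z - 1) N10, z4 1 N11,
  z4 (N%:Z - 1) N10).
have {}c00 := c00 ltac:(rewrite gE /Dnx /Dny eqxx ?NZ !add0r !Z; field; exact: hN0).
have {}c0N := c0N ltac:(rewrite gE /Dnx /Dny eqxx ?NZ !add0r !Z; field; exact: hN0).
have {}cN0 := cN0 ltac:(rewrite gE /Dnx /Dny eqxx ?NZ !add0r !Z; field; exact: hN0).
have {}cNN := cNN ltac:(rewrite gE /Dnx /Dny ?NZ !Z; field; exact: hN0).
have S : \sum_(1 <= k < N) Y (Dnx h N e1 0 k%:Z) (Dnx h N e0 0 k%:Z)
  + \sum_(1 <= k < N) Y (Dnx h N e1 N%:Z k%:Z) (Dnx h N e0 N%:Z k%:Z)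
  + \sum_(1 <= k < N) Y (Dny h N e1 k%:Z 0) (Dny h N e0 k%:Z 0)
  + \sum_(1 <= k < N) Y (Dny h N e1 k%:Z N%:Z) (Dny h N e0 k%:Z N%:Z)
  <= - dt * \sum_(1 <= k < N) side_flux N (lap_h h e1) (Dnx h N e1) (Dny h N e1) k.
  rewrite -!big_split mulr_sumr; apply: ler_sum_nat => k kN.
  have [k0 _ _] := int_side kN.
  have b1 := boundary_step (xeq o0 k0) (txb o0 k0).
  have b2 := boundary_step (xeq oN k0) (txb oN k0).
  have b3 := boundary_step (yeq o0 k0) (tyb o0 k0).
  have b4 := boundary_step (yeq oN k0) (tyb oN k0).
  rewrite /side_flux !mulrDr addrA; rewrite !lerD//.
by move: S c00 c0N cN0 cNN; lra.
Qed.

Lemma energy_step (L : R) : h * N%:R = L -> 0 <= G ->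
  energy e1 r1 <= (1 + dt) * (1 + C1 * dt) ^+ 2 * energy e0 r0
  + dt * ((1 + dt) ^+ 2 * tau ^+ 2 * (5 * L ^+ 2 + 8 * c40 p * L)
          + 2 * (1 + dt) * G * L ^+ 2).
Proof.
move=> hN G0.
have c40p : 0 < c40 p by case: hp => _ [[]].
have d1 : 0 < 1 + dt by rewrite addr_gt0.
have h2 : 0 < h ^+ 2 by rewrite exprn_gt0.
have lf := linear_form_ge N1 h0 hp ev rv.
have bs := boundary_sum_step.
set al := (2 * (1 + dt))^-1; set be := (1 + C1 * dt) ^+ 2 / 2.
set de := (1 + dt) * dt * tau ^+ 2 / 2.
have YE v w : Y v w = al * v ^+ 2 - be * w ^+ 2 - de by [].
set P1 := sumP N (fun l m => e1 l m ^+ 2 + \sum_(i < 2) \sum_(j < 2) r1 l m i j ^+ 2).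
set P0 := sumP N (fun l m => e0 l m ^+ 2 + \sum_(i < 2) \sum_(j < 2) r0 l m i j ^+ 2).
set n2 := (N.-1 ^ 2)%:R : R.
have ip : sumP N (fun l m => Y (e1 l m) (e0 l m)
    + \sum_(i < 2) \sum_(j < 2) Y (r1 l m i j) (r0 l m i j))
    = al * P1 - be * P0 - n2 * (5 * de).
  rewrite /P1 /P0 /n2 -sumP_const -!sumPZ -!sumPB; apply: eq_sumP => l m _.
  by rewrite !sum_ord2 !YE; ring.
have ist := ler_sumP interior_step.
(* [lam] is constant in space and multiplies the nodal sum of [e1], which is zero. *)
rewrite ip sumPZ sumPD sumPB sumP_const sumPZ mass mulr0 addr0 -/n2 in ist.
set S1 := sum_sigma_Dn2 h N e1; set S0 := sum_sigma_Dn2 h N e0.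
have bp : trap N (fun k => Y (Dnx h N e1 0 k%:Z) (Dnx h N e0 0 k%:Z))
  + trap N (fun k => Y (Dnx h N e1 N%:Z k%:Z) (Dnx h N e0 N%:Z k%:Z))
  + trap N (fun k => Y (Dny h N e1 k%:Z 0) (Dny h N e0 k%:Z 0))
  + trap N (fun k => Y (Dny h N e1 k%:Z N%:Z) (Dny h N e0 k%:Z N%:Z))
  = al * S1 - be * S0 - 4 * N%:R * de.
  have trE (f g : nat -> R) : trap N (fun k => Y (f k) (g k)) =
      al * trap N (fun k => f k ^+ 2) - be * trap N (fun k => g k ^+ 2) - N%:R * de.
    exact: trap_comb.
  by rewrite /S1 /S0 !sum_sigma_trap !trE; ring.
rewrite bp in bs; set F := \sum_(1 <= k < N) side_flux _ _ _ _ _ in bs.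
rewrite -mulr_sumr -/F in lf.
set LF := sumP N (linear_form p h e1 r1) in ist lf.
have n2L : h ^+ 2 * n2 <= L ^+ 2.
  rewrite /n2 natrX -exprMn -hN lerXn2r// ?nnegrE ?mulr_ge0 ?(ltW h0)//.
  by rewrite ler_pM2l// ler_nat leq_pred.
have n20 : 0 <= h ^+ 2 * n2 by rewrite mulr_ge0// ltW.
have de0 : 0 <= de by rewrite divr_ge0// mulr_ge0 ?sqr_ge0// mulr_ge0// ltW.
(* The flux [F] cancels between [I2] and [I3]. The factor 5 counts one scalar and four tensor
   entries per node; 8 c40 L comes from 4 N edges with the weight 2 c40 h. *)
have T1 : al * (h ^+ 2 * P1 + 2 * c40 p * h * S1) - be * (h ^+ 2 * P0 + 2 * c40 p * h * S0)
   <= dt * (h ^+ 2 * n2 * G) + h ^+ 2 * n2 * (5 * de) + 8 * c40 p * L * de.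
  have I1 : h ^+ 2 * (al * P1 - be * P0 - n2 * (5 * de)) <=
      h ^+ 2 * (dt * (n2 * G - LF)) by rewrite ler_pM2l.
  have I2 : 2 * c40 p * h * (al * S1 - be * S0 - 4 * N%:R * de) <=
      2 * c40 p * h * (- dt * F) by rewrite ler_pM2l// mulr_gt0// mulr_gt0.
  have I3 : dt * - (2 * c40 p * (h * F)) <= dt * (h ^+ 2 * LF) by rewrite ler_pM2l.
  rewrite -subr_ge0; move: I1 I2 I3; rewrite -subr_ge0 => I1.
  rewrite -subr_ge0 => I2; rewrite -subr_ge0 => I3.
  apply: le_trans (addr_ge0 (addr_ge0 I1 I2) I3) _.
  rewrite le_eqVlt; apply/orP; left; apply/eqP; rewrite -hN; ring.
have T2 : dt * (h ^+ 2 * n2 * G) <= dt * (L ^+ 2 * G) by rewrite ler_pM2l// ler_wpM2r.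
have T3 : h ^+ 2 * n2 * (5 * de) <= L ^+ 2 * (5 * de) by rewrite ler_wpM2r// mulr_ge0.
have T : al * energy e1 r1 <= be * energy e0 r0
   + (dt * (L ^+ 2 * G) + L ^+ 2 * (5 * de) + 8 * c40 p * L * de).
  by rewrite /energy -/P1 -/P0 -/S1 -/S0; move: T1 T2 T3; lra.
have al0 : 0 < al by rewrite invr_gt0 mulr_gt0.
rewrite -(ler_pM2l al0); apply: le_trans T _.
rewrite le_eqVlt; apply/orP; left; apply/eqP.
by rewrite /al /be /de; field; rewrite gt_eqF.
Qed.

End energy_step.

(** * The discrete Gronwall lemma *)

Lemma gronwall (R : realType) (E : nat -> R) (a b dt T : R) (M : nat) :
  0 <= a -> 0 <= b -> 0 < dt -> M%:R * dt <= T -> E 0%N <= 0 ->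
  (forall n, (n < M)%N -> E n.+1 <= (1 + a * dt) * E n + b * dt) ->
  E M <= b * T * expR (a * T).
Proof.
move=> a0 b0 dt0 MT E0 Es.
have k1 : 1 <= 1 + a * dt by rewrite lerDl mulr_ge0// ltW.
have k0 : 0 <= 1 + a * dt by apply: le_trans k1.
have H n : (n <= M)%N -> E n <= b * (n%:R * dt) * (1 + a * dt) ^+ n.
  elim: n => [|n IH] nM; first by rewrite mul0r mulr0 mul0r.
  apply: le_trans (Es _ nM) _.
  have H1 : (1 + a * dt) * E n <= b * (n%:R * dt) * (1 + a * dt) ^+ n.+1.
    by rewrite exprS mulrCA ler_wpM2l// IH// ltnW.
  have H2 : b * dt <= b * dt * (1 + a * dt) ^+ n.+1.
    by rewrite ler_peMr ?exprn_ege1// mulr_ge0// ltW.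
  apply: le_trans (lerD H1 H2) _; rewrite -mulrDl ler_wpM2r ?exprn_ge0//.
  by rewrite -[n.+1]addn1 natrD mulrDl mul1r mulrDr.
apply: le_trans (H _ (leqnn _)) _.
have nd : 0 <= M%:R * dt by rewrite mulr_ge0// ltW.
have bT : b * (M%:R * dt) <= b * T by rewrite ler_wpM2l.
apply: ler_pM bT _; [by rewrite mulr_ge0|by rewrite exprn_ge0|].
apply: (@le_trans _ _ (expR (a * dt) ^+ M)).
  by rewrite lerXn2r ?nnegrE ?expR_ge0// expR_ge1Dx.
by rewrite -expRM_natl ler_expR mulrCA ler_wpM2l// mulrC.
Qed.

Section planar_integration.
(** * Quadrature and conservation of mass *)

Local Open Scope classical_set_scope.

Section planar_measurability.
Variable R : realType.

(** An open set is the union of the open rectangles with rational corners that it contains. The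
    other rectangles are replaced by the empty set, so that the union runs over a countable type. *)
Lemma open2_measurable (A : set (R * R)) : open A -> measurable A.
Proof.
move=> oA.
pose rect (q : (rat * rat) * (rat * rat)) : set (R * R) :=
  `]ratr q.1.1, ratr q.1.2[%classic `*` `]ratr q.2.1, ratr q.2.2[%classic.
pose F q := if `[< rect q `<=` A >] then rect q else set0.
have -> : A = \bigcup_q F q.
  apply/seteqP; split=> [[x y] Axy|z [q _]]; last first.
    by rewrite /F; case: ifP => // /asboolP; apply.
  have /nbhs_ballP[e /= e0 eA] : nbhs (x, y) A by exact: open_nbhs_nbhs.
  have rat_near (w : R) : exists q : rat * rat, ratr q.1 < w < ratr q.2 /\
      forall v : R, ratr q.1 < v < ratr q.2 -> ball w e v.
    have [q1] := @rat_in_itvoo R (w - e) w ltac:(by rewrite ltrBlDr ltrDl).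
    have [q2] := @rat_in_itvoo R w (w + e) ltac:(by rewrite ltrDl).
    rewrite !in_itv /= => /andP[a b] /andP[c d].
    exists (q1, q2); split=> /=; first by rewrite d a.
    by move=> v /andP[v1 v2]; rewrite /ball /= ltr_norml; apply/andP; split; lra.
  have [q [qx qb]] := rat_near x; have [r [ry rb]] := rat_near y.
  exists (q, r) => //; rewrite /F; case: ifPn => [_|/asboolP[]].
    by rewrite /rect; split; rewrite /= ?in_itv.
  move=> [v w] /= []; rewrite ?in_itv /= => vq wr; apply: eA.
  by split; [exact: qb|exact: rb].
apply: countable_bigcupT_measurable => [|q]; first exact: countableP.
rewrite /F; case: ifP => // _.
by apply: measurableX; exact: measurable_itv.
Qed.

Lemma continuous_section2 (f : R * R -> R) (x : R) :
  continuous f -> continuous (fun y => f (x, y)).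
Proof.
move=> cf y; apply: (@continuous_comp _ _ _ (fun y : R => (x, y)) f); last exact: cf.
apply: (@cvg_pair _ _ _ (nbhs y) (nbhs x) (nbhs y) _ _ _ (fun=> x) id).
  exact: cvg_cst.
exact: cvg_id.
Qed.

Lemma continuous_section1 (U V : topologicalType) (f : U * V -> R) (y : V) :
  continuous f -> continuous (fun x => f (x, y)).
Proof.
move=> cf x; apply: (@continuous_comp _ _ _ (fun x : U => (x, y)) f); last exact: cf.
apply: (@cvg_pair _ _ _ (nbhs x) (nbhs x) (nbhs y) _ _ _ id (fun=> y)).
  exact: cvg_id.
exact: cvg_cst.
Qed.

Lemma continuous2_measurable_fun (f : R * R -> R) :
  continuous f -> measurable_fun setT f.
Proof.
move=> /continuousP cf; apply: (measurability _ (measurable_realfun.RGenOpens.measurableE R)).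
move=> _ [_ [a [b ->] <-]]; rewrite setTI; apply: open2_measurable.
exact/cf/interval_open.
Qed.

End planar_measurability.

Section square_integral.
Variables (R : realType) (L : R).
Hypothesis L0 : 0 < L.
Local Notation mu := (@lebesgue_measure R).
Local Notation mu2 := (@lebesgue_measure R \x @lebesgue_measure R)%E.

Definition square : set (R * R) := `]0, L[%classic `*` `]0, L[%classic.

Lemma measurable_square : measurable square.
Proof. by apply: measurableX; exact: measurable_itv. Qed.

Lemma lebesgue_side : mu `]0, L[%classic = L%:E.
Proof. by rewrite lebesgue_measure_itv /= lte_fin L0 sube0. Qed.

Lemma square_area : mu2 square = (L ^+ 2)%:E.
Proof.
pose I : set R := `]0, L[%classic; transitivity (mu I * mu I)%E.
  by apply: product_measure1E; exact: measurable_itv.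
by rewrite /I !lebesgue_side -EFinM expr2.
Qed.

Lemma integrable_square (f : R * R -> R) (B : R) : continuous f ->
  (forall z, square z -> `|f z| <= B) -> mu2.-integrable square (EFin \o f).
Proof.
move=> cf fB; apply: measurable_bounded_integrable.
- exact: measurable_square.
- by have := ltry (L ^+ 2); rewrite -square_area.
- by apply: measurable_funTS; exact: continuous2_measurable_fun.
- exists B; split; first exact: num_real.
  by move=> M BM z sz /=; apply: le_trans (fB _ sz) (ltW BM).
Qed.

Lemma integrable_side (f : R -> R) (B : R) : continuous f ->
  (forall x, 0 < x < L -> `|f x| <= B) ->
  mu.-integrable `]0, L[%classic (EFin \o f).
Proof.
move=> cf fB; apply: measurable_bounded_integrable.
- exact: measurable_itv.
- by have := ltry L; rewrite -lebesgue_side.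
- by apply: measurable_funTS; exact: measurable_realfun.continuous_measurable_fun.
- exists B; split; first exact: num_real.
  move=> M BM z /=; rewrite in_itv /= => sz.
  by apply: le_trans (fB _ sz) (ltW BM).
Qed.

Lemma fubini_square (f : R * R -> R) (B : R) : continuous f ->
  (forall z, square z -> `|f z| <= B) ->
  let g x := (\int[mu]_(y in `]0, L[%classic) f (x, y))%R in
  (\int[mu2]_(z in square) f z)%R = (\int[mu]_(x in `]0, L[%classic) g x)%R
  /\ mu.-integrable `]0, L[%classic (EFin \o g).
Proof.
move=> cf fB g; have If := integrable_square cf fB.
have It : mu2.-integrable setT ((EFin \o f) \_ square).
  have [H _] := integrable_mkcond (mu := mu2) (EFin \o f) measurable_square.
  exact: H If.
have FE : fubini_F mu ((EFin \o f) \_ square) = (EFin \o g) \_ `]0, L[%classic.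
  apply/funext => x; rewrite /fubini_F [RHS]patchE.
  case: ifPn => xL; last first.
    rewrite (eq_integral (fun=> 0%E)) ?integral0// => y _.
    by rewrite patchE ifF//; apply/negbTE; move: xL; rewrite !notin_setE => xL [].
  rewrite /= /g /Rintegral fineK; last first.
    apply: integrable_fin_num; first exact: measurable_itv.
    apply: (integrable_side (B := B)).
      exact: continuous_section2.
    move=> y yL; apply: fB; split => /=; first by move: xL; rewrite inE.
    by rewrite in_itv.
  rewrite [RHS]integral_mkcond; apply: eq_integral => y _.
  rewrite !patchE; congr (if _ then _ else _).
  apply/idP/idP; rewrite !inE; first by case.
  by move=> yL; split => //; rewrite inE in xL.
split; last first.
  have [_ H] := integrable_mkcond (mu := mu) (EFin \o g) (measurable_itv (Interval (BRight 0) (BLeft L))).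
  by apply: H; rewrite -FE; exact: integrable_fubini_F It.
rewrite /Rintegral [in LHS]integral_mkcond -(integral12_prod_meas1 It).
rewrite [in RHS]integral_mkcond; congr fine; apply: eq_integral => x _.
by rewrite -[RHS](congr1 (@^~ x) FE).
Qed.

End square_integral.

Section trapezoid_rule.
Variables (R : realType) (L : R).
Hypothesis L0 : 0 < L.
Local Notation mu := (@lebesgue_measure R).

(** On a cell, the second order expansion of the primitive minus h / 2 times the first order
    expansion of g removes the derivative of g and leaves O(h^3). As g vanishes at both ends, the
    trapezoidal sum is the interior sum. *)
Lemma trapezoid_rule (g : nat -> R -> R) (B h : R) (N : nat) :
  (0 < N)%N -> N%:R * h = L ->
  (forall k (z : R), (k < 2)%N -> is_derive z 1 (g k) (g k.+1 z)) ->
  (forall z, 0 <= z <= L -> `|g 2 z| <= B) -> g 0%N 0 = 0 -> g 0%N L = 0 ->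
  `|(\int[mu]_(x in `]0%R, L[%classic) g 0%N x)%R
    - h * \sum_(1 <= k < N) g 0%N (k%:R * h)| <= 2 * B * L * h ^+ 2.
Proof.
move=> N0 hN dg gB g0 gL.
have NR : (0 : R) < N%:R by rewrite ltr0n.
have h0 : 0 < h by rewrite -(pmulr_rgt0 _ NR) hN.
have cg : continuous (g 0%N) by move=> z; exact: is_derive_continuous (dg 0%N z isT).
have Ig (a b : R) : mu.-integrable `[a, b] (EFin \o g 0%N).
  apply: continuous_compact_integrable; first exact: segment_compact.
  exact: continuous_subspaceT.
(* The primitive starts at - 1 and the fundamental theorem is used on [- 1, L + 1], so that [F] has
   a two-sided derivative at 0 and at [L] too. *)
pose F x := (\int[mu]_(t in `[(- 1)%R, x]) g 0%N t)%R.
have dF (z : R) : 0 <= z <= L -> is_derive z 1 F (g 0%N z).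
  move=> /andP[z0 zL].
  have zu : z < L + 1 by rewrite (le_lt_trans zL)// ltrDl.
  have zl : -1 < z by rewrite (lt_le_trans _ z0)// ltrN10.
  have [d1 d2] := continuous_FTC1_closed zu (Ig (-1) (L + 1)) zl (cg z).
  by rewrite -d2 derive1E; exact/derivableP.
have IF : (\int[mu]_(x in `]0%R, L[%classic) g 0%N x)%R = F L - F 0.
  rewrite /F Rintegral_itvB ?bnd_simp ?(ltW L0) ?lerN10//.
  rewrite Rintegral_itv_bndo_bndc//.
  by apply: integrableS (Ig 0 L) => //; apply: subset_itv => //; rewrite ?bnd_simp.
pose f k := if k is k'.+1 then g k' else F.
have cell (k : nat) : (k < N)%N ->
    `|F (k.+1%:R * h) - F (k%:R * h)
      - h * ((g 0%N (k%:R * h) + g 0%N (k.+1%:R * h)) / 2)| <= 2 * B * h ^+ 3.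
  move=> kN; set a := k%:R * h; have -> : k.+1%:R * h = a + h.
    by rewrite -natr1 mulrDl mul1r.
  have a0 : 0 <= a by rewrite mulr_ge0// ltW.
  have aL : a + h <= L.
    rewrite -hN (_ : a + h = k.+1%:R * h); last by rewrite -natr1 mulrDl mul1r.
    by rewrite ler_pM2r// ler_nat.
  have aI : 0 <= a <= L by move: a0 aL h0; lra.
  have bI : 0 <= a + h <= L by move: a0 aL h0; lra.
  have T3 := @taylor_bound_on _ 3 f 0 L B _ gB a (a + h) aI bI.
  have {}T3 := T3 ltac:(by move=> [|j] z j3 zL; [exact: dF|exact: dg]).
  have T2 := taylor_bound dg gB aI bI.
  move: T3 T2; rewrite !big_ord_recl !big_ord0 /= (_ : a + h - a = h); last by ring.
  rewrite /bump /= !factS fact0 (gtr0_norm h0) => T3 T2.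
  have h2 : 0 < h / 2 by rewrite divr_gt0.
  have T2' : `|h / 2 * (g 0%N (a + h) - (g 0%N a + g 1%N a * h))| <= h / 2 * (B * h ^+ 2).
    rewrite normrM gtr0_norm// ler_pM2l//; move: T2; congr (_ <= _).
    by congr `| _ |; rewrite addr0 addn0 expr0 expr1; field.
  have B0 : 0 <= B * h ^+ 3.
    by rewrite mulr_ge0 ?exprn_ge0 ?(ltW h0)//; apply: le_trans (gB _ aI).
  apply: (@le_trans _ _ (B * h ^+ 3 + h / 2 * (B * h ^+ 2))); last first.
    by rewrite (_ : h / 2 * (B * h ^+ 2) = B * h ^+ 3 / 2); [move: B0; lra|field].
  move: (norm_sub_le T3 T2'); congr (_ <= _).
  by congr `| _ |; rewrite addr0 !addn0 ?expr0 ?expr1; field.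
have -> : (\int[mu]_(x in `]0%R, L[%classic) g 0%N x)%R
    - h * \sum_(1 <= k < N) g 0%N (k%:R * h) =
  \sum_(0 <= k < N) (F (k.+1%:R * h) - F (k%:R * h)
      - h * ((g 0%N (k%:R * h) + g 0%N (k.+1%:R * h)) / 2)).
  rewrite sumrB telescope_sumr// IF hN mul0r -mulr_sumr; congr (_ - _ * _).
  have := trapE N0 (fun k => g 0%N (k%:R * h)).
  by rewrite /trap hN mul0r g0 gL mul0r add0r addr0 => ->.
apply: le_trans (ler_norm_sum _ _ _) _.
apply: (@le_trans _ _ (\sum_(0 <= k < N) 2 * B * h ^+ 3)).
  by apply: ler_sum_nat => k /andP[_ kN]; exact: cell.
rewrite sumr_const_nat subn0 -mulr_natr -[in X in _ <= X]hN.
by rewrite le_eqVlt; apply/orP; left; apply/eqP; ring.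
Qed.

End trapezoid_rule.

Lemma Rintegral_sum (R : realType) (I : interval R) (s : seq nat) (F : nat -> R -> R)
    (mu := @lebesgue_measure R) (D := [set` I]) :
  (forall i, i \in s -> mu.-integrable D (EFin \o F i)) ->
  mu.-integrable D (EFin \o (fun x => \sum_(i <- s) F i x)) /\
  (\int[mu]_(x in D) (\sum_(i <- s) F i x))%R =
    \sum_(i <- s) (\int[mu]_(x in D) F i x)%R.
Proof.
elim: s => [|i s IH] Fi.
  split; last first.
    rewrite big_nil; transitivity (\int[mu]_(x in D) (0 : R))%R.
      by apply: eq_Rintegral => x _; rewrite big_nil.
    by rewrite /Rintegral integral0.
  rewrite (_ : _ \o _ = cst 0%E); first exact: integrable0.
  by apply/funext => x /=; rewrite big_nil.
have [I1 E1] := IH (fun j js => Fi j ltac:(by rewrite inE js orbT)).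
have Ii := Fi i (mem_head _ _).
have FE : (fun x => \sum_(j <- i :: s) F j x) = (fun x => F i x + \sum_(j <- s) F j x).
  by apply/funext => x; rewrite big_cons.
rewrite FE big_cons -E1; split; last first.
  by rewrite RintegralD//; exact: measurable_itv.
pose G x := \sum_(j <- s) F j x.
have H : mu.-integrable D (fun x => (F i x)%:E + (G x)%:E)%E.
  by apply: integrableD => //; exact: measurable_itv.
by move: H; apply: eq_integrable => //; exact: measurable_itv.
Qed.

Section square_quadrature.
Variables (R : realType) (L : R).
Hypothesis L0 : 0 < L.
Local Notation mu := (@lebesgue_measure R).
Local Notation mu2 := (@lebesgue_measure R \x @lebesgue_measure R)%E.

(** [S] is discretised in y only. Passing from the inner integral to [S] costs one trapezoidal error
    for each x, integrated over the side; passing from [S] to the grid sum costs one for each grid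
    line. *)
Lemma square_quadrature (ux uy : nat -> R -> R -> R) (u : R -> R -> R)
    (B A h : R) (N : nat) :
  (0 < N)%N -> N%:R * h = L ->
  continuous (fun z : R * R => u z.1 z.2) ->
  (forall x y, 0 <= x <= L -> 0 <= y <= L -> `|u x y| <= A) ->
  ux 0%N = u -> uy 0%N = u ->
  (forall k (x y : R), (k < 2)%N ->
     is_derive x 1 (fun x => ux k x y) (ux k.+1 x y)) ->
  (forall k (x y : R), (k < 2)%N -> is_derive y 1 (uy k x) (uy k.+1 x y)) ->
  (forall x y, 0 <= x <= L -> 0 <= y <= L -> `|ux 2 x y| <= B) ->
  (forall x y, 0 <= x <= L -> 0 <= y <= L -> `|uy 2 x y| <= B) ->
  (forall x y, 0 <= x <= L -> 0 <= y <= L ->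
     (x == 0) || (x == L) || (y == 0) || (y == L) -> u x y = 0) ->
  `|(\int[mu2]_(z in square L) u z.1 z.2)%R
    - h ^+ 2 * sumP N (fun l m => u (l%:~R * h) (m%:~R * h))|
  <= 4 * B * L ^+ 2 * h ^+ 2.
Proof.
move=> N0 hN cu uA ux0 uy0 dux duy uxB uyB ub.
have NR : (0 : R) < N%:R by rewrite ltr0n.
have h0 : 0 < h by rewrite -(pmulr_rgt0 _ NR) hN.
have L00 : (0 : R) <= 0 <= L by rewrite lexx ltW.
have LLL : 0 <= L <= L by apply/andP; split => //; exact: ltW.
have B0 : 0 <= B by apply: le_trans (uxB 0 0 L00 L00).
have grid (k : nat) : (1 <= k < N)%N -> 0 <= k%:R * h <= L.
  move=> /andP[_ kN]; rewrite mulr_ge0 ?(ltW h0)//= -hN ler_pM2r//.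
  by rewrite ler_nat ltnW.
pose g x := (\int[mu]_(y in `]0%R, L[%classic) u x y)%R.
have uA' : forall z, square L z -> `|u z.1 z.2| <= A.
  move=> [x y] [/=]; rewrite !in_itv /= => /andP[x0 xL] /andP[y0 yL].
  by apply: uA; rewrite !ltW.
have [IE Ig] : (\int[mu2]_(z in square L) u z.1 z.2)%R =
    (\int[mu]_(x in `]0%R, L[%classic) g x)%R /\
    mu.-integrable `]0%R, L[%classic (EFin \o g).
  exact: (fubini_square L0 cu uA').
rewrite IE.
pose S x := h * \sum_(1 <= m < N) u x (m%:R * h).
have gS (x : R) : 0 < x < L -> `|g x - S x| <= 2 * B * L * h ^+ 2.
  move=> /andP[x0 xL]; have xI : 0 <= x <= L by rewrite !ltW.
  have := @trapezoid_rule R L L0 (fun k y => uy k x y) B h N N0 hN.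
  rewrite uy0; apply => [k z k2|z zL||]; [exact: duy|exact: uyB| |].
    by apply: ub => //; rewrite eqxx !orbT.
  by apply: ub => //; rewrite eqxx !orbT.
have cux (y : R) : continuous (fun x => u x y).
  by move=> x; have := is_derive_continuous (dux 0%N x y isT); rewrite ux0.
have Iu (m : nat) : (1 <= m < N)%N ->
    mu.-integrable `]0%R, L[%classic (EFin \o (fun x => u x (m%:R * h))).
  move=> mN; apply: (integrable_side L0 (B := A)) => // x /andP[x0 xL].
  by apply: uA; rewrite ?grid// !ltW.
have [ISs ISE] := @Rintegral_sum _ (Interval (BRight 0) (BLeft L)) (index_iota 1 N) (fun m x => u x (m%:R * h))
  (fun m mN => Iu m ltac:(by move: mN; rewrite mem_index_iota)).
have IS : mu.-integrable `]0%R, L[%classic (EFin \o S).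
  have : mu.-integrable `]0%R, L[%classic (fun x => h%:E * (\sum_(m <- index_iota 1 N) u x (m%:R * h))%R%:E)%E.
    by apply: integrableZl => //; exact: measurable_itv.
  by apply: eq_integrable => //; exact: measurable_itv.
have SE : (\int[mu]_(x in `]0%R, L[%classic) S x)%R =
   h * \sum_(1 <= m < N) (\int[mu]_(x in `]0%R, L[%classic) u x (m%:R * h))%R.
  by rewrite /S RintegralZl ?ISE//; exact: measurable_itv.
have muL : fine (mu `]0%R, L[%classic) = L by rewrite lebesgue_side.
have D1 : `|(\int[mu]_(x in `]0%R, L[%classic) g x)%R
    - (\int[mu]_(x in `]0%R, L[%classic) S x)%R| <= 2 * B * L * h ^+ 2 * L.
  rewrite -RintegralB//.
  have IB : mu.-integrable `]0%R, L[%classic (EFin \o (fun x => g x - S x)).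
    have : mu.-integrable `]0%R, L[%classic (fun x => (g x)%:E - (S x)%:E)%E.
      by apply: integrableB => //; exact: measurable_itv.
    by apply: eq_integrable => //; exact: measurable_itv.
  apply: (@le_trans _ _ (\int[mu]_(x in `]0%R, L[%classic) `|g x - S x|)%R).
    by apply: le_normr_Rintegral => //; exact: measurable_itv.
  rewrite -[X in _ * X]muL -Rintegral_cst//; apply: le_Rintegral => //.
  - by have := integrable_abse IB; apply: eq_integrable => //; exact: measurable_itv.
  - by apply: (integrable_side L0 (B := `|2 * B * L * h ^+ 2|)) => // x; exact: cvg_cst.
have D2 : `|(\int[mu]_(x in `]0%R, L[%classic) S x)%R
    - h ^+ 2 * sumP N (fun l m => u (l%:~R * h) (m%:~R * h))|
    <= 2 * B * L ^+ 2 * h ^+ 2.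
  have -> : h ^+ 2 * sumP N (fun l m => u (l%:~R * h) (m%:~R * h)) =
      h * \sum_(1 <= m < N) h * \sum_(1 <= l < N) u (l%:R * h) (m%:R * h).
    rewrite /sumP exchange_big_nat /= expr2 -mulrA; congr (h * _).
    rewrite mulr_sumr; apply: eq_bigr => m _; congr (h * _).
  rewrite SE -mulrBr -sumrB normrM gtr0_norm//.
  apply: (@le_trans _ _ (h * \sum_(1 <= m < N) 2 * B * L * h ^+ 2)).
    rewrite ler_pM2l//; apply: le_trans (ler_norm_sum _ _ _) _.
    apply: ler_sum_nat => m mN.
    have := @trapezoid_rule R L L0 (fun k x => ux k x (m%:R * h)) B h N N0 hN.
    rewrite ux0; apply.
    - by move=> z zL; apply: uxB => //; exact: grid.
    - by apply: ub => //; rewrite ?grid// eqxx.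
    - by apply: ub => //; rewrite ?grid// eqxx orbT.
  rewrite sumr_const_nat -[X in h * X]mulr_natr.
  rewrite (_ : h * (2 * B * L * h ^+ 2 * (N - 1)%:R) =
    2 * B * L * h ^+ 2 * ((N - 1)%:R * h)); last by ring.
  rewrite (_ : 2 * B * L ^+ 2 * h ^+ 2 = 2 * B * L * h ^+ 2 * L); last by ring.
  apply: ler_wpM2l; first by rewrite !mulr_ge0 ?sqr_ge0 ?(ltW L0) ?(ltW h0).
  by rewrite -hN ler_pM2r// ler_nat leq_subr.
have H := norm_add_le D1 D2; rewrite addrA subrK in H; apply: le_trans H _.
by rewrite le_eqVlt; apply/orP; left; apply/eqP; ring.
Qed.

End square_quadrature.

End planar_integration.

(** * Conservation of the exact mass *)

Definition regular_solution (R : realType) (p : model R) (T K : R)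
    (cbnd : R -> R -> R) (Qbnd : R -> R -> 'M[R]_2)
    (c : R -> R -> R -> R) (Q : R -> R -> R -> 'M[R]_2) : Prop :=
  [/\ classC 6 c, forall i j : 'I_2, classC 4 (tcomp Q i j),
      exact_solution p T cbnd Qbnd c Q, derivs_le 6 c 0 (mL p) T K
    & forall i j : 'I_2, derivs_le 4 (tcomp Q i j) 0 (mL p) T K].

(** Cutting [s, t] into n equal pieces gives the bound C (t - s)^2 / n. This takes the place of
    differentiation under the integral sign: a Taylor expansion in time bounds the increments of the
    mass by a square. *)
Lemma quadratic_increment_const (R : realType) (G : R -> R) (T C : R) :
  (forall s t, 0 <= s <= t -> t <= T -> `|G t - G s| <= C * (t - s) ^+ 2) ->
  forall s t, 0 <= s <= t -> t <= T -> G t = G s.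
Proof.
move=> GC s t st tT; apply/eqP; rewrite -subr_eq0 -normr_le0.
apply/ler_addgt0Pl => e e0; rewrite addr0.
have [st0 st1] := andP st.
pose D := C * (t - s) ^+ 2.
have [n nD] : exists n : nat, D / e < n.+1%:R.
  exists (Num.trunc (D / e)); exact: truncnS_gt.
pose d := (t - s) / n.+1%:R.
have n0 : (0 : R) < n.+1%:R by rewrite ltr0n.
have d0 : 0 <= d by rewrite divr_ge0 ?subr_ge0// ltW.
have dE : n.+1%:R * d = t - s by rewrite /d mulrC divfK// gt_eqF.
have -> : G t - G s = \sum_(0 <= k < n.+1) (G (s + k.+1%:R * d) - G (s + k%:R * d)).
  by rewrite (telescope_sumr (fun k => G (s + k%:R * d)))// dE mul0r addr0 [s + _]addrC subrK.
apply: le_trans (ler_norm_sum _ _ _) _.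
apply: (@le_trans _ _ (\sum_(0 <= k < n.+1) C * d ^+ 2)).
  apply: ler_sum_nat => k /andP[_ kn].
  have -> : C * d ^+ 2 = C * (s + k.+1%:R * d - (s + k%:R * d)) ^+ 2.
    by rewrite -natr1; congr (C * _ ^+ 2); ring.
  apply: GC.
    by rewrite lerD2l ler_wpM2r ?ler_nat// addr_ge0// mulr_ge0.
  have : k.+1%:R * d <= n.+1%:R * d by rewrite ler_wpM2r// ler_nat.
  by rewrite dE; move: tT; lra.
rewrite sumr_const_nat subn0 -mulr_natr.
have -> : C * d ^+ 2 * n.+1%:R = D / n.+1%:R.
  by rewrite /D /d; field; rewrite gt_eqF.
rewrite ler_pdivrMr// mulrC; apply: ltW.
by rewrite -ltr_pdivrMr.
Qed.

Section exact_mass.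
Variables (R : realType) (p : model R) (T K : R).
Variables (cbnd : R -> R -> R) (Qbnd : R -> R -> 'M[R]_2).
Variables (c : R -> R -> R -> R) (Q : R -> R -> R -> 'M[R]_2).
Hypotheses (hp : model_ok p) (hT : 0 < T).
Hypothesis sol : regular_solution p T K cbnd Qbnd c Q.
Let L := mL p.
Let L0 : 0 < L. Proof. by case: hp => -[]. Qed.
Let cc : classC 6 c. Proof. by case: sol. Qed.
Let cK : derivs_le 6 c 0 L T K. Proof. by case: sol. Qed.
Let ex : exact_solution p T cbnd Qbnd c Q. Proof. by case: sol. Qed.
Local Notation mu2 := (@lebesgue_measure R \x @lebesgue_measure R)%E.

Lemma derivative_bound_ge0 : 0 <= K.
Proof.
have L00 : (0 : R) <= 0 <= L by rewrite lexx ltW.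
have T00 : (0 : R) <= 0 <= T by rewrite lexx ltW.
exact: le_trans (normr_ge0 _) (cK (s := [:: sx]) isT L00 L00 T00).
Qed.

Lemma square_in (z : R * R) : square L z -> 0 < z.1 < L /\ 0 < z.2 < L.
Proof. by move=> [/=]; rewrite !in_itv. Qed.

Lemma continuous_slice (u : R -> R -> R -> R) (k : nat) (t : R) : classC k u ->
  continuous (fun z : R * R => u z.1 z.2 t).
Proof.
by move=> /classC_continuous cu; exact: (@continuous_section1 R (R * R)%type R
  (fun q => u q.1.1 q.1.2 q.2) t cu).
Qed.

Lemma exact_admissible (x y t : R) : 0 < x < L -> 0 < y < L -> 0 <= t <= T ->
  admissible (mM p) (c x y t) (Q x y t).
Proof. by case: ex => _ H _ _ _ xL yL tT; have [] := H x y t xL yL tT. Qed.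

Let integrable_c (t : R) : 0 <= t <= T ->
  mu2.-integrable (square L) (EFin \o (fun z : R * R => c z.1 z.2 t)).
Proof.
move=> tT; apply: (integrable_square L0 (B := mM p)).
  exact: continuous_slice cc.
move=> z /square_in[z1 z2]; have [/andP[c0 cM] _] := exact_admissible z1 z2 tT.
by rewrite gtr0_norm// ltW.
Qed.

Let integrable_ct (t : R) : 0 <= t <= T ->
  mu2.-integrable (square L) (EFin \o (fun z : R * R => pd Time c z.1 z.2 t)).
Proof.
move=> tT; apply: (integrable_square L0 (B := K)).
  exact: (@continuous_slice (pd Time c) 5 t (@classC_pds _ 6 [:: Time] c isT cc)).
move=> z /square_in[/andP[a1 a2] /andP[b1 b2]].
by apply: (cK (s := [:: Time])) => //; rewrite !ltW.
Qed.

Let fine_area : fine (mu2 (square L)) = L ^+ 2.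
Proof. by rewrite square_area. Qed.

Let mD := @measurable_square R L.

(** Nothing is known beforehand on the integrability of the chemical potential near the boundary.
    The equation itself writes it on the open square as its mean m minus the bounded d_t c; taking
    means gives m = m - mean of d_t c. *)
Lemma mean_rate_zero (t : R) : 0 <= t <= T ->
  (\int[mu2]_(z in square L) pd Time c z.1 z.2 t)%R = 0.
Proof.
move=> tT; pose A x y := chem_c p c Q x y t.
pose m := mean_square L A.
have E : m = (L ^+ 2)^-1 * (\int[mu2]_(z in square L) (m - pd Time c z.1 z.2 t))%R.
  rewrite {1}/m /mean_square; congr (_ * _).
  apply: eq_Rintegral => z; rewrite inE => /square_in[z1 z2].
  case: ex => _ H _ _ _; have [_ -> _] := H _ _ _ z1 z2 tT.
  by rewrite opprK /projG [m + _]addrC subrK.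
have Im : mu2.-integrable (square L) (EFin \o (fun _ : R * R => m)).
  by apply: (integrable_square L0 (B := `|m|)) => // z; exact: cvg_cst.
move: E; rewrite RintegralB//; last exact: integrable_ct.
rewrite Rintegral_cst// fine_area mulrBr.
have L2 : L ^+ 2 != 0 by rewrite expf_neq0// gt_eqF.
rewrite mulrCA mulVf// mulr1 => /eqP; rewrite -subr_eq0 opprB addrC subrK.
by rewrite mulf_eq0 invr_eq0 (negbTE L2) => /eqP.
Qed.

Lemma mass_conserved (t t' : R) : 0 <= t <= T -> 0 <= t' <= T ->
  (\int[mu2]_(z in square L) (c z.1 z.2 t' - c z.1 z.2 t))%R = 0.
Proof.
wlog tt : t t' / t <= t'.
  move=> H tT tT'; case/orP: (le_total t t') => tt; first exact: H.
  have := H _ _ tt tT' tT; rewrite !RintegralB ?integrable_c// => /eqP.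
  by rewrite subr_eq0 => /eqP ->; rewrite subrr.
move=> tT tT'; pose G s := (\int[mu2]_(z in square L) c z.1 z.2 s)%R.
suff GE : G t' = G t by rewrite RintegralB ?integrable_c// -/(G t) -/(G t') GE subrr.
apply: (@quadratic_increment_const _ G T (K * L ^+ 2)); last 2 first.
- by move: tT tT' tt; lra.
- by case/andP: tT'.
move=> s r /andP[s0 sr] rT.
have sT : 0 <= s <= T by rewrite s0 (le_trans sr).
have rT' : 0 <= r <= T by rewrite rT (le_trans s0).
have pointwise z : square L z ->
    `|c z.1 z.2 r - (c z.1 z.2 s + (r - s) * pd Time c z.1 z.2 s)| <= K * (r - s) ^+ 2.
  move=> /square_in[/andP[a1 a2] /andP[b1 b2]].
  have := @taylor_bound _ 2 (fun k w => pds (nseq k Time) c z.1 z.2 w) 0 T K.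
  move=> /(_ _ _ s r sT rT'); rewrite !big_ord_recl big_ord0 /= /bump /= fact0 expr0.
  rewrite (ger0_norm (_ : 0 <= r - s)) ?subr_ge0//; set X := (X in `|X| <= _).
  move=> H; have -> : c z.1 z.2 r - (c z.1 z.2 s + (r - s) * pd Time c z.1 z.2 s) = X.
    rewrite /X addr0 mulr1 divr1 (_ : (1 + 0)%N = 1%N)// expr1 divr1.
    by congr (_ - (_ + _)); rewrite mulrC.
  apply: H => [k w k2|w wT].
    apply: (is_derive_pdst cc (s := nseq k Time)).
    by rewrite size_nseq; exact: leq_trans k2 _.
  by apply: (cK (s := [:: Time; Time])) => //; rewrite !ltW.
have ctc : continuous (fun z : R * R => (r - s) * pd Time c z.1 z.2 s).
  move=> z; apply: cvgM; first exact: cvg_cst.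
  exact: (@continuous_slice (pd Time c) 5 s (@classC_pds _ 6 [:: Time] c isT cc)).
have W0 : (\int[mu2]_(z in square L) ((r - s) * pd Time c z.1 z.2 s))%R = 0.
  by rewrite RintegralZl ?mean_rate_zero ?mulr0//; exact: integrable_ct.
have Is : mu2.-integrable (square L)
    (EFin \o (fun z : R * R => c z.1 z.2 s + (r - s) * pd Time c z.1 z.2 s)).
  apply: (integrable_square L0 (B := mM p + `|r - s| * K)).
    by move=> z; apply: cvgD; [exact: (continuous_slice cc)|exact: ctc].
  move=> z Lz; have [z1 z2] := square_in Lz; apply: norm_add_le.
    have [/andP[c0 cM] _] := exact_admissible z1 z2 sT.
    by rewrite gtr0_norm// ltW.
  have [/andP[a1 a2] /andP[b1 b2]] := square_in Lz.
  rewrite normrM ler_wpM2l//.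
  by apply: (cK (s := [:: Time])) => //; rewrite !ltW.
have Iw : mu2.-integrable (square L)
    (EFin \o (fun z : R * R => (r - s) * pd Time c z.1 z.2 s)).
  apply: (integrable_square L0 (B := `|r - s| * K)) => // z.
  move=> /square_in[/andP[a1 a2] /andP[b1 b2]]; rewrite normrM ler_wpM2l//.
  by apply: (cK (s := [:: Time])) => //; rewrite !ltW.
have GE : G r - G s = (\int[mu2]_(z in square L)
    (c z.1 z.2 r - (c z.1 z.2 s + (r - s) * pd Time c z.1 z.2 s)))%R.
  by rewrite RintegralB ?integrable_c// RintegralD ?integrable_c// W0 addr0.
have ID : mu2.-integrable (square L) (EFin \o (fun z : R * R =>
    c z.1 z.2 r - (c z.1 z.2 s + (r - s) * pd Time c z.1 z.2 s))).
  apply: (integrable_square L0 (B := K * (r - s) ^+ 2)); last exact: pointwise.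
  move=> z; apply: cvgB; first exact: (continuous_slice cc).
  by apply: cvgD; [exact: (continuous_slice cc)|exact: ctc].
rewrite GE; apply: (@le_trans _ _ (\int[mu2]_(z in square L)
    `|c z.1 z.2 r - (c z.1 z.2 s + (r - s) * pd Time c z.1 z.2 s)|)%R).
  by apply: le_normr_Rintegral.
rewrite -mulrA [L ^+ 2 * _]mulrC mulrA -fine_area -Rintegral_cst//.
apply: le_Rintegral => //.
- exact: (integrable_abse ID).
- by apply: (integrable_square L0 (B := `|K * (r - s) ^+ 2|)) => // z; exact: cvg_cst.
Qed.

End exact_mass.

(** * A priori bounds *)

Lemma norm_half_sub_le (R : realType) (a b B : R) :
  `|a| <= B -> `|b| <= B -> `|(a - b) / 2| <= B.
Proof.
move=> aB bB; rewrite normrM (gtr0_norm (_ : 0 < 2^-1)) ?invr_gt0//.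
by have := norm_sub_le aB bB; lra.
Qed.

Lemma norm_half_add_le (R : realType) (a b B : R) :
  `|a| <= B -> `|b| <= B -> `|(a + b) / 2| <= B.
Proof.
by move=> aB bB; rewrite -[b]opprK; apply: norm_half_sub_le; rewrite ?normrN.
Qed.

Section a_priori_bounds.
Variables (R : realType) (p : model R) (T K : R).
Variables (cbnd : R -> R -> R) (Qbnd : R -> R -> 'M[R]_2).
Variables (c : R -> R -> R -> R) (Q : R -> R -> R -> 'M[R]_2).
Hypotheses (hp : model_ok p) (hT : 0 < T).
Hypothesis sol : regular_solution p T K cbnd Qbnd c Q.
Let L := mL p.
Let L0 : 0 < L. Proof. by case: hp => -[]. Qed.
Let M0 : 0 < mM p. Proof. by case: hp => -[]. Qed.
Let nu0 : 0 < mnu p. Proof. by case: hp => -[]. Qed.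
Let cc : classC 6 c. Proof. by case: sol. Qed.
Let cK : derivs_le 6 c 0 L T K. Proof. by case: sol. Qed.
Let QK (i j : 'I_2) : derivs_le 4 (tcomp Q i j) 0 L T K.
Proof. by case: sol. Qed.
Let ex : exact_solution p T cbnd Qbnd c Q. Proof. by case: sol. Qed.

Lemma exact_boundary (x y t : R) : 0 <= x <= L -> 0 <= y <= L -> 0 <= t <= T ->
  (x == 0) || (x == L) || (y == 0) || (y == L) ->
  c x y t = cbnd x y /\ Q x y t = Qbnd x y.
Proof. by case: ex => _ _ H _ _; exact: H. Qed.

Lemma exact_cases (x y : R) : 0 <= x <= L -> 0 <= y <= L ->
  ((x == 0) || (x == L) || (y == 0) || (y == L)) \/ (0 < x < L /\ 0 < y < L).
Proof.
move=> /andP[x0 xL] /andP[y0 yL].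
case: eqVneq => [_|xN0]; first by left.
case: eqVneq => [_|xNL]; first by left.
case: eqVneq => [_|yN0]; first by left.
case: eqVneq => [_|yNL]; first by left.
by right; rewrite !lt_neqAle x0 xL y0 yL xNL yNL ![0 == _]eq_sym xN0 yN0.
Qed.

Lemma increment_bounded (x y t t' : R) : 0 <= x <= L -> 0 <= y <= L ->
  0 <= t <= T -> 0 <= t' <= T -> `|c x y t' - c x y t| <= mM p.
Proof.
move=> xL yL tT tT'; case: (exact_cases xL yL) => [b|[xI yI]].
  have [-> _] := exact_boundary xL yL tT b; have [-> _] := exact_boundary xL yL tT' b.
  by rewrite subrr normr0 ltW.
have [/andP[a1 a2] _] := exact_admissible sol xI yI tT.
have [/andP[b1 b2] _] := exact_admissible sol xI yI tT'.
by rewrite ler_norml; apply/andP; split; lra.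
Qed.

(** The increment c(t') - c(t) has integral zero and vanishes on the boundary, so its nodal sum is
    pure quadrature error. The bound [B] is left open: it will be linear in t' - t for the time rate
    of the corrector, and obtained by interpolation for its size in terms of eps. *)
Lemma discrete_mass_bound (t t' B h : R) (N : nat) : (0 < N)%N -> N%:R * h = L ->
  0 <= t <= T -> 0 <= t' <= T ->
  (forall x y, 0 <= x <= L -> 0 <= y <= L ->
     `|pds [:: sx; sx] c x y t' - pds [:: sx; sx] c x y t| <= B) ->
  (forall x y, 0 <= x <= L -> 0 <= y <= L ->
     `|pds [:: sy; sy] c x y t' - pds [:: sy; sy] c x y t| <= B) ->
  `|h ^+ 2 * sumP N (fun l m => sample h t' c l m - sample h t c l m)|
    <= 4 * B * L ^+ 2 * h ^+ 2.
Proof.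
move=> N0 hN tT tT' xB yB.
pose ux k x y := pds (nseq k sx) c x y t' - pds (nseq k sx) c x y t.
pose uy k x y := pds (nseq k sy) c x y t' - pds (nseq k sy) c x y t.
pose u x y := c x y t' - c x y t.
have cu : continuous (fun z : R * R => u z.1 z.2).
  by move=> z; apply: cvgB; exact: (continuous_slice cc).
have uA x y : 0 <= x <= L -> 0 <= y <= L -> `|u x y| <= mM p.
  by move=> xL yL; exact: increment_bounded.
have k6 k : (k < 2)%N -> (size (nseq k sx) < 6)%N.
  by move=> k2; rewrite size_nseq; exact: leq_trans k2 _.
have k6' k : (k < 2)%N -> (size (nseq k sy) < 6)%N.
  by move=> k2; rewrite size_nseq; exact: leq_trans k2 _.
have dux k (x y : R) : (k < 2)%N -> is_derive x 1 (fun x => ux k x y) (ux k.+1 x y).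
  move=> k2; apply: is_deriveB; exact: (is_derive_pdsx cc x y _ (k6 _ k2)).
have duy k (x y : R) : (k < 2)%N -> is_derive y 1 (uy k x) (uy k.+1 x y).
  move=> k2; apply: is_deriveB; exact: (is_derive_pdsy cc x y _ (k6' _ k2)).
have ub x y : 0 <= x <= L -> 0 <= y <= L ->
    (x == 0) || (x == L) || (y == 0) || (y == L) -> u x y = 0.
  move=> xL yL b; have [e1 _] := exact_boundary xL yL tT b.
  by have [e2 _] := exact_boundary xL yL tT' b; rewrite /u e1 e2 subrr.
have H := @square_quadrature R L L0 ux uy u B (mM p) h N N0 hN cu uA
  erefl erefl dux duy xB yB ub.
by move: H; rewrite (mass_conserved hp sol tT tT') sub0r normrN.
Qed.

Lemma pds_time_lipschitz (s : seq axis) (x y t t' : R) : (size s < 6)%N ->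
  0 <= x <= L -> 0 <= y <= L -> 0 <= t <= T -> 0 <= t' <= T ->
  `|pds s c x y t' - pds s c x y t| <= K * `|t' - t|.
Proof.
move=> s6 xL yL tT tT'; apply: mean_value_bound.
  by move=> z; exact: (is_derive_pdst cc x y z s6).
move=> z zt; apply: (cK (s := Time :: s) s6 xL yL).
by move: zt tT tT'; case: (leP t t') => _; lra.
Qed.

Lemma discrete_mass_rate (t t' h : R) (N : nat) : (0 < N)%N -> N%:R * h = L ->
  0 <= t <= T -> 0 <= t' <= T ->
  `|h ^+ 2 * sumP N (fun l m => sample h t' c l m - sample h t c l m)|
    <= 4 * (K * `|t' - t|) * L ^+ 2 * h ^+ 2.
Proof.
move=> N0 hN tT tT'; apply: (discrete_mass_bound N0 hN tT tT') => x y xL yL;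
  exact: pds_time_lipschitz.
Qed.

Lemma discrete_mass_interpolated (t t' s A h : R) (N : nat) : (0 < N)%N ->
  N%:R * h = L -> 0 <= t <= T -> 0 <= t' <= T -> 0 < s -> 10 * s <= L ->
  (forall x y, 0 <= x <= L -> 0 <= y <= L -> `|c x y t' - c x y t| <= A) ->
  `|h ^+ 2 * sumP N (fun l m => sample h t' c l m - sample h t c l m)|
    <= 4 * (60 * A / s ^+ 2 + 50 * 5 ^+ 6 * (K + K) * s ^+ 4) * L ^+ 2 * h ^+ 2.
Proof.
move=> N0 hN tT tT' s0 sL uA; have sL' : 10 * s <= L - 0 by rewrite subr0.
apply: (discrete_mass_bound N0 hN tT tT') => x y xL yL.
  apply: (@second_derivative_interpolation _
    (fun k x => pds (nseq k sx) c x y t' - pds (nseq k sx) c x y t) 0 L) => //.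
  - move=> k z k6; have sz : (size (nseq k sx) < 6)%N by rewrite size_nseq.
    apply: is_deriveB; exact: (is_derive_pdsx cc _ _ _ sz).
  - by move=> z zL; apply: norm_sub_le; exact: cK.
  - by move=> z zL; exact: uA.
apply: (@second_derivative_interpolation _
  (fun k y => pds (nseq k sy) c x y t' - pds (nseq k sy) c x y t) 0 L) => //.
- move=> k z k6; have sz : (size (nseq k sy) < 6)%N by rewrite size_nseq.
  apply: is_deriveB; exact: (is_derive_pdsy cc _ _ _ sz).
- by move=> z zL; apply: norm_sub_le; exact: cK.
- by move=> z zL; exact: uA.
Qed.

Section interior_point.
Variables x y t : R.
Hypotheses (xI : 0 < x < L) (yI : 0 < y < L) (tT : 0 <= t <= T).
Let xL : 0 <= x <= L. Proof. by move: xI; lra. Qed.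
Let yL : 0 <= y <= L. Proof. by move: yI; lra. Qed.

Lemma exact_sym_traceless : sym_traceless (Q x y t).
Proof. by case: ex => H _ _ _ _; exact: H. Qed.

Lemma exact_gap_gt0 : 0 < gap (c x y t) (Q x y t).
Proof. exact: admissible_gap exact_sym_traceless (exact_admissible sol xI yI tT). Qed.

Lemma exact_c_in : 0 < c x y t < mM p.
Proof. by have [] := exact_admissible sol xI yI tT. Qed.

Lemma exact_gap_le1 : gap (c x y t) (Q x y t) <= 1.
Proof.
by rewrite /gap lerBlDr lerDl divr_ge0 ?sqr_ge0// mulr_ge0// sqn_ge0.
Qed.

Lemma exact_Q_le (i j : 'I_2) : `|Q x y t i j| <= c x y t / 2.
Proof.
have [Q10 Q11] := (sym_tracelessP _).1 exact_sym_traceless.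
have /andP[c0 _] := exact_c_in.
have S : 4 * sqn (Q x y t) <= c x y t ^+ 2.
  have := exact_gap_gt0; rewrite /gap subr_gt0 ltr_pdivrMr ?exprn_gt0// mul1r.
  exact: ltW.
have H (a : R) : a ^+ 2 <= sqn (Q x y t) -> `|a| <= c x y t / 2.
  move=> aS; rewrite -ler_sqr ?nnegrE ?divr_ge0 ?(ltW c0)//.
  by rewrite real_normK ?num_real// expr_div_n; move: S aS; lra.
have H0 : `|Q x y t 0 0| <= c x y t / 2 by apply: H; rewrite /sqn lerDl sqr_ge0.
have H1 : `|Q x y t 0 1| <= c x y t / 2 by apply: H; rewrite /sqn lerDr sqr_ge0.
by have [->|->] := ord2P i; have [->|->] := ord2P j; rewrite ?Q10 ?Q11 ?normrN.
Qed.

Definition lin_Q (i j : 'I_2) : R := 2 * c02 p * Q x y t i j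
    - 2 * c21 p * lap (tcomp Q i j) x y t
    - 2 * c22 p * (\sum_(k < 2) pd (Defs.Space i) (pd (Defs.Space k) (tcomp Q k j)) x y t)
    - c23 p * pd (Defs.Space i) (pd (Defs.Space j) c) x y t.

Definition lin_Q_bound : R := `|2 * c02 p| * (mM p / 2) + `|2 * c21 p| * (K + K)
  + `|2 * c22 p| * (K + K) + `|c23 p| * K.

Lemma lin_Q_le (i j : 'I_2) : `|lin_Q i j| <= lin_Q_bound.
Proof.
have q2 (a b : 'I_2) i' j' : `|pd (Defs.Space a) (pd (Defs.Space b) (tcomp Q i' j')) x y t| <= K.
  by apply: (QK i' j' (s := [:: Defs.Space a; Defs.Space b])).
have d2 (a b : 'I_2) : `|pd (Defs.Space a) (pd (Defs.Space b) c) x y t| <= K.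
  by apply: (cK (s := [:: Defs.Space a; Defs.Space b])).
rewrite /lin_Q lapE sum_ord2.
apply: norm_sub_le; last by rewrite normrM ler_wpM2l.
apply: norm_sub_le; last by rewrite normrM ler_wpM2l// norm_add_le.
apply: norm_sub_le; last by rewrite normrM ler_wpM2l// norm_add_le.
rewrite normrM ler_wpM2l//; apply: le_trans (exact_Q_le i j) _.
by rewrite ler_pM2r ?invr_gt0//; have /andP[_ /ltW] := exact_c_in.
Qed.

(* The equation for Q controls 4 S / (1 - 4 |S|^2), S = Q / c, hence keeps the
   eigenvalues of S uniformly away from -1/2 and 1/2. *)
Lemma exact_gap_ge :
  (1 + ((K + lin_Q_bound) / mnu p) ^+ 2 / 2)^-1 <= gap (c x y t) (Q x y t).
Proof.
have X0 := exact_gap_gt0; have X1 := exact_gap_le1.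
have st := exact_sym_traceless; have /andP[c0 cM] := exact_c_in.
set D := (K + lin_Q_bound) / mnu p.
have [X XD] : exists X, X = gap (c x y t) (Q x y t) by eexists.
rewrite -XD in X0 X1 *.
have [Q10 Q11] := (sym_tracelessP _).1 st.
have qt i j : `|pd Time (tcomp Q i j) x y t| <= K by exact: (QK i j (s := [:: Time])).
have E : \matrix_(i, j) pd Time (tcomp Q i j) x y t = - projP (chem_Q p c Q x y t).
  by case: ex => _ H _ _ _; have [] := H x y t xI yI tT.
have chemE i j : chem_Q p c Q x y t i j = dXi_dQ p (c x y t) (Q x y t) i j + lin_Q i j.
  by rewrite /chem_Q !mxE.
move: (chem_Q p c Q x y t) E chemE => V E chemE.
have E0 : 4 * (Q x y t 0 0 / c x y t) / X * mnu p =
    - pd Time (tcomp Q 0 0) x y t - (lin_Q 0 0 - lin_Q 1 1) / 2.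
  have := congr1 (fun A : 'M[R]_2 => A 0 0) E; rewrite /projP !mxE /mxtrace sum_ord2 !chemE.
  rewrite !dXi_dQE -?XD// /= mulr1n Q11 => ->.
  move: (lin_Q 0 0) (lin_Q 1 1) (Q x y t 0 0) => l1 l2 q.
  move: (c x y t) (mnu p) c0 nu0 => c' nu' c0' nu0'.
  by field; rewrite !gt_eqF.
have E1 : 4 * (Q x y t 0 1 / c x y t) / X * mnu p =
    - pd Time (tcomp Q 0 1) x y t - (lin_Q 0 1 + lin_Q 1 0) / 2.
  have := congr1 (fun A : 'M[R]_2 => A 0 1) E; rewrite /projP !mxE !chemE.
  rewrite !dXi_dQE -?XD// /= mulr0n Q10 => ->.
  move: (lin_Q 0 1) (lin_Q 1 0) (Q x y t 0 1) => l1 l2 q.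
  move: (c x y t) (mnu p) c0 nu0 => c' nu' c0' nu0'.
  by field; rewrite !gt_eqF.
have B0 : `|4 * (Q x y t 0 0 / c x y t) / X| <= D.
  rewrite /D ler_pdivlMr// -{1}(gtr0_norm nu0) -normrM E0.
  by apply: norm_sub_le; [rewrite normrN|apply: norm_half_sub_le; exact: lin_Q_le].
have B1 : `|4 * (Q x y t 0 1 / c x y t) / X| <= D.
  rewrite /D ler_pdivlMr// -{1}(gtr0_norm nu0) -normrM E1.
  by apply: norm_sub_le; [rewrite normrN|apply: norm_half_add_le; exact: lin_Q_le].
have D0 : 0 <= D by apply: le_trans B0.
have sq (a : R) : `|a| <= D -> a ^+ 2 <= D ^+ 2.
  by move=> aD; rewrite -[a ^+ 2]real_normK ?num_real// lerXn2r ?nnegrE.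
have XE : 1 - X = X ^+ 2 / 4 * ((4 * (Q x y t 0 0 / c x y t) / X) ^+ 2
    + (4 * (Q x y t 0 1 / c x y t) / X) ^+ 2).
  transitivity (4 * sqn (Q x y t) / c x y t ^+ 2); first by rewrite XD /gap; ring.
  rewrite /sqn; move: (Q x y t 0 0) (Q x y t 0 1) (c x y t) c0 => q1 q2 c' c0'.
  by field; rewrite !gt_eqF.
(* The factor X^2 in [XE] is lowered to X by means of X <= 1; the inequality becomes linear and can
   be solved for X. *)
have : 1 - X <= X * (D ^+ 2 / 2).
  rewrite XE; apply: (@le_trans _ _ (X ^+ 2 / 4 * (D ^+ 2 + D ^+ 2))).
    by rewrite ler_wpM2l ?divr_ge0 ?sqr_ge0// lerD// sq.
  rewrite (_ : _ * _ = X * (X * (D ^+ 2 / 2))); last by field.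
  by rewrite ler_wpM2l ?(ltW X0)// ler_piMl// divr_ge0 ?sqr_ge0.
move=> H; have D2 : 0 < 1 + D ^+ 2 / 2 by rewrite ltr_pwDl// divr_ge0 ?sqr_ge0.
by rewrite -[_^-1]mul1r ler_pdivrMr// mulrDr mulr1 -lerBlDl.
Qed.

Definition lin_c : R := 2 * c00 p * c x y t - 2 * c20 p * lap c x y t
  - c23 p * (\sum_(i < 2) \sum_(j < 2)
               pd (Defs.Space i) (pd (Defs.Space j) (tcomp Q i j)) x y t)
  + 2 * c40 p * lap (lap c) x y t.

Definition lin_c_bound : R := `|2 * c00 p| * mM p + `|2 * c20 p| * (K + K)
  + `|c23 p| * (K + K + (K + K)) + `|2 * c40 p| * (K + K + (K + K)).

Lemma lin_c_le : `|lin_c| <= lin_c_bound.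
Proof.
have q2 (a b : 'I_2) i' j' : `|pd (Defs.Space a) (pd (Defs.Space b) (tcomp Q i' j')) x y t| <= K.
  by apply: (QK i' j' (s := [:: Defs.Space a; Defs.Space b])).
have dd s : (0 < size s <= 6)%N -> `|pds s c x y t| <= K by move=> s6; exact: cK.
rewrite /lin_c lap_lapE; last exact: classCW cc.
rewrite (lapE c).
have /andP[c0 cM] := exact_c_in.
apply: norm_add_le; last first.
  by rewrite normrM ler_wpM2l// !norm_add_le//; exact: dd.
apply: norm_sub_le; last first.
  rewrite normrM; apply: ler_wpM2l; first exact: normr_ge0.
  rewrite sum_ord2; apply: norm_add_le.
    by rewrite sum_ord2; exact: norm_add_le (q2 _ _ _ _) (q2 _ _ _ _).
  by rewrite sum_ord2; exact: norm_add_le (q2 _ _ _ _) (q2 _ _ _ _).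
apply: norm_sub_le; last first.
  by rewrite normrM ler_wpM2l// norm_add_le//; [exact: (dd [:: sx; sx])|exact: (dd [:: sy; sy])].
by rewrite normrM ler_wpM2l// gtr0_norm// ltW.
Qed.

Lemma chem_cE : chem_c p c Q x y t = dXi_dc p (c x y t) (Q x y t) + lin_c.
Proof. by rewrite /chem_c /lin_c !addrA. Qed.

End interior_point.
End a_priori_bounds.

(** * Comparison of c with its boundary value *)

Lemma le0_of_linear (R : realType) (A B s0 : R) : 0 < s0 ->
  (forall s, 0 < s < s0 -> A <= s * B) -> A <= 0.
Proof.
move=> s00 H; apply/ler_addgt0Pl => e e0; rewrite addr0.
have B1 : 0 < `|B| + 1 by rewrite ltr_wpDl.
pose s := Num.min (s0 / 2) (e / (`|B| + 1)).
have s1 : 0 < s by rewrite lt_min !divr_gt0.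
have s2 : s < s0.
  by apply: (@le_lt_trans _ _ (s0 / 2)); [rewrite /s ge_min lexx|lra].
have s3 : s <= e / (`|B| + 1) by rewrite /s ge_min lexx orbT.
apply: le_trans (H s _) _; first by rewrite s1.
apply: (@le_trans _ _ (s * (`|B| + 1))).
  by rewrite ler_pM2l//; apply: le_trans (ler_norm B) _; rewrite lerDl.
by rewrite -ler_pdivlMr.
Qed.

Definition comparable_in (R : realType) (M E a b : R) : Prop :=
  [/\ b <= E * a, a <= E * b, M - b <= E * (M - a) & M - a <= E * (M - b)].

(** The cross products compare the odds a / (M - a) and b / (M - b) within the factor E. A priori
    [b] may be 0 or [M]; in either case one of the left-hand sides would be positive and bounded by
    0. *)
Lemma comparable_of_cross (R : realType) (M E a b : R) : 1 <= E -> 0 < a < M ->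
  0 <= b <= M ->
  a * (M - b) <= E * (b * (M - a)) -> b * (M - a) <= E * (a * (M - b)) ->
  0 < b < M /\ comparable_in M E a b.
Proof.
move=> E1 /andP[a0 aM] /andP[b0 bM] h1 h2.
have E0 : 0 < E by apply: lt_le_trans E1.
have Ma : 0 < M - a by rewrite subr_gt0.
have bpos : 0 < b.
  rewrite lt_neqAle b0 andbT; apply/eqP => bz; move: h1; rewrite -bz mul0r mulr0 subr0.
  by apply/negP; rewrite -ltNge mulr_gt0// (lt_trans a0).
have Mb : 0 < M - b.
  rewrite lt_neqAle subr_ge0 bM andbT; apply/eqP => bz; move: h2.
  rewrite -bz !mulr0; apply/negP; rewrite -ltNge mulr_gt0//.
split; first by rewrite bpos -subr_gt0.
have mE (x y : R) : 0 <= x -> y <= x -> y <= E * x.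
  by move=> x0 yx; apply: le_trans yx _; rewrite ler_peMl.
split.
- case: (lerP b a) => ba; first by rewrite mE// ltW.
  have H : b * (M - a) <= E * a * (M - a).
    by rewrite -mulrA; apply: le_trans h2 _; rewrite ler_pM2l// ler_pM2l//; lra.
  by rewrite -(ler_pM2r Ma).
- case: (lerP a b) => ba; first by rewrite mE// ltW.
  have H : a * (M - b) <= E * b * (M - b).
    by rewrite -mulrA; apply: le_trans h1 _; rewrite ler_pM2l// ler_pM2l//; lra.
  by rewrite -(ler_pM2r Mb).
- case: (lerP a b) => ba; first by rewrite mE//; lra.
  have H : a * (M - b) <= a * (E * (M - a)).
    by rewrite mulrCA; apply: le_trans h1 _; rewrite ler_pM2l// ler_pM2r//; lra.
  by rewrite -(ler_pM2l a0).
- case: (lerP b a) => ba; first by rewrite mE//; lra.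
  have H : b * (M - a) <= b * (E * (M - b)).
    by rewrite mulrCA; apply: le_trans h2 _; rewrite ler_pM2l// ler_pM2r//; lra.
  by rewrite -(ler_pM2l bpos).
Qed.

(** Products instead of quotients: in this form the comparison passes to the limit towards the
    boundary, where the value might still be 0 or [M]. *)
Lemma logit_cross (R : realType) (M C a b : R) : 0 < a < M -> 0 < b < M ->
  logit M a - logit M b <= C -> a * (M - b) <= expR C * (b * (M - a)).
Proof.
move=> /andP[a0 aM] /andP[b0 bM].
have M0 : 0 < M by apply: lt_trans aM.
have Ma : 0 < M - a by rewrite subr_gt0.
have Mb : 0 < M - b by rewrite subr_gt0.
rewrite /logit lerBlDr -{1}(expRK C) -lnM ?posrE ?expR_gt0 ?divr_gt0 ?mulr_gt0//.
rewrite ler_ln ?posrE ?mulr_gt0 ?divr_gt0 ?expR_gt0 ?mulr_gt0// ?invr_gt0//.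
rewrite ler_pdivrMr// -(ler_pM2l (divr_gt0 Mb M0)).
rewrite (_ : (M - b) / M * (M * a) = a * (M - b)); last by field; rewrite gt_eqF.
rewrite (_ : (M - b) / M * _ = expR C * (b * (M - a)))//.
by field; rewrite !gt_eqF.
Qed.

(** The mean [m] is the same at both points and cancels: the equation controls the oscillation of
    the logarithm, not its size. *)
Lemma osc_of_equation (R : realFieldType) (a a' m f f' P P' l l' K B C : R) :
  a = m - (f + P + l) -> a' = m - (f' + P' + l') -> `|a| <= K -> `|a'| <= K ->
  `|P| <= B -> `|P'| <= B -> `|l| <= C -> `|l'| <= C ->
  f - f' <= K + K + (C + C) + (B + B).
Proof.
by rewrite !ler_norml => -> -> /andP[? ?] /andP[? ?] /andP[? ?] /andP[? ?]
  /andP[? ?] /andP[? ?]; lra.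
Qed.

Lemma cross_limit (R : realFieldType) (M E K a b d s : R) : 0 < a < M -> 0 <= E ->
  `|d - b| <= K * s -> a * (M - d) <= E * (d * (M - a)) ->
  a * (M - b) - E * (b * (M - a)) <= s * (K * M + E * (K * M)).
Proof.
move=> /andP[a0 aM] E0 db H; have Ks : 0 <= K * s by apply: le_trans db.
have h1 : a * (d - b) <= M * (K * s).
  apply: (@le_trans _ _ (a * (K * s))); last by rewrite ler_wpM2r// ltW.
  by rewrite ler_pM2l//; apply: le_trans (ler_norm _) db.
have h2 : (d - b) * (M - a) <= K * s * M.
  apply: (@le_trans _ _ (K * s * (M - a))); last by rewrite ler_wpM2l//; lra.
  by rewrite ler_pM2r ?subr_gt0//; apply: le_trans (ler_norm _) db.
have h3 : E * ((d - b) * (M - a)) <= E * (K * s * M) by rewrite ler_wpM2l.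
by move: H h1 h3; lra.
Qed.

Lemma cross_limit' (R : realFieldType) (M E K a b d s : R) : 0 < a < M -> 0 <= E ->
  `|d - b| <= K * s -> d * (M - a) <= E * (a * (M - d)) ->
  b * (M - a) - E * (a * (M - b)) <= s * (K * M + E * (K * M)).
Proof.
rewrite -(opprB b d) normrN => /andP[a0 aM] E0 db H.
have Ks : 0 <= K * s by apply: le_trans db.
have h1 : (b - d) * (M - a) <= K * s * M.
  apply: (@le_trans _ _ (K * s * (M - a))); last by rewrite ler_wpM2l//; lra.
  by rewrite ler_pM2r ?subr_gt0//; apply: le_trans (ler_norm _) db.
have h2 : a * (b - d) <= M * (K * s).
  apply: (@le_trans _ _ (a * (K * s))); last by rewrite ler_wpM2r// ltW.
  by rewrite ler_pM2l//; apply: le_trans (ler_norm _) db.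
have h3 : E * (a * (b - d)) <= E * (M * (K * s)) by rewrite ler_wpM2l.
by move: H h1 h3; lra.
Qed.

Section comparability.
Variables (R : realType) (p : model R) (T K : R).
Variables (cbnd : R -> R -> R) (Qbnd : R -> R -> 'M[R]_2).
Variables (c : R -> R -> R -> R) (Q : R -> R -> R -> 'M[R]_2).
Hypotheses (hp : model_ok p) (hT : 0 < T).
Hypothesis sol : regular_solution p T K cbnd Qbnd c Q.
Let L := mL p.
Let L0 : 0 < L. Proof. by case: hp => -[]. Qed.
Let M := mM p.
Let nu0 : 0 < mnu p. Proof. by case: hp => -[]. Qed.
Let K0 : 0 <= K := derivative_bound_ge0 hp hT sol.

Definition gap_bound : R := (1 + ((K + lin_Q_bound p K) / mnu p) ^+ 2 / 2)^-1.

Lemma gap_bound_gt0 : 0 < gap_bound.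
Proof. by rewrite invr_gt0 ltr_pwDl// divr_ge0 ?sqr_ge0. Qed.

Definition osc_bound : R := K + K + (lin_c_bound p K + lin_c_bound p K)
  + mnu p * ((- ln gap_bound + 2 / gap_bound) + (- ln gap_bound + 2 / gap_bound)).

(** This part of [dXi_dc] is a function of the gap alone, as 8 sqn B / b^2 = 2 (1 - gap), and is
    bounded once the gap is bounded from below. *)
Lemma perspective_le (b : R) (B : 'M[R]_2) : 0 < b ->
  gap_bound <= gap b B -> gap b B <= 1 ->
  `|- ln (gap b B) - 8 * (sqn B / b ^+ 2) / gap b B| <= - ln gap_bound + 2 / gap_bound.
Proof.
move=> b0 gX X1; have g0 := gap_bound_gt0.
have X0 : 0 < gap b B by apply: lt_le_trans gX.
have bN0 : b ^+ 2 != 0 by rewrite expf_neq0// gt_eqF.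
apply: norm_sub_le.
  rewrite normrN ler0_norm ?ln_le0// lerN2 ler_ln ?posrE//.
have -> : 8 * (sqn B / b ^+ 2) = 2 * (1 - gap b B) by rewrite /gap; field; rewrite gt_eqF.
rewrite normrM normfV (gtr0_norm X0) ger0_norm; last by rewrite mulr_ge0// subr_ge0.
apply: ler_pM; rewrite ?invr_ge0 ?(ltW X0)//.
- by rewrite mulr_ge0// subr_ge0.
- by rewrite ler_piMr// gerBl ltW.
- by rewrite lef_pV2 ?posrE.
Qed.

Lemma logit_osc (x y x' y' t : R) : 0 < x < L -> 0 < y < L -> 0 < x' < L ->
  0 < y' < L -> 0 <= t <= T ->
  logit M (c x y t) - logit M (c x' y' t) <= osc_bound.
Proof.
move=> xI yI xI' yI' tT; case: (sol) => cc cQ ex cK QK.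
have W (a : R) : 0 < a < L -> 0 <= a <= L by move=> /andP[a0 aL]; rewrite !ltW.
have E a b : 0 < a < L -> 0 < b < L -> pd Time c a b t =
    mean_square L (fun x' y' => chem_c p c Q x' y' t) - chem_c p c Q a b t.
  move=> aI bI; case: ex => _ H _ _ _; have [_ -> _] := H _ _ _ aI bI tT.
  by rewrite /projG opprB.
have ct a b : 0 < a < L -> 0 < b < L -> `|pd Time c a b t| <= K.
  by move=> aI bI; exact: (cK [:: Time] isT _ _ _ (W _ aI) (W _ bI) tT).
have D a b : 0 < a < L -> 0 < b < L ->
    chem_c p c Q a b t = logit M (c a b t)
    + mnu p * (- ln (gap (c a b t) (Q a b t))
        - 8 * (sqn (Q a b t) / c a b t ^+ 2) / gap (c a b t) (Q a b t))
    + lin_c p c Q a b t.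
  move=> aI bI; have /andP[c0 _] := exact_c_in sol aI bI tT.
  have st := exact_sym_traceless sol aI bI tT; have X0 := exact_gap_gt0 sol aI bI tT.
  by rewrite (chem_cE p c Q) (dXi_dcE p c0 st X0).
have P a b : 0 < a < L -> 0 < b < L ->
    `|mnu p * (- ln (gap (c a b t) (Q a b t))
        - 8 * (sqn (Q a b t) / c a b t ^+ 2) / gap (c a b t) (Q a b t))|
    <= mnu p * (- ln gap_bound + 2 / gap_bound).
  move=> aI bI; have /andP[c0 _] := exact_c_in sol aI bI tT.
  have X0 := exact_gap_ge hp sol aI bI tT.
  rewrite normrM (gtr0_norm nu0) ler_pM2l//; apply: perspective_le => //.
  exact: exact_gap_le1.
have Li a b (aI : 0 < a < L) (bI : 0 < b < L) := lin_c_le sol aI bI tT.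
have := E _ _ xI yI; have := E _ _ xI' yI'; rewrite (D _ _ xI yI) (D _ _ xI' yI').
move=> h1 h2; rewrite /osc_bound (_ : mnu p * (_ + _) = mnu p * (- ln gap_bound + 2 / gap_bound) + mnu p * (- ln gap_bound + 2 / gap_bound)); last by rewrite mulrDr.
exact: osc_of_equation h2 h1 (ct _ _ xI yI) (ct _ _ xI' yI') (P _ _ xI yI)
  (P _ _ xI' yI') (Li _ _ xI yI) (Li _ _ xI' yI').
Qed.

Definition osc_ratio : R := expR osc_bound.

(** One boundary point suffices because the oscillation is bounded over the whole square. It is the
    midpoint of a side, so that the points (s, L / 2) approaching it are interior. *)
Definition boundary_value : R := cbnd 0 (L / 2).

Lemma near_boundary_value (s t : R) : 0 < s < L -> 0 <= t <= T ->
  `|c s (L / 2) t - boundary_value| <= K * s.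
Proof.
move=> /andP[s0 sL] tT; case: (sol) => cc _ ex cK _.
have L2 : 0 <= L / 2 <= L by move: L0; lra.
have [<- _] : c 0 (L / 2) t = boundary_value /\ Q 0 (L / 2) t = Qbnd 0 (L / 2).
  by case: ex => _ _ H _ _; apply: H => //; rewrite ?eqxx// lexx ltW.
rewrite -{2}(gtr0_norm s0) -{2}[s]subr0.
apply: (@mean_value_bound _ (fun x => c x (L / 2) t) (fun x => pds [:: sx] c x (L / 2) t)).
  by move=> z; exact: (is_derive_pdsx cc z (L / 2) t (s := [::])).
move=> z /andP[z0 zs]; apply: (cK [:: sx]) => //.
by move: z0 zs; rewrite (min_l (ltW s0)) (max_r (ltW s0)) => -> zs /=; rewrite (le_trans zs)// ltW.
Qed.

Lemma cross_of_near (M0' E K' a b : R) : 0 < a < M0' -> 0 <= E -> 0 <= K' ->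
  (forall s, 0 < s < L -> exists2 d, 0 < d < M0' /\ `|d - b| <= K' * s &
     a * (M0' - d) <= E * (d * (M0' - a))) ->
  a * (M0' - b) <= E * (b * (M0' - a)).
Proof.
move=> aM E0 K0' H; rewrite -subr_le0.
apply: (@le0_of_linear _ _ (K' * M0' + E * (K' * M0')) L) => // s sL.
have [d [_ db] h] := H _ sL.
exact: cross_limit aM E0 db h.
Qed.

Lemma cross_of_near' (M0' E K' a b : R) : 0 < a < M0' -> 0 <= E -> 0 <= K' ->
  (forall s, 0 < s < L -> exists2 d, 0 < d < M0' /\ `|d - b| <= K' * s &
     d * (M0' - a) <= E * (a * (M0' - d))) ->
  b * (M0' - a) <= E * (a * (M0' - b)).
Proof.
move=> aM E0 K0' H; rewrite -subr_le0.
apply: (@le0_of_linear _ _ (K' * M0' + E * (K' * M0')) L) => // s sL.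
have [d [_ db] h] := H _ sL.
exact: cross_limit' aM E0 db h.
Qed.

Lemma boundary_value_bounds : 0 <= boundary_value <= M.
Proof.
have T0 : (0 : R) <= 0 <= T by rewrite lexx ltW.
have L2 : 0 < L / 2 < L by move: L0; lra.
have H s : 0 < s < L -> 0 < c s (L / 2) 0 < M by move=> sL; exact: (exact_c_in sol sL L2 T0).
apply/andP; split.
  rewrite -oppr_le0; apply: (@le0_of_linear _ _ K L) => // s sL.
  have /andP[a0 _] := H _ sL; have := near_boundary_value sL T0.
  by rewrite ler_norml => /andP[_]; move: a0; lra.
rewrite -subr_le0; apply: (@le0_of_linear _ _ K L) => // s sL.
have /andP[_ a0] := H _ sL; have := near_boundary_value sL T0.
by rewrite ler_norml => /andP[+ _]; move: a0; lra.
Qed.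

Lemma osc_ratio_ge1 : 1 <= osc_ratio.
Proof.
have T0 : (0 : R) <= 0 <= T by rewrite lexx ltW.
have L2 : 0 < L / 2 < L by move: L0; lra.
have := logit_osc L2 L2 L2 L2 T0; rewrite subrr => H.
by rewrite -expR0 ler_expR.
Qed.

(** [logit_osc] compares interior points only; the boundary value is reached as the limit of c at
    (s, L / 2) when s tends to 0. It does not depend on time, so one number is comparable to c at
    all times. *)
Lemma exact_comparable (x y t : R) : 0 < x < L -> 0 < y < L -> 0 <= t <= T ->
  0 < boundary_value < M /\ comparable_in M osc_ratio (c x y t) boundary_value.
Proof.
move=> xI yI tT; have cM := exact_c_in sol xI yI tT.
have L2 : 0 < L / 2 < L by move: L0; lra.
apply: comparable_of_cross => //; first exact: osc_ratio_ge1.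
- exact: boundary_value_bounds.
- apply: (@cross_of_near _ _ K) => //; first exact: expR_ge0.
  move=> s sL; exists (c s (L / 2) t); last first.
    exact: (logit_cross cM (exact_c_in sol sL L2 tT) (logit_osc xI yI sL L2 tT)).
  split; [exact: (exact_c_in sol sL L2 tT)|exact: near_boundary_value].
- apply: (@cross_of_near' _ _ K) => //; first exact: expR_ge0.
  move=> s sL; exists (c s (L / 2) t); last first.
    exact: (logit_cross (exact_c_in sol sL L2 tT) cM (logit_osc sL L2 xI yI tT)).
  split; [exact: (exact_c_in sol sL L2 tT)|exact: near_boundary_value].
Qed.

End comparability.

(** * The entropy near the solution *)

Section nearby_values.
Variable R : realType.

Lemma ln1D_le (r : R) : `|r| <= 2^-1 -> `|ln (1 + r)| <= 2 * `|r|.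
Proof.
move=> r2; have [r2l r2r] : - 2^-1 <= r /\ r <= 2^-1.
  by move: r2; rewrite ler_norml => /andP.
have r0 : 0 < 1 + r by lra.
have h1 : ln (1 + r) <= r by apply: le_ln1Dx; lra.
have n0 := normr_ge0 r; have nr := ler_norm r.
have h2 : - ln (1 + r) <= - r / (1 + r).
  rewrite -lnV ?posrE// [in leLHS](_ : (1 + r)^-1 = 1 + - r / (1 + r)); last by field; rewrite gt_eqF.
  apply: le_ln1Dx; rewrite ltr_pdivlMr//; lra.
have h3 : - r / (1 + r) <= 2 * `|r|.
  apply: le_trans (ler_norm _) _; rewrite normrM normrN normfV (gtr0_norm r0) mulrC.
  by rewrite ler_wpM2r// -(invrK 2) lef_pV2 ?posrE ?invr_gt0//; lra.
by rewrite ler_norml; apply/andP; split; lra.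
Qed.

Lemma logit_near (M a w : R) : 0 < a < M -> `|w| <= a / 2 -> `|w| <= (M - a) / 2 ->
  `|logit M a - logit M (a + w)| <= 2 * (`|w| / a + `|w| / (M - a)).
Proof.
move=> /andP[a0 aM] wa wM; have Ma : 0 < M - a by rewrite subr_gt0.
have M0 : 0 < M by apply: lt_trans aM.
have b0 : 0 < a + w by move: (ler_norm (- w)); rewrite normrN; lra.
have Mb : 0 < M - (a + w) by move: (ler_norm w); lra.
have E : logit M a - logit M (a + w) = ln (1 + - w / (M - a)) - ln (1 + w / a).
  rewrite /logit !ln_div ?posrE ?mulr_gt0//.
  rewrite (_ : 1 + - w / (M - a) = (M - (a + w)) / (M - a)); last by field; rewrite gt_eqF.
  rewrite (_ : 1 + w / a = (a + w) / a); last by field; rewrite gt_eqF.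
  by rewrite !ln_div ?posrE// !lnM ?posrE//; ring.
rewrite E mulrDr [leRHS]addrC; apply: le_trans (ler_normB _ _) _.
have e1 : `|- w / (M - a)| = `|w| / (M - a) by rewrite normrM normrN normfV (gtr0_norm Ma).
have e2 : `|w / a| = `|w| / a by rewrite normrM normfV (gtr0_norm a0).
apply: lerD; rewrite -?e1 -?e2; apply: ln1D_le.
  by rewrite e1 ler_pdivrMr// mulrC.
by rewrite e2 ler_pdivrMr// mulrC.
Qed.

Lemma entropy_breg_scaled (c c' : R) (Q : 'M[R]_2) : 0 < c -> 0 < c' ->
  0 < gap c Q -> entropy_breg c Q c' ((c' / c) *: Q) = 0.
Proof.
move=> c0 c0' X0; rewrite /entropy_breg (_ : gap c' _ = gap c Q).
  by rewrite !mxE; field; rewrite !gt_eqF.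
by rewrite /gap /sqn !mxE; field; rewrite !gt_eqF.
Qed.

Lemma gap_scaled (c c' : R) (Q : 'M[R]_2) : 0 < c -> 0 < c' ->
  gap c' ((c' / c) *: Q) = gap c Q.
Proof. by move=> c0 c0'; rewrite /gap /sqn !mxE; field; rewrite !gt_eqF. Qed.

(** With Q fixed, 1 - gap is proportional to c^-2, and a relative change d / 4 of c loses at most
    half of the lower bound d. *)
Lemma gap_shift (d c c' : R) (Q : 'M[R]_2) : 0 < c -> 0 < d <= 1 -> d <= gap c Q ->
  `|c' - c| <= d / 4 * c -> d / 2 <= gap c' Q.
Proof.
move=> c0 /andP[d0 d1] X0 cc; have c'c : (1 - d / 4) * c <= c'.
  by move: (ler_norm (c - c')); rewrite distrC; lra.
have u0 : 0 < (1 - d / 4) * c by rewrite mulr_gt0//; lra.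
have c'0 : 0 < c' by apply: lt_le_trans c'c.
have q0 := sqn_ge0 Q.
have S : 4 * sqn Q <= (1 - d) * c ^+ 2.
  rewrite -ler_pdivrMr ?exprn_gt0//; move: X0; rewrite /gap; lra.
have sq : ((1 - d / 4) * c) ^+ 2 <= c' ^+ 2 by rewrite lerXn2r// nnegrE ltW.
have : 4 * sqn Q / c' ^+ 2 <= 1 - d / 2.
  rewrite ler_pdivrMr ?exprn_gt0//; apply: le_trans S _.
  apply: (@le_trans _ _ ((1 - d / 2) * ((1 - d / 4) * c) ^+ 2)); last first.
    by rewrite ler_wpM2l//; lra.
  rewrite (_ : _ * (_ * c) ^+ 2 = (1 - d / 2) * (1 - d / 4) ^+ 2 * c ^+ 2); last by ring.
  rewrite ler_wpM2r ?sqr_ge0// -subr_ge0.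
  rewrite (_ : _ - _ = d ^+ 2 / 4 + d ^+ 2 / 16 * (1 - d / 2)); last by field.
  by rewrite addr_ge0 ?mulr_ge0 ?sqr_ge0//; lra.
by rewrite /gap; lra.
Qed.

Lemma sqr2D_le (v : R) : `|v| <= 1 -> (2 + v) ^+ 2 <= 9.
Proof.
rewrite ler_norml => /andP[? ?].
by rewrite (_ : 9 = 3 ^+ 2 :> R); [rewrite lerXn2r// ?nnegrE; lra|ring].
Qed.

(** Here S' = (c / c') S, so for a given gap the divergence depends on v = c / c' - 1 alone. Its
    first order part cancels against the gradient term and a multiple of v^2 remains; 38 is 1 + 18,
    from [H3] and [H4], doubled because c' >= c / 2. *)
Lemma entropy_breg_near (d c c' : R) (Q : 'M[R]_2) : 0 < c -> 0 < d <= 1 ->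
  d <= gap c Q -> gap c Q <= 1 -> `|c' - c| <= d / 4 * c ->
  c' * entropy_breg c Q c' Q <= 38 / d ^+ 2 * ((c' - c) ^+ 2 / c).
Proof.
move=> c0 dI X0 X1 cc; have X0' := gap_shift c0 dI X0 cc; have /andP[d0 d1] := dI.
have c'c : c / 2 <= c'.
  move: (ler_norm (c - c')); rewrite distrC => H.
  have : d / 4 * c <= c / 2 by rewrite mulrC ler_pM2l//; lra.
  by move: cc H; lra.
have c2 : 0 < c / 2 by rewrite divr_gt0.
have c'0 : 0 < c' by apply: lt_le_trans c'c.
have XE' : gap c' Q = gap c Q - (1 - gap c Q) * ((c / c') ^+ 2 - 1).
  by rewrite /gap; field; rewrite !gt_eqF.
have BE : entropy_breg c Q c' Q = ln (gap c Q / gap c' Q)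
    - 2 * (1 - gap c Q) / gap c Q * (c / c' - 1).
  have Xp : 0 < gap c Q by apply: lt_le_trans X0.
  have Xp' : 0 < gap c' Q by apply: lt_le_trans X0'; lra.
  rewrite ln_div ?posrE// /entropy_breg [- ln _ + _]addrC; congr (_ - _).
  move: Xp; rewrite /gap /sqn => Xp.
  have [X XE] : exists X, X = 1 - 4 * (Q 0 0 ^+ 2 + Q 0 1 ^+ 2) / c ^+ 2 by eexists.
  rewrite -XE in Xp *; have S : 4 * (Q 0 0 ^+ 2 + Q 0 1 ^+ 2) = (1 - X) * c ^+ 2.
    by rewrite XE; field; rewrite gt_eqF.
  transitivity (4 * (Q 0 0 ^+ 2 + Q 0 1 ^+ 2) * (2 / X / c * (c'^-1 - c^-1))).
    by field; rewrite !gt_eqF.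
  by rewrite S; field; rewrite !gt_eqF.
have [v vE] : exists v, v = c / c' - 1 by eexists.
have v1 : `|v| <= 1.
  rewrite vE (_ : c / c' - 1 = (c - c') / c'); last by field; rewrite gt_eqF.
  rewrite normrM normfV (gtr0_norm c'0) ler_pdivrMr// mul1r distrC.
  apply: le_trans cc _; apply: le_trans c'c.
  by rewrite mulrC ler_pM2l//; lra.
have vE' : (c / c') ^+ 2 - 1 = 2 * v + v ^+ 2 by rewrite vE; ring.
have cv : c' * v ^+ 2 = (c' - c) ^+ 2 / c' by rewrite vE; field; rewrite gt_eqF.
rewrite BE -vE vE' in XE' *.
move: (gap c Q) (gap c' Q) X0 X1 X0' XE' {BE} => X Y X0 X1 X0' XE'.
have Xp : 0 < X by lra.
have Yp : 0 < Y by lra.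
have H1 : ln (X / Y) <= X / Y - 1.
  have XY : 0 < X / Y by rewrite divr_gt0.
  by have := @le_ln1Dx R (X / Y - 1); rewrite [1 + _]addrC subrK; apply; lra.
have H2 : X / Y - 1 - 2 * (1 - X) / X * v = (1 - X) * v ^+ 2 / X
    + (1 - X) ^+ 2 * (2 + v) ^+ 2 * v ^+ 2 / (X * Y).
  have XY : X = Y + (1 - X) * (2 * v + v ^+ 2) by rewrite XE'; ring.
  have -> : (1 - X) ^+ 2 * (2 + v) ^+ 2 * v ^+ 2 = (X - Y) ^+ 2 by rewrite XE'; ring.
  have -> : (1 - X) * v ^+ 2 / X = (X - Y - 2 * (1 - X) * v) / X by rewrite XE'; field; rewrite gt_eqF.
  by field; rewrite !gt_eqF.
have v20 : 0 <= v ^+ 2 by rewrite sqr_ge0.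
have dX : X^-1 <= d^-1 by rewrite lef_pV2 ?posrE.
have dY : Y^-1 <= 2 / d.
  by rewrite -[2 / d]invrK lef_pV2 ?posrE ?invr_gt0 ?divr_gt0// invf_div.
have d1' : 1 <= d^-1 by rewrite -invr1 lef_pV2 ?posrE.
have H3 : (1 - X) * v ^+ 2 / X <= v ^+ 2 / d ^+ 2.
  apply: (@le_trans _ _ (v ^+ 2 / X)).
    by rewrite ler_pM2r ?invr_gt0// ler_piMl//; lra.
  rewrite ler_wpM2l// -exprVn expr2; apply: le_trans dX _.
  by rewrite ler_peMl// invr_ge0 ltW.
have H4 : (1 - X) ^+ 2 * (2 + v) ^+ 2 * v ^+ 2 / (X * Y) <= 18 * v ^+ 2 / d ^+ 2.
  have a1 : (1 - X) ^+ 2 <= 1 by rewrite exprn_ile1// ?subr_ge0// gerBl ltW.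
  have a2 := sqr2D_le v1.
  have a3 : (X * Y)^-1 <= 2 / d ^+ 2.
    rewrite invfM (_ : 2 / d ^+ 2 = d^-1 * (2 / d)); last by field; rewrite gt_eqF.
    by apply: ler_pM => //; rewrite invr_ge0 ltW.
  rewrite (_ : 18 * v ^+ 2 / d ^+ 2 = 1 * 9 * v ^+ 2 * (2 / d ^+ 2)); last first.
    by field; rewrite gt_eqF.
  have s1 := sqr_ge0 (1 - X); have s2 := sqr_ge0 (2 + v).
  apply: ler_pM => //; first exact: mulr_ge0 (mulr_ge0 s1 s2) v20.
    by rewrite invr_ge0 mulr_ge0// ltW.
  by rewrite ler_wpM2r//; apply: ler_pM.
apply: (@le_trans _ _ (c' * (19 * v ^+ 2 / d ^+ 2))).
  rewrite ler_pM2l// (_ : 19 * _ / _ = v ^+ 2 / d ^+ 2 + 18 * v ^+ 2 / d ^+ 2).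
    by move: H1 H2 H3 H4; lra.
  by field; rewrite gt_eqF.
rewrite (_ : c' * _ = 19 / d ^+ 2 * (c' * v ^+ 2)); last by field; rewrite gt_eqF.
rewrite cv (_ : 38 / d ^+ 2 * _ = 19 / d ^+ 2 * ((c' - c) ^+ 2 / (c / 2))); last first.
  by field; rewrite !gt_eqF.
by rewrite ler_wpM2l ?divr_ge0 ?sqr_ge0// ler_wpM2l ?sqr_ge0// lef_pV2 ?posrE.
Qed.

End nearby_values.

Section comparable_values.
Variables (R : realType) (M E b : R).
Hypotheses (E1 : 1 <= E) (bM : 0 < b < M).

(** Inverse of 1 / b + 1 / (M - b), the second derivative at b of the scalar part of the entropy; it
    agrees with min(b, M - b) up to a factor 2. *)
Definition separation : R := b * (M - b) / M.

Let b0 : 0 < b. Proof. by case/andP: bM. Qed.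
Let Mb : 0 < M - b. Proof. by case/andP: bM => _; rewrite subr_gt0. Qed.
Let M0 : 0 < M. Proof. by case/andP: bM => ? ?; apply: lt_trans b0 _. Qed.
Let E0 : 0 < E. Proof. exact: lt_le_trans E1. Qed.

Lemma separation_gt0 : 0 < separation.
Proof. by rewrite divr_gt0// mulr_gt0. Qed.

Lemma separation_le_l : separation <= b.
Proof. by rewrite ler_pdivrMr// ler_pM2l//; move: b0; lra. Qed.

Lemma separation_le_r : separation <= M - b.
Proof. by rewrite ler_pdivrMr// mulrC ler_pM2l//; move: Mb; lra. Qed.

Lemma separation_le : separation <= M.
Proof. by apply: le_trans separation_le_l _; move: Mb; lra. Qed.

Lemma separation_ge (x : R) : x <= b -> x <= M - b -> x <= 2 * separation.
Proof.
move=> xb xMb; case: (lerP b (M / 2)) => bM2.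
  apply: le_trans xb _; rewrite /separation (_ : 2 * _ = b * (2 * (M - b) / M)).
    by apply: ler_peMr; [exact: ltW|rewrite ler_pdivlMr//; lra].
  by field; rewrite gt_eqF.
apply: le_trans xMb _; rewrite /separation (_ : 2 * _ = (M - b) * (2 * b / M)).
  by apply: ler_peMr; [exact: ltW|rewrite ler_pdivlMr//; lra].
by field; rewrite gt_eqF.
Qed.

Lemma inv_separation : b^-1 + (M - b)^-1 = separation^-1.
Proof. by rewrite /separation; field; rewrite !gt_eqF. Qed.

Lemma comparable_dist (a : R) : 0 < a < M -> comparable_in M E a b ->
  `|a - b| <= 2 * E * separation.
Proof.
move=> /andP[a0 aM] [h1 h2 h3 h4].
have key (x : R) : x <= E * b -> x <= E * (M - b) -> x <= 2 * E * separation.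
  move=> xb xMb; rewrite -mulrA mulrCA -ler_pdivrMl//; apply: separation_ge.
    by rewrite ler_pdivrMl.
  by rewrite ler_pdivrMl.
have bE : b <= E * b by rewrite ler_peMl// ltW.
have MbE : M - b <= E * (M - b) by rewrite ler_peMl// ltW.
by rewrite ler_norml lerNl opprB; apply/andP; split; apply: key; move: b0 Mb; lra.
Qed.

Lemma comparable_le (a : R) : 0 < a < M -> comparable_in M E a b ->
  [/\ a^-1 <= E / b, (M - a)^-1 <= E / (M - b) & a^-1 + (M - a)^-1 <= E / separation].
Proof.
move=> /andP[a0 aM] [h1 h2 h3 h4]; have Ma : 0 < M - a by rewrite subr_gt0.
have i1 : a^-1 <= E / b by rewrite -[a^-1]mul1r ler_pdivrMr// mulrAC ler_pdivlMr// mul1r.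
have i2 : (M - a)^-1 <= E / (M - b).
  by rewrite -[(M - a)^-1]mul1r ler_pdivrMr// mulrAC ler_pdivlMr// mul1r.
by split=> //; rewrite -inv_separation mulrDr lerD.
Qed.

Lemma comparable_logit (a : R) : 0 < a < M -> comparable_in M E a b ->
  `|logit M a - logit M b| <= 2 * ln E.
Proof.
move=> /andP[a0 aM] [h1 h2 h3 h4]; have Ma : 0 < M - a by rewrite subr_gt0.
have k (x y : R) : 0 < x -> 0 < y -> x <= E * y -> ln x <= ln E + ln y.
  by move=> x0 y0 xy; rewrite -lnM ?posrE// ler_ln ?posrE// mulr_gt0.
rewrite /logit !ln_div ?posrE ?mulr_gt0// !lnM ?posrE//.
move: (k _ _ b0 a0 h1) (k _ _ a0 b0 h2) (k _ _ Mb Ma h3) (k _ _ Ma Mb h4).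
by move=> *; rewrite ler_norml; apply/andP; split; lra.
Qed.

End comparable_values.

(** * The bump corrector *)

Section cosine_grid.
Variables (R : realType) (N : nat).
Hypothesis N1 : (1 < N)%N.

Definition mesh_angle : R := 2 * pi / N%:R.
Definition cos_grid (l : int) : R := cos (mesh_angle * l%:~R).
(** Even and N-periodic on the grid, and zero at 0 and N: ghost values mirror the interior ones, so
    that normal differences vanish together with boundary values. *)
Definition bump_grid (l : int) : R := 1 - cos_grid l.

Local Notation th := mesh_angle.

Let N0 : (0 : R) < N%:R. Proof. by rewrite ltr0n ltnW. Qed.

Lemma mesh_angle_gt0 : 0 < th.
Proof. by rewrite divr_gt0// mulr_gt0// pi_gt0. Qed.

Lemma sin_le_id (x : R) : 0 <= x -> `|sin x| <= x.
Proof.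
move=> x0; have := @mean_value_bound R sin cos 0 x 1.
rewrite sin0 !subr0 mul1r (ger0_norm x0); apply.
by move=> z _; exact: cos_max.
Qed.

Lemma one_sub_cos (x : R) : 1 - cos x = 2 * sin (x / 2) ^+ 2.
Proof.
have {1}-> : x = (x / 2) *+ 2 by rewrite -mulr_natr; field.
by rewrite cos_mulr2n sin2cos2 mulr2n; ring.
Qed.

Lemma one_sub_cos_le (x : R) : 0 <= x -> 0 <= 2 * (1 - cos x) <= x ^+ 2.
Proof.
move=> x0; have x2 : 0 <= x / 2 by rewrite divr_ge0.
rewrite one_sub_cos (_ : x ^+ 2 = 4 * (x / 2) ^+ 2); last by field.
rewrite mulrA (_ : 2 * 2 = 4 :> R); last by ring.
rewrite mulr_ge0 ?sqr_ge0//= ler_pM2l// -[sin _ ^+ 2]real_normK ?num_real//.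
by rewrite lerXn2r// ?nnegrE// sin_le_id.
Qed.

Lemma cos_grid0 : cos_grid 0 = 1. Proof. by rewrite /cos_grid mulr0 cos0. Qed.

Lemma cos_gridN (l : int) : cos_grid (- l) = cos_grid l.
Proof. by rewrite /cos_grid rmorphN mulrN cosN. Qed.

Lemma cos_gridNl (l : int) : cos_grid (N%:Z + l) = cos_grid l.
Proof.
rewrite /cos_grid rmorphD mulrDr (_ : th * N%:~R = pi *+ 2).
  by rewrite addrC cosD2pi.
by rewrite /th -mulr_natr -[N%:~R]/(N%:R); field; rewrite gt_eqF.
Qed.

Lemma cos_grid_le (l : int) : `|cos_grid l| <= 1. Proof. exact: cos_max. Qed.

Lemma bump_grid_le (l : int) : 0 <= bump_grid l <= 2.
Proof.
by have := cos_grid_le l; rewrite ler_norml /bump_grid => /andP[? ?]; apply/andP; split; lra.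
Qed.

Lemma cos_grid_D1 (l : int) :
  cos_grid (l + 1) - cos_grid (l - 1) = - 2 * sin th * sin (th * l%:~R).
Proof.
rewrite /cos_grid rmorphD rmorphB mulrDr mulrBr rmorph1 mulr1 cosD cosB; ring.
Qed.

Lemma cos_grid_D2 (l : int) : cos_grid (l - 1) - 2 * cos_grid l + cos_grid (l + 1)
  = - (2 * (1 - cos th)) * cos_grid l.
Proof.
rewrite /cos_grid rmorphB rmorphD mulrBr mulrDr rmorph1 mulr1 cosB cosD; ring.
Qed.

(** The cosine is an eigenvector of the second difference, and second differences of a periodic
    function telescope to 0 over a period. The eigenvalue, 2 (1 - cos th) up to sign, is nonzero
    because N > 1, so the cosine itself sums to 0. *)
Lemma sum_bump_grid : \sum_(1 <= l < N) bump_grid l%:Z = N%:R.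
Proof.
suff S : \sum_(0 <= l < N) cos_grid l%:Z = 0.
  move: S; rewrite big_ltn; last exact: ltnW.
  rewrite cos_grid0 => /eqP; rewrite addrC addr_eq0 => /eqP S.
  rewrite /bump_grid big_split /= sumr_const_nat sumrN S opprK -mulrSr subn1.
  by rewrite prednK// ltnW.
have P0 : 2 * (1 - cos th) != 0.
  rewrite one_sub_cos mulrA mulf_neq0// expf_neq0// gt_eqF//; apply: sin_gt0_pi.
  rewrite divr_gt0 ?mesh_angle_gt0//= ltr_pdivrMr// /th ltr_pdivrMr//.
  by rewrite [pi * 2]mulrC -mulrA ltr_pM2l// ltr_pMr ?pi_gt0// ltr1n.
apply: (mulfI P0); rewrite mulr0 mulr_sumr.
transitivity (\sum_(0 <= l < N) (- ((cos_grid l.+1%:Z - cos_grid (l.+1%:Z - 1))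
    - (cos_grid l%:Z - cos_grid (l%:Z - 1))))).
  apply: eq_bigr => l _; rewrite -[LHS]opprK -mulNr -cos_grid_D2.
  rewrite (_ : l.+1%:Z = l%:Z + 1); last by rewrite -PoszD addn1.
  rewrite addrK.
  by congr (- _); ring.
rewrite sumrN (telescope_sumr (fun l : nat => cos_grid l%:Z - cos_grid (l%:Z - 1)))//.
rewrite cos_gridNl -[N%:Z]addr0 cos_gridNl cos_grid0 sub0r cos_gridN.
by rewrite subrr oppr0.
Qed.

End cosine_grid.

Section bump_corrector.
Variables (R : realType) (N : nat) (L mu : R).
Hypotheses (N1 : (1 < N)%N) (L0 : 0 < L).
Let h := L / N%:R.
Let N0 : (0 : R) < N%:R. Proof. by rewrite ltr0n ltnW. Qed.
Let h0 : 0 < h. Proof. exact: divr_gt0. Qed.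
Local Notation th := (mesh_angle R N).
Local Notation phi := (@cos_grid R N).
Local Notation psi := (@bump_grid R N).

Definition bump_corrector : grid_fun R := fun l m => mu * (psi l * psi m).

(** The continuous eigenvalue; it dominates the discrete one, [lam], and so makes the bounds on the
    differences of the bump independent of [h]. *)
Definition bump_rate : R := (2 * pi / L) ^+ 2.
Let P := bump_rate.
Let lam := 2 * (1 - cos th) / h ^+ 2.

Let PE : th ^+ 2 / h ^+ 2 = P.
Proof. by rewrite /P /bump_rate /mesh_angle /h; field; rewrite !gt_eqF. Qed.

Lemma bump_rate_ge0 : 0 <= bump_rate. Proof. exact: sqr_ge0. Qed.

Let lam_le : 0 <= lam <= P.
Proof.
have /andP[l0 l1] := one_sub_cos_le (ltW (mesh_angle_gt0 R N1)).
by rewrite /lam -PE divr_ge0 ?sqr_ge0//= ler_pM2r// invr_gt0 exprn_gt0.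
Qed.

Let hN : h != 0. Proof. by rewrite gt_eqF. Qed.

Let D2phi (a : R) l : (a * phi (l - 1) - 2 * (a * phi l) + a * phi (l + 1)) / h ^+ 2
  = - lam * (a * phi l).
Proof.
transitivity (a * (phi (l - 1) - 2 * phi l + phi (l + 1)) / h ^+ 2); first by field.
by rewrite cos_grid_D2 /lam; field.
Qed.

Let D2psi (a : R) l : (a * psi (l - 1) - 2 * (a * psi l) + a * psi (l + 1)) / h ^+ 2
  = lam * (a * phi l).
Proof.
transitivity (- ((a * phi (l - 1) - 2 * (a * phi l) + a * phi (l + 1)) / h ^+ 2)).
  by rewrite /bump_grid; field.
by rewrite D2phi mulNr opprK.
Qed.

Lemma bump_boundary l m : boundary_node N l m -> bump_corrector l m = 0.
Proof.
have p0 : psi 0 = 0 by rewrite /bump_grid cos_grid0 subrr.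
have pN : psi N%:Z = 0 by rewrite /bump_grid -[N%:Z]addr0 cos_gridNl// cos_grid0 subrr.
rewrite /bump_corrector => /andP[/andP[/andP[l0 lN] /andP[m0 mN]]].
rewrite /interior_node !lt_neqAle l0 lN m0 mN !andbT.
rewrite -!negb_or negbK => /orP[/orP[]|/orP[]] /eqP; [move=> <-|move=> ->|move=> <-|move=> ->];
  by rewrite ?p0 ?pN ?mulr0 ?mul0r ?mulr0.
Qed.

Let psiN l : psi (- l) = psi l. Proof. by rewrite /bump_grid cos_gridN. Qed.
Let psiNl l : psi (N%:Z + l) = psi l. Proof. by rewrite /bump_grid cos_gridNl. Qed.

Lemma bump_Dnx l m : (l == 0) || (l == N%:Z) -> Dnx h N bump_corrector l m = 0.
Proof.
rewrite /Dnx /bump_corrector => _; rewrite psiN !psiNl psiN subrr.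
by case: ifP; rewrite ?subrr mul0r.
Qed.

Lemma bump_Dny l m : (m == 0) || (m == N%:Z) -> Dny h N bump_corrector l m = 0.
Proof.
rewrite /Dny /bump_corrector => _; rewrite psiN !psiNl psiN subrr.
by case: ifP; rewrite ?subrr mul0r.
Qed.

Lemma bump_sum : sumP N bump_corrector = mu * N%:R ^+ 2.
Proof.
rewrite /bump_corrector sumPZ; congr (_ * _); rewrite /sumP.
under eq_bigr do rewrite -mulr_sumr sum_bump_grid//.
by rewrite -mulr_suml sum_bump_grid// expr2.
Qed.

Lemma bump_le l m : `|bump_corrector l m| <= 4 * `|mu|.
Proof.
have /andP[a0 a1] := bump_grid_le R N l; have /andP[b0 b1] := bump_grid_le R N m.
rewrite normrM mulrC ler_wpM2r// ger0_norm ?mulr_ge0//.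
by rewrite (_ : 4 = 2 * 2 :> R); [exact: ler_pM|ring].
Qed.

Let b2 l : `|psi l| <= 2.
Proof. by have /andP[a0 a1] := bump_grid_le R N l; rewrite ger0_norm. Qed.

Let D00 l m : DD h 0 0 bump_corrector l m = lam * (mu * psi m * phi l).
Proof.
rewrite DD00E /bump_corrector -D2psi; congr (_ / _).
by move: (psi (l - 1)) (psi l) (psi (l + 1)) (psi m) => *; ring.
Qed.

Let D11 l m : DD h 1 1 bump_corrector l m = lam * (mu * psi l * phi m).
Proof.
rewrite DD11E /bump_corrector -D2psi; congr (_ / _).
by move: (psi (m - 1)) (psi l) (psi (m + 1)) (psi m) => *; ring.
Qed.

Let prod_le (a b c x y z : R) : 0 <= a -> `|a| <= x -> `|b| <= y -> `|c| <= z ->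
  `|a * (mu * b * c)| <= x * (`|mu| * y * z).
Proof.
move=> a0 ax yb cz; rewrite !normrM; apply: ler_pM => //.
by apply: ler_pM => //; rewrite ler_wpM2l.
Qed.

Let lamn : `|lam| <= P.
Proof. by have /andP[l0 l1] := lam_le; rewrite ger0_norm. Qed.

Lemma bump_DD i j l m : `|DD h i j bump_corrector l m| <= 2 * P * `|mu|.
Proof.
have l0 : 0 <= lam by case/andP: lam_le.
have diag a b : `|lam * (mu * psi a * phi b)| <= 2 * P * `|mu|.
  rewrite (_ : 2 * P * `|mu| = P * (`|mu| * 2 * 1)); last by ring.
  by apply: prod_le => //; exact: cos_grid_le.
have mix : `|(bump_corrector (l - 1) (m - 1) + bump_corrector (l + 1) (m + 1)
        - bump_corrector (l - 1) (m + 1) - bump_corrector (l + 1) (m - 1)) / (4 * h ^+ 2)|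
    <= 2 * P * `|mu|.
  rewrite /bump_corrector (_ : _ / _ = (sin th ^+ 2 / h ^+ 2)
      * (mu * sin (th * l%:~R) * sin (th * m%:~R))); last first.
    transitivity (mu * ((phi (l + 1) - phi (l - 1)) * (phi (m + 1) - phi (m - 1))) / (4 * h ^+ 2)).
      by rewrite /bump_grid; field.
    by rewrite !cos_grid_D1; field.
  rewrite (_ : 2 * P * `|mu| = (2 * P) * (`|mu| * 1 * 1)); last by ring.
  apply: prod_le; rewrite ?sin_max//; first by rewrite divr_ge0 ?sqr_ge0.
  rewrite ger0_norm ?divr_ge0 ?sqr_ge0//; apply: (@le_trans _ _ P).
    rewrite -PE ler_pM2r ?invr_gt0 ?exprn_gt0// -[sin _ ^+ 2]real_normK ?num_real//.
    have t0 := ltW (mesh_angle_gt0 R N1).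
    by rewrite lerXn2r// ?nnegrE// sin_le_id.
  by rewrite ler_peMl ?sqr_ge0// ler1n.
have [->|->] := ord2P i; have [->|->] := ord2P j.
- by rewrite D00; exact: diag.
- by rewrite DDCE//; exact: mix.
- by rewrite DDCE//; exact: mix.
- by rewrite D11; exact: diag.
Qed.

Lemma bump_bilap l m : `|bilap_h h bump_corrector l m| <= 8 * P ^+ 2 * `|mu|.
Proof.
have /andP[l0 _] := lam_le.
have l2 : `|lam ^+ 2| <= P ^+ 2 by rewrite normrX lerXn2r// nnegrE// sqr_ge0.
have e00 : DD h 0 0 (DD h 0 0 bump_corrector) l m = - (lam ^+ 2 * (mu * psi m * phi l)).
  rewrite DD00E !D00 (_ : - _ = lam * (- lam * (mu * psi m * phi l))); last by ring.
  by rewrite -D2phi; move: (phi (l - 1)) (phi l) (phi (l + 1)) => *; field.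
have e01 : DD h 0 0 (DD h 1 1 bump_corrector) l m = lam ^+ 2 * (mu * phi m * phi l).
  rewrite DD00E !D11 (_ : lam ^+ 2 * _ = lam * (lam * (mu * phi m * phi l))); last by ring.
  by rewrite -(D2psi (mu * phi m) l); move: (psi (l - 1)) (psi l) (psi (l + 1)) => *; field.
have e11 : DD h 1 1 (DD h 1 1 bump_corrector) l m = - (lam ^+ 2 * (mu * psi l * phi m)).
  rewrite DD11E !D11 (_ : - _ = lam * (- lam * (mu * psi l * phi m))); last by ring.
  by rewrite -D2phi; move: (phi (m - 1)) (phi m) (phi (m + 1)) => *; field.
rewrite /bilap_h e00 e01 e11 (_ : 8 * _ * _ = P ^+ 2 * (`|mu| * 2 * 1)
  + 2 * (P ^+ 2 * (`|mu| * 2 * 1)) + P ^+ 2 * (`|mu| * 2 * 1)); last by ring.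
have s0 := sqr_ge0 lam; have c1 := @cos_grid_le R N.
apply: norm_add_le; last by rewrite normrN; apply: prod_le.
apply: norm_add_le; first by rewrite normrN; apply: prod_le.
rewrite normrM (gtr0_norm (_ : 0 < 2))// ler_pM2l//; apply: prod_le => //.
by apply: le_trans (c1 _) _; rewrite ler1n.
Qed.

End bump_corrector.

(* Perturbation (w, W) of the sampled exact solution, of size O(h^2), which
   restores the discrete mass balance and stays inside the domain of the
   entropy. *)
Record corrector (R : realType) (p : model R) (T C h : R) (N : nat)
    (c : R -> R -> R -> R) (Q : R -> R -> R -> 'M[R]_2)
    (w : R -> grid_fun R) (W : R -> grid_tens R) : Prop := Corrector {
  corrector_boundary : forall t l m, 0 <= t <= T -> boundary_node N l m ->
    w t l m = 0 /\ W t l m = 0;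
  corrector_Dnx : forall t l m, 0 <= t <= T -> (l == 0) || (l == N%:Z) ->
    0 <= m <= N%:Z -> Dnx h N (w t) l m = 0;
  corrector_Dny : forall t l m, 0 <= t <= T -> (m == 0) || (m == N%:Z) ->
    0 <= l <= N%:Z -> Dny h N (w t) l m = 0;
  corrector_sum : forall t, 0 <= t <= T ->
    sumP N (w t) = - sumP N (fun l m => sample h t c l m - sample h 0 c l m);
  corrector_init : forall l m, grid_node N l m -> w 0 l m = 0 /\ W 0 l m = 0;
  corrector_traceless : forall t l m, 0 <= t <= T -> interior_node N l m ->
    sym_traceless (W t l m);
  corrector_size : forall t l m, 0 <= t <= T -> interior_node N l m ->
    `|w t l m| <= C * h ^+ 2 /\ forall i j, `|W t l m i j| <= C * h ^+ 2;
  corrector_rate : forall t t' l m, 0 <= t <= T -> 0 <= t' <= T ->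
    interior_node N l m -> `|w t' l m - w t l m| <= C * h ^+ 2 * `|t' - t| /\
    forall i j, `|W t' l m i j - W t l m i j| <= C * h ^+ 2 * `|t' - t|;
  corrector_DD : forall t l m, 0 <= t <= T -> interior_node N l m ->
    (forall i j, `|DD h i j (w t) l m| <= C * h ^+ 2) /\
    (forall i j a b, `|DD h i j (gcomp (W t) a b) l m| <= C * h ^+ 2);
  corrector_bilap : forall t l m, 0 <= t <= T -> interior_node N l m ->
    `|bilap_h h (w t) l m| <= C * h ^+ 2;
  corrector_lap : forall t l m, 0 <= t <= T -> boundary_node N l m ->
    `|lap_h h (w t) l m| <= C * h ^+ 2;
  corrector_domain : forall t l m, 0 <= t <= T -> interior_node N l m ->
    0 < sample h t c l m + w t l m < mM p /\
    0 < gap (sample h t c l m + w t l m) (sample h t Q l m + W t l m);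
  corrector_entropy : forall t l m, 0 <= t <= T -> interior_node N l m ->
    `|logit (mM p) (sample h t c l m)
      - logit (mM p) (sample h t c l m + w t l m)| * `|w t l m|
    + mnu p * ((sample h t c l m + w t l m)
       * entropy_breg (sample h t c l m) (sample h t Q l m)
           (sample h t c l m + w t l m) (sample h t Q l m + W t l m))
    <= C * h ^+ 4 }.

(** Interpolation with the step B h. Up to constants the two parts of the bound are eps / B^2, small
    by the choice of B, and B^4 h^6, small by the case hypothesis on eps; each is made at most half
    of kap * eps. *)
Lemma small_defect (R : realFieldType) (E G kap eps B h mu x : R) :
  0 < B -> 0 < h -> 96 * (80 * E) <= kap * B ^+ 2 -> 0 <= eps ->
  32 * G * B ^+ 4 * h ^+ 6 <= kap * eps -> `|x| <= 4 * mu ->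
  mu <= 4 * (60 * (4 * E * eps) / (B * h) ^+ 2 + G * (B * h) ^+ 4) * h ^+ 2 ->
  `|x| <= kap * eps.
Proof.
move=> B0 h0 h1 e0 h2 xm mm; apply: le_trans xm _.
apply: (@le_trans _ _ (4 * (4 * (60 * (4 * E * eps) / (B * h) ^+ 2 + G * (B * h) ^+ 4) * h ^+ 2))).
  by rewrite ler_pM2l.
rewrite (_ : 4 * _ = (96 * (80 * E) / B ^+ 2 * eps) / 2 + (32 * G * B ^+ 4 * h ^+ 6) / 2); last first.
  by field; rewrite !gt_eqF.
have : 96 * (80 * E) / B ^+ 2 * eps <= kap * eps.
  by rewrite ler_wpM2r// ler_pdivrMr// exprn_gt0.
by lra.
Qed.

(* The interpolation step s ~ eps^(1/4) balances the two terms. *)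
Lemma sqrt_defect (R : rcfType) (E G eps M a h mu x s : R) :
  0 < a -> 0 < eps <= M -> 0 <= E -> 0 <= G -> s ^+ 2 = a * Num.sqrt eps ->
  `|x| <= 4 * mu -> 0 < h ->
  mu <= 4 * (60 * (4 * E * eps) / s ^+ 2 + G * s ^+ 4) * h ^+ 2 ->
  x ^+ 2 <= (16 * (240 * E / a + G * a ^+ 2 * (1 + M))) ^+ 2 * (eps * h ^+ 4).
Proof.
move=> a0 /andP[e0 eM] E0 G0 s2 xm h0 mm.
pose q := Num.sqrt eps; have q0 : 0 < q by rewrite sqrtr_gt0.
have q2 : q ^+ 2 = eps by rewrite sqr_sqrtr// ltW.
have qM : q <= 1 + M.
  case: (lerP q 1) => q1; first by apply: le_trans q1 _; rewrite lerDl (le_trans _ eM)// ltW.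
  apply: (@le_trans _ _ eps); last by apply: le_trans eM _; rewrite lerDr.
  by rewrite -q2 expr2 ler_peMr// ltW.
have s4 : s ^+ 4 = a ^+ 2 * q ^+ 2.
  by rewrite (_ : s ^+ 4 = (s ^+ 2) ^+ 2); [rewrite s2 exprMn|rewrite -exprM].
have xb : `|x| <= 16 * (240 * E / a + G * a ^+ 2 * (1 + M)) * (q * h ^+ 2).
  apply: le_trans xm _.
  apply: (@le_trans _ _ (4 * (4 * (60 * (4 * E * eps) / s ^+ 2 + G * s ^+ 4) * h ^+ 2))).
    by rewrite ler_pM2l.
  rewrite s4 s2 -/q -q2.
  rewrite (_ : 4 * _ = 16 * (240 * E / a + G * a ^+ 2 * q) * (q * h ^+ 2)); last first.
    by field; rewrite !gt_eqF.
  have qh : 0 <= q * h ^+ 2 by rewrite mulr_ge0 ?sqr_ge0 ?(ltW q0).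
  have Ga : 0 <= G * a ^+ 2 by rewrite mulr_ge0 ?sqr_ge0.
  by apply: ler_wpM2r => //; rewrite ler_pM2l// lerD2l ler_wpM2l.
rewrite -[x ^+ 2]real_normK ?num_real// -q2.
rewrite (_ : _ * (_ * _) = (16 * (240 * E / a + G * a ^+ 2 * (1 + M)) * (q * h ^+ 2)) ^+ 2).
  have B0 := le_trans (normr_ge0 x) xb.
  by apply: lerXn2r; [exact: normr_ge0|exact: B0|exact: xb].
by ring.
Qed.

Lemma half_perturbation (R : realFieldType) (M a w : R) : 0 < a < M ->
  `|w| <= a / 2 -> `|w| <= (M - a) / 2 -> 0 < a + w < M.
Proof.
by rewrite !ler_norml => /andP[? ?] /andP[? ?] /andP[? ?]; apply/andP; split; lra.
Qed.

(** Both entropy costs are at most w^2 times a multiple of 1 / a + 1 / (M - a) <= E / eps, so the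
    factor eps in the bound on w^2 cancels. The smallness of w amounts to a relative change of at
    most d / 4 of both a and M - a, as needed for [gap_shift] and [logit_near]. *)
Lemma entropy_corrector_bound (R : realType) (M nu E eps d a w h Cq b : R) (Q : 'M[R]_2) :
  1 <= E -> 0 < b < M -> eps = separation M b -> comparable_in M E a b -> 0 < a < M ->
  0 < d <= 1 -> d <= gap a Q -> gap a Q <= 1 -> 0 < nu ->
  `|w| <= d / (4 * E) * eps -> w ^+ 2 <= Cq * (eps * h ^+ 4) ->
  [/\ 0 < a + w < M, 0 < gap (a + w) Q &
  `|logit M a - logit M (a + w)| * `|w| + nu * ((a + w) * entropy_breg a Q (a + w) Q)
    <= (2 * E + nu * (38 / d ^+ 2 * E)) * Cq * h ^+ 4].
Proof.
move=> E1 bM epsE cmp aM dI dX X1 nu0 wk wq; have /andP[a0 aM'] := aM.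
have E0 : 0 < E by apply: lt_le_trans E1.
have Ma : 0 < M - a by rewrite subr_gt0.
have /andP[d0 d1] := dI.
have eps0 : 0 < eps by rewrite epsE separation_gt0.
have [i1 i2 i3] := comparable_le bM aM cmp; rewrite -epsE in i3.
have [c1 c2 c3 c4] := cmp.
have el : eps <= E * a by rewrite epsE (le_trans (separation_le_l bM)).
have er : eps <= E * (M - a) by rewrite epsE (le_trans (separation_le_r bM)).
have k x : eps <= E * x -> `|w| <= d / 4 * x.
  move=> ex; apply: le_trans wk _; rewrite (_ : d / (4 * E) * eps = d / 4 * (eps / E)).
    by rewrite ler_pM2l ?divr_gt0// ler_pdivrMr// mulrC.
  by field; rewrite gt_eqF.
have wa := k _ el; have wM := k _ er.
have h2 x : 0 < x -> d / 4 * x <= x / 2.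
  by move=> x0; rewrite mulrC ler_pM2l//; move: d1; lra.
have wa2 := le_trans wa (h2 _ a0); have wM2 := le_trans wM (h2 _ Ma).
have waD : `|a + w - a| <= d / 4 * a by rewrite addrC addKr.
have X' := gap_shift a0 dI dX waD.
have inM : 0 < a + w < M by exact: half_perturbation.
split=> //; first by apply: lt_le_trans X'; rewrite divr_gt0.
have w2 : 0 <= w ^+ 2 by rewrite sqr_ge0.
have nw : `|w| * `|w| = w ^+ 2 by rewrite -expr2 real_normK ?num_real.
have L1 : `|logit M a - logit M (a + w)| * `|w| <= 2 * E * (w ^+ 2 / eps).
  apply: (@le_trans _ _ (2 * (`|w| / a + `|w| / (M - a)) * `|w|)).
    by rewrite ler_wpM2r// logit_near.
  rewrite (_ : _ * `|w| = 2 * (w ^+ 2 * (a^-1 + (M - a)^-1))); last by rewrite -nw; ring.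
  rewrite (_ : 2 * E * _ = 2 * (w ^+ 2 * (E / eps))); last by ring.
  by rewrite ler_pM2l// ler_wpM2l.
have L2 : (a + w) * entropy_breg a Q (a + w) Q <= 38 / d ^+ 2 * E * (w ^+ 2 / eps).
  apply: le_trans (entropy_breg_near a0 dI dX X1 waD) _.
  rewrite (_ : a + w - a = w); last by rewrite addrC addKr.
  have d38 : 0 <= 38 / d ^+ 2 by rewrite divr_ge0 ?sqr_ge0.
  rewrite -[leRHS]mulrA; apply: ler_wpM2l => //; rewrite mulrCA.
  by apply: ler_wpM2l => //; apply: le_trans i3; rewrite lerDl invr_ge0 ltW.
have L3 : w ^+ 2 / eps <= Cq * h ^+ 4 by rewrite ler_pdivrMr// -mulrA [h ^+ 4 * _]mulrC.
apply: (@le_trans _ _ ((2 * E + nu * (38 / d ^+ 2 * E)) * (w ^+ 2 / eps))).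
  by rewrite [leRHS]mulrDl; apply: lerD => //; rewrite -[leRHS]mulrA ler_pM2l.
have d38 : 0 <= 38 / d ^+ 2 by rewrite divr_ge0 ?sqr_ge0.
have s0 : 0 <= 2 * E + nu * (38 / d ^+ 2 * E).
  by apply: addr_ge0; [rewrite mulr_ge0// ltW|rewrite (mulr_ge0 (ltW nu0))// mulr_ge0// ltW].
by rewrite -[leRHS]mulrA; apply: ler_wpM2l.
Qed.

Section grid_nodes.
Variables (R : realType) (N : nat) (L : R).
Hypotheses (N1 : (1 < N)%N) (L0 : 0 < L).
Let h := L / N%:R.
Let N0 : (0 < N)%N. Proof. exact: ltnW. Qed.
Let h0 : 0 < h := mesh_gt0 L0 N0.
Let hN : N%:Z%:~R * h = L := mesh_N L N0.

Lemma interior_mesh l m : interior_node N l m ->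
  0 < l%:~R * h < L /\ 0 < m%:~R * h < L.
Proof.
move=> /andP[/andP[l0 lN] /andP[m0 mN]].
have lt (k : int) : k < N%:Z -> k%:~R * h < L by rewrite -(ltr_int R) -(ltr_pM2r h0) hN.
have pos (k : int) : 0 < k -> 0 < k%:~R * h by rewrite -(ltr0z R) => k0; apply: mulr_gt0.
by split; apply/andP; split; [exact: pos|exact: lt|exact: pos|exact: lt].
Qed.

Lemma grid_mesh l m : grid_node N l m ->
  0 <= l%:~R * h <= L /\ 0 <= m%:~R * h <= L.
Proof. by move=> /andP[lN mN]; split; apply: mesh_in. Qed.

Lemma boundary_mesh l m : boundary_node N l m ->
  [/\ 0 <= l%:~R * h <= L, 0 <= m%:~R * h <= L &
   (l%:~R * h == 0) || (l%:~R * h == L) || (m%:~R * h == 0) || (m%:~R * h == L)].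
Proof.
move=> /andP[lm]; have [lI mI] := grid_mesh lm; case/andP: lm => /andP[l0 lN] /andP[m0 mN].
rewrite /interior_node !lt_neqAle l0 lN m0 mN !andbT -!negb_or negbK => B; split => //.
have e0 (k : int) : (0 == k) -> k%:~R * h == 0 by move=> /eqP <-; rewrite mul0r.
have eN (k : int) : (k == N%:Z) -> k%:~R * h == L by move=> /eqP ->; rewrite hN.
by case/orP: B => /orP[] => [/e0|/eN|/e0|/eN] ->; rewrite ?orbT.
Qed.

Lemma interior_grid l m : interior_node N l m -> grid_node N l m.
Proof. by move=> /andP[/andP[l0 lN] /andP[m0 mN]]; rewrite /grid_node !ltW. Qed.

Lemma interior_neighbour l m (a b : int) : interior_node N l m ->
  -1 <= a <= 1 -> -1 <= b <= 1 -> grid_node N (l + a) (m + b).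
Proof. by clear; rewrite /interior_node /grid_node; lia. Qed.

Lemma mesh_le : h <= L / 2.
Proof. by rewrite /h ler_pM2l// lef_pV2 ?posrE ?ltr0n// ler_nat. Qed.

End grid_nodes.

Section corrector_data.
Variables (R : realType) (p : model R) (T K : R).
Variables (cbnd : R -> R -> R) (Qbnd : R -> R -> 'M[R]_2).
Variables (c : R -> R -> R -> R) (Q : R -> R -> R -> 'M[R]_2).
Hypotheses (hp : model_ok p) (hT : 0 < T).
Hypothesis sol : regular_solution p T K cbnd Qbnd c Q.
Let L := mL p.
Let L0 : 0 < L. Proof. by case: hp => -[]. Qed.
Local Notation E := (osc_ratio p K).
Local Notation cb := (boundary_value p cbnd).

(* The scale at which the entropy degenerates along the solution: c and mM p - c
   are bounded below by a multiple of it, and c varies by at most a multiple. *)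
Definition sol_separation : R := separation (mM p) cb.

Lemma boundary_value_in : 0 < cb < mM p.
Proof.
have L2 : 0 < mL p / 2 < mL p by rewrite -/L; move: L0; lra.
have T0 : (0 : R) <= 0 <= T by rewrite lexx ltW.
by have [] := exact_comparable hp hT sol L2 L2 T0.
Qed.

Lemma sol_separation_gt0 : 0 < sol_separation.
Proof. exact: separation_gt0 boundary_value_in. Qed.

Lemma sol_separation_le : sol_separation <= mM p.
Proof. exact: separation_le boundary_value_in. Qed.

Lemma osc_gt0 : 0 < E.
Proof. exact: expR_gt0. Qed.

Lemma exact_dist (x y t : R) : 0 < x < L -> 0 < y < L -> 0 <= t <= T ->
  `|c x y t - cb| <= 2 * E * sol_separation.
Proof.
move=> xI yI tT; have [_ cmp] := exact_comparable hp hT sol xI yI tT.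
have c0 := exact_c_in sol xI yI tT; have E1 := osc_ratio_ge1 hp hT sol.
by rewrite /sol_separation; exact: (comparable_dist E1 boundary_value_in c0 cmp).
Qed.

Lemma exact_increment_le (x y t t' : R) : 0 <= x <= L -> 0 <= y <= L ->
  0 <= t <= T -> 0 <= t' <= T ->
  `|c x y t' - c x y t| <= 4 * E * sol_separation.
Proof.
move=> xL yL tT tT'; case: (exact_cases xL yL) => [b|[xI yI]].
  have [-> _] := exact_boundary sol xL yL tT b; have [-> _] := exact_boundary sol xL yL tT' b.
  have e0 := osc_gt0; have s0 := sol_separation_gt0.
  by rewrite subrr normr0; apply: mulr_ge0 (ltW s0); apply: mulr_ge0 (ltW e0).
have d1 := exact_dist xI yI tT; have d2 := exact_dist xI yI tT'.
rewrite (_ : c x y t' - c x y t = (c x y t' - cb) - (c x y t - cb)); last by ring.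
rewrite (_ : 4 * E * _ = 2 * E * sol_separation + 2 * E * sol_separation); last by ring.
exact: norm_sub_le.
Qed.

End corrector_data.

Lemma gap_bound_le1 (R : realType) (p : model R) (K : R) : gap_bound p K <= 1.
Proof.
have g0 : 0 < 1 + ((K + lin_Q_bound p K) / mnu p) ^+ 2 / 2.
  by rewrite ltr_pwDl// divr_ge0 ?sqr_ge0.
by rewrite /gap_bound invf_le1// lerDl divr_ge0 ?sqr_ge0.
Qed.

Lemma le_sqr1D (R : realFieldType) (M : R) : 0 <= M -> M <= (1 + M) ^+ 2.
Proof. by move=> M0; rewrite -subr_ge0 (_ : _ - _ = 1 + M + M ^+ 2); [rewrite !addr_ge0 ?sqr_ge0|ring]. Qed.

Lemma le_sum5 (R : realFieldType) (a b d e f : R) :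
  0 <= a -> 0 <= b -> 0 <= d -> 0 <= e -> 0 <= f ->
  [/\ a <= a + b + d + e + f, b <= a + b + d + e + f, d <= a + b + d + e + f,
      e <= a + b + d + e + f & f <= a + b + d + e + f].
Proof. by move=> *; split; lra. Qed.

Section bump_case.
Variables (R : realType) (p : model R) (T K : R).

(** [corr_kap] is the size relative to eps that [entropy_corrector_bound] allows to w; [corr_width],
    the interpolation step in units of h, is large enough for the first hypothesis of
    [small_defect]. *)
Definition corr_kap : R := gap_bound p K / (4 * osc_ratio p K).
Definition corr_width : R := 1 + 96 * (80 * osc_ratio p K) / corr_kap.
Definition deriv6 : R := 50 * 5 ^+ 6 * (K + K).
(** Chosen so that the step s with s^2 = [corr_scale] * sqrt eps satisfies 10 s <= L for every eps
    <= M. *)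
Definition corr_scale : R := mL p ^+ 2 / (100 * (1 + mM p)).
Definition corr_sqrt : R := (16 * (240 * osc_ratio p K / corr_scale
  + deriv6 * corr_scale ^+ 2 * (1 + mM p))) ^+ 2.
Definition bump_const : R :=
  16 * (K * T) + 16 * K + 16 * bump_rate (mL p) * (K * T)
  + 32 * bump_rate (mL p) ^+ 2 * (K * T)
  + (2 * osc_ratio p K + mnu p * (38 / gap_bound p K ^+ 2 * osc_ratio p K)) * corr_sqrt.

Variables (cbnd : R -> R -> R) (Qbnd : R -> R -> 'M[R]_2).
Variables (c : R -> R -> R -> R) (Q : R -> R -> R -> 'M[R]_2) (N : nat).
Hypotheses (hp : model_ok p) (hT : 0 < T) (N1 : (1 < N)%N).
Hypothesis sol : regular_solution p T K cbnd Qbnd c Q.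
Local Notation E := (osc_ratio p K).
Local Notation eps := (sol_separation p cbnd).
Local Notation L := (mL p).
Let h := L / N%:R.
Hypothesis hB : 10 * (corr_width * h) <= L.
Hypothesis hE : 32 * deriv6 * corr_width ^+ 4 * h ^+ 6 <= corr_kap * eps.

Let L0 : 0 < L. Proof. by case: hp => -[]. Qed.
Let M0 : 0 < mM p. Proof. by case: hp => -[]. Qed.
Let nu0 : 0 < mnu p. Proof. by case: hp => -[]. Qed.
Let K0 : 0 <= K := derivative_bound_ge0 hp hT sol.
Let h0 : 0 < h := mesh_gt0 L0 (ltnW N1).
Let hN : N%:R * h = L := mesh_N L (ltnW N1).
Let E0 : 0 < E := osc_gt0 p K.
Let e0 : 0 < eps := sol_separation_gt0 hp hT sol.
Let T0 : (0 : R) <= 0 <= T. Proof. by rewrite lexx ltW. Qed.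

Definition mass_defect (t : R) : R :=
  h ^+ 2 * sumP N (fun l m => sample h t c l m - sample h 0 c l m).

(** The bump of amplitude 1 has nodal sum N^2, and h^2 N^2 = L^2. *)
Let mu (t : R) : R := - (mass_defect t / L ^+ 2).
Definition bump_case_corrector (t : R) : grid_fun R := bump_corrector N (mu t).

Let L20 : 0 < L ^+ 2. Proof. by rewrite exprn_gt0. Qed.

Let mu_rate (t t' : R) : 0 <= t <= T -> 0 <= t' <= T ->
  `|mu t' - mu t| <= 4 * K * h ^+ 2 * `|t' - t|.
Proof.
move=> tT tT'; have H := discrete_mass_rate hp sol (ltnW N1) hN tT tT'.
rewrite (_ : mu t' - mu t = - ((h ^+ 2 * sumP N (fun l m => sample h t' c l m - sample h t c l m))
   / L ^+ 2)); last first.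
  by rewrite /mu /mass_defect !sumPB; move: (sumP N _) (sumP N _) (sumP N _) => *; ring.
rewrite normrN normrM normfV (gtr0_norm L20) ler_pdivrMr//.
by apply: le_trans H _; rewrite le_eqVlt; apply/orP; left; apply/eqP; ring.
Qed.

Let mu0 : mu 0 = 0.
Proof. by rewrite /mu /mass_defect sumPB subrr mulr0 mul0r oppr0. Qed.

Let mu_le (t : R) : 0 <= t <= T -> `|mu t| <= 4 * (K * T) * h ^+ 2.
Proof.
move=> tT; have := mu_rate T0 tT; rewrite mu0 !subr0 => H; apply: le_trans H _.
rewrite (_ : 4 * (K * T) * h ^+ 2 = 4 * K * h ^+ 2 * T); last by ring.
have /andP[t0 tT'] := tT; rewrite ger0_norm//; apply: ler_wpM2l => //.
by rewrite mulr_ge0 ?sqr_ge0// mulr_ge0.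
Qed.

Let mu_interpolated (t s : R) : 0 <= t <= T -> 0 < s -> 10 * s <= L ->
  `|mu t| <= 4 * (60 * (4 * E * eps) / s ^+ 2 + deriv6 * s ^+ 4) * h ^+ 2.
Proof.
move=> tT s0 sL; rewrite /mu normrN normrM normfV (gtr0_norm L20) ler_pdivrMr//.
apply: le_trans (discrete_mass_interpolated hp sol (ltnW N1) hN T0 tT s0 sL
  (A := 4 * E * eps) _) _.
  by move=> x y xL yL; exact: (exact_increment_le hp hT sol).
by rewrite /deriv6 le_eqVlt; apply/orP; left; apply/eqP; ring.
Qed.

Let d0 : 0 < gap_bound p K := gap_bound_gt0 p K.
Let d1 : gap_bound p K <= 1 := gap_bound_le1 p K.

Let kap0 : 0 < corr_kap.
Proof. by rewrite divr_gt0// mulr_gt0. Qed.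

Let B1 : 1 <= corr_width.
Proof.
rewrite lerDl; apply: divr_ge0 (ltW kap0); apply: mulr_ge0 => //.
by apply: mulr_ge0 (ltW E0).
Qed.

Let a0 : 0 < corr_scale.
Proof. by rewrite divr_gt0// mulr_gt0// addr_gt0. Qed.

Let w_small (t : R) l m : 0 <= t <= T -> `|bump_case_corrector t l m| <= corr_kap * eps.
Proof.
move=> tT; have B0 : 0 < corr_width by apply: lt_le_trans B1.
apply: (small_defect (E := E) B0 h0 _ (ltW e0) hE (bump_le _ _ _ _)).
  apply: (@le_trans _ _ (corr_kap * corr_width)).
    rewrite /corr_width (_ : corr_kap * _ = corr_kap + 96 * (80 * E)).
      by rewrite lerDr ltW.
    by rewrite mulrDr mulr1 mulrCA divff ?mulr1// gt_eqF.
  by rewrite ler_pM2l// expr2 ler_peMr// ltW.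
by apply: mu_interpolated => //; rewrite mulr_gt0.
Qed.

Let w_sqr (t : R) l m : 0 <= t <= T ->
  bump_case_corrector t l m ^+ 2 <= corr_sqrt * (eps * h ^+ 4).
Proof.
move=> tT; pose s := Num.sqrt (corr_scale * Num.sqrt eps).
have q0 : 0 < Num.sqrt eps by rewrite sqrtr_gt0.
have s2 : s ^+ 2 = corr_scale * Num.sqrt eps by rewrite sqr_sqrtr// mulr_ge0 ?ltW.
have s0 : 0 < s by rewrite sqrtr_gt0 mulr_gt0.
have eM : 0 < eps <= mM p by rewrite e0 (sol_separation_le hp hT sol).
have q1 : Num.sqrt eps <= 1 + mM p.
  rewrite -[leRHS]ger0_norm ?addr_ge0 ?(ltW M0)// -sqrtr_sqr ler_wsqrtr//.
  have /andP[_ eM'] := eM; apply: le_trans eM' _.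
  exact: le_sqr1D (ltW M0).
have sL : 10 * s <= L.
  rewrite -(@ler_pXn2r _ 2) ?nnegrE ?mulr_ge0 ?(ltW s0) ?(ltW L0)// exprMn s2 /corr_scale.
  rewrite (_ : 10 ^+ 2 * _ = L ^+ 2 * (Num.sqrt eps / (1 + mM p))); last first.
    by field; rewrite gt_eqF// addr_gt0.
  by rewrite ler_piMr ?(ltW L20)// ler_pdivrMr ?mul1r// addr_gt0.
apply: (sqrt_defect a0 eM (ltW E0) _ s2 (bump_le _ _ _ _) h0 (mu_interpolated tT s0 sL)).
by rewrite mulr_ge0// addr_ge0.
Qed.

Let KT : 0 <= K * T. Proof. by rewrite mulr_ge0// ltW. Qed.
Let P0 := bump_rate_ge0 L.
Let S0 : 0 <= (2 * E + mnu p * (38 / gap_bound p K ^+ 2 * E)) * corr_sqrt.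
Proof.
rewrite mulr_ge0 ?sqr_ge0// addr_ge0//; first by rewrite mulr_ge0// ltW.
by rewrite (mulr_ge0 (ltW nu0))// mulr_ge0 ?(ltW E0)// divr_ge0 ?sqr_ge0.
Qed.

Let const_le : [/\ 16 * (K * T) <= bump_const, 16 * K <= bump_const,
  16 * bump_rate L * (K * T) <= bump_const, 32 * bump_rate L ^+ 2 * (K * T) <= bump_const &
  (2 * E + mnu p * (38 / gap_bound p K ^+ 2 * E)) * corr_sqrt <= bump_const].
Proof.
have t1 : 0 <= 16 * (K * T) by rewrite mulr_ge0.
have t2 : 0 <= 16 * K by rewrite mulr_ge0.
have t3 : 0 <= 16 * bump_rate L * (K * T) by rewrite mulr_ge0// mulr_ge0.
have t4 : 0 <= 32 * bump_rate L ^+ 2 * (K * T).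
  by apply: mulr_ge0 KT; rewrite mulr_ge0// sqr_ge0.
exact: le_sum5 t1 t2 t3 t4 S0.
Qed.

Let weaken (x y z : R) : x <= y * h ^+ 2 -> y <= z -> x <= z * h ^+ 2.
Proof. by move=> H yz; apply: le_trans H _; rewrite ler_wpM2r// sqr_ge0. Qed.

Let mu_mul (a : R) (t : R) : 0 <= a -> 0 <= t <= T ->
  a * `|mu t| <= a * (4 * (K * T)) * h ^+ 2.
Proof. by move=> a00 tT; rewrite -mulrA ler_wpM2l// mu_le. Qed.

Lemma bump_case : corrector p T bump_const h N c Q bump_case_corrector
  (fun _ _ _ => 0).
Proof.
have [k1 k2 k3 k4 k5] := const_le.
have DDle t l m i j : 0 <= t <= T ->
    `|DD h i j (bump_case_corrector t) l m| <= 8 * bump_rate L * (K * T) * h ^+ 2.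
  move=> tT; apply: le_trans (bump_DD _ N1 L0 i j l m) _.
  apply: le_trans (mu_mul _ tT) _; first by rewrite mulr_ge0.
  by rewrite le_eqVlt; apply/orP; left; apply/eqP; ring.
have k3' : 8 * bump_rate L * (K * T) <= bump_const.
  apply: le_trans k3; rewrite (_ : 16 * _ * _ = 8 * bump_rate L * (K * T) + 8 * bump_rate L * (K * T)).
    by rewrite lerDl; apply: mulr_ge0 KT; exact: mulr_ge0.
  by ring.
have C0 : 0 <= bump_const by apply: le_trans k2; rewrite mulr_ge0.
have Ch n : 0 <= bump_const * h ^+ n by rewrite mulr_ge0// exprn_ge0// ltW.
split.
- by move=> t l m tT lm; rewrite /bump_case_corrector bump_boundary.
- by move=> t l m tT lB mI; rewrite /bump_case_corrector bump_Dnx.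
- by move=> t l m tT lB mI; rewrite /bump_case_corrector bump_Dny.
- move=> t tT; rewrite /bump_case_corrector bump_sum// /mu /mass_defect.
  move: (sumP _ _) => S; rewrite -hN; field.
  by rewrite gt_eqF//= pnatr_eq0 -lt0n ltnW.
- by move=> l m _; rewrite /bump_case_corrector mu0 /bump_corrector mul0r.
- by move=> t l m _ _; split; [exact: trmx0|exact: mxtrace0].
- move=> t l m tT lm; split=> [|i j]; last by rewrite mxE normr0.
  apply: weaken k1; apply: le_trans (bump_le _ _ l m) _.
  apply: le_trans (mu_mul _ tT) _ => //.
  by rewrite le_eqVlt; apply/orP; left; apply/eqP; ring.
- move=> t t' l m tT tT' lm; split=> [|i j]; last by rewrite !mxE subrr normr0 mulr_ge0.
  have -> : bump_case_corrector t' l m - bump_case_corrector t l m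
      = bump_corrector N (mu t' - mu t) l m by rewrite /bump_corrector mulrBl.
  apply: le_trans (bump_le _ _ l m) _.
  apply: (@le_trans _ _ (16 * K * h ^+ 2 * `|t' - t|)).
    rewrite (_ : 16 * _ * _ * _ = 4 * (4 * K * h ^+ 2 * `|t' - t|)); last by ring.
    by rewrite ler_pM2l// mu_rate.
  by rewrite ler_wpM2r// ler_wpM2r// sqr_ge0.
- move=> t l m tT lm; split=> [i j|i j a b]; first by apply: weaken (DDle _ _ _ _ _ tT) k3'.
  have -> : DD h i j (gcomp (fun _ _ => 0 : 'M[R]_2) a b) l m = 0.
    by rewrite /DD /gcomp !mxE !(mulr0, addr0, subr0) !mul0r !if_same.
  by rewrite normr0.
- move=> t l m tT lm; apply: weaken k4; apply: le_trans (bump_bilap _ N1 L0 l m) _.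
  apply: le_trans (mu_mul _ tT) _; first by rewrite mulr_ge0// sqr_ge0.
  by rewrite le_eqVlt; apply/orP; left; apply/eqP; ring.
- move=> t l m tT lm; apply: weaken k3; rewrite lap_hE.
  rewrite (_ : 16 * _ * _ * _ = 8 * bump_rate L * (K * T) * h ^+ 2
    + 8 * bump_rate L * (K * T) * h ^+ 2); last by ring.
  by apply: norm_add_le; exact: DDle.
- move=> t l m tT lm; rewrite addr0; have [xI yI] := interior_mesh N1 L0 lm.
  have [_ cmp] := exact_comparable hp hT sol xI yI tT.
  by have [] := entropy_corrector_bound (osc_ratio_ge1 hp hT sol)
    (boundary_value_in hp hT sol) erefl cmp (exact_c_in sol xI yI tT)
    (introT andP (conj d0 d1)) (exact_gap_ge hp sol xI yI tT)
    (exact_gap_le1 c Q _ _ t) nu0 (w_small l m tT) (w_sqr l m tT).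
- move=> t l m tT lm; rewrite addr0; have [xI yI] := interior_mesh N1 L0 lm.
  have [_ cmp] := exact_comparable hp hT sol xI yI tT.
  have [_ _ H] := entropy_corrector_bound (osc_ratio_ge1 hp hT sol)
    (boundary_value_in hp hT sol) erefl cmp (exact_c_in sol xI yI tT)
    (introT andP (conj d0 d1)) (exact_gap_ge hp sol xI yI tT)
    (exact_gap_le1 c Q _ _ t) nu0 (w_small l m tT) (w_sqr l m tT).
  apply: le_trans H _.
  by rewrite ler_wpM2r// exprn_ge0// ltW.
Qed.

End bump_case.

(** * The rescaling corrector *)

Section bounded_grid_function.
Variables (R : realType) (h A : R) (u : grid_fun R) (l m : int).
Hypothesis h0 : 0 < h.

Lemma norm_D2_le (x y z B : R) : `|x| <= B -> `|y| <= B -> `|z| <= B ->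
  `|(x - 2 * y + z) / h ^+ 2| <= 4 * B / h ^+ 2.
Proof.
move=> xB yB zB; rewrite normrM [X in _ * X]ger0_norm ?invr_ge0 ?sqr_ge0//.
rewrite ler_pM2r ?invr_gt0 ?exprn_gt0// (_ : 4 * B = B + 2 * B + B); last by ring.
apply: norm_add_le => //; apply: norm_sub_le => //.
by rewrite normrM (gtr0_norm (_ : 0 < 2))// ler_pM2l.
Qed.

(** A crude bound by the values: those of the rescaling corrector are O(h^6), and dividing by h^2,
    or by h^4 in [bounded_bilap], still leaves O(h^2). *)
Lemma bounded_DD (i j : 'I_2) :
  (forall a b : int, -1 <= a <= 1 -> -1 <= b <= 1 -> `|u (l + a) (m + b)| <= A) ->
  `|DD h i j u l m| <= 4 * A / h ^+ 2.
Proof.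
move=> uA.
have u0x a : -1 <= a <= 1 -> `|u (l + a) m| <= A by move=> aI; rewrite -[m]addr0 uA.
have u0y b : -1 <= b <= 1 -> `|u l (m + b)| <= A by move=> bI; rewrite -[l]addr0 uA.
have u00 : `|u l m| <= A by rewrite -[m]addr0 u0y.
have A0 : 0 <= A by apply: le_trans u00.
have mix : `|(u (l - 1) (m - 1) + u (l + 1) (m + 1)
        - u (l - 1) (m + 1) - u (l + 1) (m - 1)) / (4 * h ^+ 2)| <= 4 * A / h ^+ 2.
  have h4 : 0 < 4 * h ^+ 2 by rewrite mulr_gt0// exprn_gt0.
  have h4i : 0 <= (4 * h ^+ 2)^-1 by rewrite invr_ge0 ltW.
  rewrite normrM [X in _ * X]ger0_norm//; apply: ler_pM => //.
    rewrite (_ : 4 * A = A + A + A + A); last by ring.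
    by apply: norm_sub_le; [apply: norm_sub_le; [apply: norm_add_le|]|]; exact: uA.
  rewrite lef_pV2 ?posrE ?mulr_gt0 ?exprn_gt0// ler_peMl ?sqr_ge0// ler1n//.
have [->|->] := ord2P i; have [->|->] := ord2P j.
- by rewrite DD00E; apply: norm_D2_le => //; exact: u0x.
- by rewrite DDCE.
- by rewrite DDCE.
- by rewrite DD11E; apply: norm_D2_le => //; exact: u0y.
Qed.

End bounded_grid_function.

Lemma bounded_bilap (R : realType) (h A : R) (u : grid_fun R) (l m : int) : 0 < h ->
  (forall a b : int, -2 <= a <= 2 -> -2 <= b <= 2 -> `|u (l + a) (m + b)| <= A) ->
  `|bilap_h h u l m| <= 64 * A / h ^+ 4.
Proof.
move=> h0 uA.
have D (i j : 'I_2) a b : -1 <= a <= 1 -> -1 <= b <= 1 ->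
    `|DD h i j u (l + a) (m + b)| <= 4 * A / h ^+ 2.
  move=> aI bI; apply: bounded_DD => // a' b' aI' bI'; rewrite -!addrA; apply: uA.
    by move: aI aI'; clear; lia.
  by move: bI bI'; clear; lia.
have DD2 (i j i' j' : 'I_2) : `|DD h i j (DD h i' j' u) l m| <= 4 * (4 * A / h ^+ 2) / h ^+ 2.
  by apply: bounded_DD => // a b; exact: D.
rewrite /bilap_h (_ : 64 * A / h ^+ 4 = 4 * (4 * A / h ^+ 2) / h ^+ 2
  + 2 * (4 * (4 * A / h ^+ 2) / h ^+ 2) + 4 * (4 * A / h ^+ 2) / h ^+ 2); last first.
  by field; rewrite gt_eqF.
apply: norm_add_le => //; apply: norm_add_le => //.
by rewrite normrM (gtr0_norm (_ : 0 < 2))// ler_pM2l.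
Qed.

(** Interpolation in time: closeness to a constant and a bounded second derivative control the first
    derivative. The factor [th] is there for Q, whose size cb it brings down to eps. *)
Lemma scaled_time_rate (R : realType) (u : R -> R -> R -> R) (x y T K A th b tau : R) :
  classC 4 u -> (forall s, 0 <= s <= T -> `|pds [:: Time; Time] u x y s| <= K) ->
  0 <= th <= 1 -> (forall s, 0 <= s <= T -> `|th * u x y s - b| <= A) ->
  0 < tau -> 2 * tau <= T ->
  forall t t', 0 <= t <= T -> 0 <= t' <= T ->
  th * `|u x y t' - u x y t| <= (2 * A / tau + K * tau) * `|t' - t|.
Proof.
move=> cu uK /andP[th0 th1] uA tau0 tauT t t' tT tT'.
pose f (k : nat) s := th * pds (nseq k Time) u x y s - (k == 0%N)%:R * b.
have df k (z : R) : (k < 2)%N -> is_derive z 1 (f k) (f k.+1 z).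
  move=> k2; have sz : (size (nseq k Time) < 4)%N by rewrite size_nseq (leq_trans k2).
  have H := is_derive_pdst cu x y z sz.
  by rewrite /f mul0r; apply: is_deriveB.
have K0 : 0 <= K by apply: le_trans (uK _ tT).
rewrite -[X in X * _](ger0_norm th0) -normrM mulrBr.
rewrite (_ : _ - _ = f 0%N t' - f 0%N t); last by rewrite /f /=; ring.
apply: (@mean_value_bound _ (f 0%N) (f 1%N)); first by move=> z; exact: df.
move=> z zt; have zT : 0 <= z <= T.
  have [/andP[z1 z2] [/andP[t0 t1] /andP[t0' t1']]] := (zt, (tT, tT')).
  by rewrite (le_trans _ z1) ?le_min ?t0 ?t0'//= (le_trans z2)// ge_max t1 t1'.
have tauT' : 2 * tau <= T - 0 by rewrite subr0.
apply: (first_derivative_interpolation df _ _ tau0 tauT' zT) => s sT.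
  rewrite /f mul0r subr0 normrM (ger0_norm th0).
  by apply: le_trans (uK _ sT); rewrite ler_piMl.
by rewrite /f /= mul1r; exact: uA.
Qed.

(** Only th |q' - q| is under control; the missing factor th is supplied by |w| / a', which stands
    in front of q' - q. *)
Lemma quotient_increment (R : realFieldType) (E th w w' a a' q q' D : R) :
  1 <= E -> 0 <= th <= 1 -> 0 < a -> 0 < a' -> `|q| <= a / 2 -> `|q'| <= a' / 2 ->
  `|w' - w| <= D -> `|a' - a| <= D -> `|w| / a' <= 4 * E ^+ 2 * th ->
  th * `|q' - q| <= D -> `|w' / a' * q' - w / a * q| <= 7 * E ^+ 2 * D.
Proof.
move=> E1 /andP[th0 th1] a0 a0' qa qa' wD aD wa qD.
have D0 : 0 <= D by apply: le_trans wD.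
have E2 : 1 <= E ^+ 2 by rewrite exprn_ege1.
rewrite (_ : _ - _ = (w' - w) * (q' / a') + w / a' * ((q' - q) - q / a * (a' - a))); last first.
  by field; rewrite !gt_eqF.
have r (x b : R) : 0 < b -> `|x| <= b / 2 -> `|x / b| <= 2^-1.
  by move=> b0 xb; rewrite normrM normfV (gtr0_norm b0) ler_pdivrMr// mulrC.
have h1 : `|(w' - w) * (q' / a')| <= D * 2^-1 by apply: norm_mul_le => //; exact: r.
have h2 : `|w / a' * ((q' - q) - q / a * (a' - a))| <= 4 * E ^+ 2 * (D + 2^-1 * D).
  rewrite normrM normrM normfV (gtr0_norm a0').
  apply: (@le_trans _ _ (4 * E ^+ 2 * th * (`|q' - q| + 2^-1 * `|a' - a|))).
    apply: ler_pM => //; first by rewrite divr_ge0// ltW.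
    apply: le_trans (ler_normB _ _) _; rewrite lerD2l normrM ler_wpM2r//; exact: r.
  rewrite -mulrA; apply: ler_wpM2l; first by rewrite mulr_ge0// sqr_ge0.
  rewrite mulrDr; apply: lerD => //; rewrite mulrCA ler_pM2l ?invr_gt0//.
  by apply: le_trans aD; rewrite ler_piMl.
have h3 : D <= E ^+ 2 * D by rewrite ler_peMl.
by apply: le_trans (norm_add_le h1 h2) _; move: h3 D0; lra.
Qed.

Section rescaling_case.
Variables (R : realType) (p : model R) (T K Lam : R).
Local Notation L := (mL p).
Local Notation E := (osc_ratio p K).

Definition interp_rate : R := 8 * E * Lam * L ^+ 3 / T + K * T / (2 * L ^+ 3).
Definition rescaling_const : R :=
  4 * E * Lam * L ^+ 4 + 7 * E ^+ 2 * interp_rate * L + 32 * E * Lam * L ^+ 2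
  + 64 * (4 * E * Lam) + 16 * ln E * E * Lam * L ^+ 2.

Variables (cbnd : R -> R -> R) (Qbnd : R -> R -> 'M[R]_2).
Variables (c : R -> R -> R -> R) (Q : R -> R -> R -> 'M[R]_2) (N : nat).
Hypotheses (hp : model_ok p) (hT : 0 < T) (N1 : (1 < N)%N).
Hypothesis sol : regular_solution p T K cbnd Qbnd c Q.
Local Notation eps := (sol_separation p cbnd).
Local Notation cb := (boundary_value p cbnd).
Let h := L / N%:R.
Hypothesis epsL : eps <= Lam * h ^+ 6.

Let L0 : 0 < L. Proof. by case: hp => -[]. Qed.
Let K0 : 0 <= K := derivative_bound_ge0 hp hT sol.
Let h0 : 0 < h := mesh_gt0 L0 (ltnW N1).
Let E0 : 0 < E := osc_gt0 p K.
Let E1 : 1 <= E := osc_ratio_ge1 hp hT sol.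
Let e0 : 0 < eps := sol_separation_gt0 hp hT sol.
Let T0 : (0 : R) <= 0 <= T. Proof. by rewrite lexx ltW. Qed.
Let cbM : 0 < cb < mM p := boundary_value_in hp hT sol.
Let hL : h <= L.
Proof. by apply: le_trans (mesh_le N1 L0) _; rewrite ler_pdivrMr// ler_peMr ?ler1n// ltW. Qed.
Let Lam0 : 0 <= Lam.
Proof.
by have := le_trans (ltW e0) epsL; rewrite pmulr_lge0// exprn_gt0.
Qed.
(** The increments of c are O(eps), but those of Q are only O(cb), which is much larger when cb is
    close to M; [th] is the ratio of the two scales. *)
Let th := eps / cb.
Let thI : 0 <= th <= 1.
Proof.
have /andP[b0 _] := cbM; rewrite /th divr_ge0 ?(ltW e0) ?(ltW b0)//= ler_pdivrMr// mul1r.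
exact: (separation_le_l cbM).
Qed.

(* Ghost values by even reflection, so that normal differences vanish. *)
Definition reflect_index (l : int) : int :=
  if l == -1 then 1 else if l == N%:Z + 1 then N%:Z - 1 else l.

Definition rescaling_w (t : R) : grid_fun R := fun l m =>
  sample h 0 c (reflect_index l) (reflect_index m)
  - sample h t c (reflect_index l) (reflect_index m).
Definition rescaling_W (t : R) : grid_tens R := fun l m =>
  (rescaling_w t l m / sample h t c l m) *: sample h t Q l m.

Lemma reflect_index_in l : -1 <= l <= N%:Z + 1 -> 0 <= reflect_index l <= N%:Z.
Proof.
rewrite /reflect_index; move: N1; clear; move=> N1; case: eqP => ?; first lia.
by case: eqP => ?; lia.
Qed.

Lemma reflect_index_id l : 0 <= l <= N%:Z -> reflect_index l = l.
Proof. by rewrite /reflect_index; clear; case: eqP => ?; [lia|case: eqP => ?; lia]. Qed.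

Let A := 4 * E * eps.

Lemma rescaling_w_le t l m : 0 <= t <= T -> -1 <= l <= N%:Z + 1 -> -1 <= m <= N%:Z + 1 ->
  `|rescaling_w t l m| <= A.
Proof.
move=> tT /reflect_index_in lI /reflect_index_in mI.
by apply: (exact_increment_le hp hT sol) => //; apply: mesh_in => //; exact: ltnW.
Qed.

Let wE t l m : grid_node N l m ->
  rescaling_w t l m = sample h 0 c l m - sample h t c l m.
Proof. by move=> /andP[lI mI]; rewrite /rescaling_w !reflect_index_id. Qed.

Lemma rescaling_boundary t l m : 0 <= t <= T -> boundary_node N l m ->
  rescaling_w t l m = 0.
Proof.
move=> tT lm; have [lI mI b] := boundary_mesh N1 L0 lm; have /andP[lm' _] := lm.
rewrite wE// /sample; have [-> _] := exact_boundary sol lI mI T0 b.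
by have [-> _] := exact_boundary sol lI mI tT b; rewrite subrr.
Qed.

Lemma rescaling_W_le t l m i j : 0 <= t <= T -> grid_node N l m ->
  `|rescaling_W t l m i j| <= A.
Proof.
move=> tT lm; have A0 : 0 <= A by rewrite mulr_ge0 ?(ltW e0)// mulr_ge0// ltW.
case: (boolP (interior_node N l m)) => lmI; last first.
  have B : boundary_node N l m by rewrite /boundary_node lm.
  by rewrite !mxE rescaling_boundary// !mul0r normr0.
have [xI yI] := interior_mesh N1 L0 lmI; have /andP[a0 _] := exact_c_in sol xI yI tT.
have Qc := exact_Q_le sol xI yI tT i j.
have wA : `|rescaling_w t l m| <= A.
  have /andP[/andP[l0 lN] /andP[m0 mN]] := lm.
  by apply: rescaling_w_le => //; apply/andP; split;
    [apply: le_trans l0|rewrite (le_trans lN)// lerDl|apply: le_trans m0|rewrite (le_trans mN)// lerDl].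
rewrite mxE -mulrA normrM -[leRHS]mulr1; apply: ler_pM => //.
rewrite mulrC normrM normfV (gtr0_norm a0) ler_pdivrMr// mul1r.
by apply: le_trans Qc _; rewrite ler_pdivrMr// ler_peMr ?ler1n// ltW.
Qed.

(** As A = O(h^6), a [tau] of order h^3 balances A / tau and K tau; the normalisation makes 2 tau <=
    T. *)
Let tau := T / 2 * (h / L) ^+ 3.
Let tau0 : 0 < tau.
Proof. by rewrite mulr_gt0 ?divr_gt0// exprn_gt0// divr_gt0. Qed.
Let tauT : 2 * tau <= T.
Proof.
rewrite (_ : 2 * tau = T * (h / L) ^+ 3); last by rewrite /tau; field; rewrite gt_eqF.
rewrite ler_piMr ?(ltW hT)// exprn_ile1 ?divr_ge0 ?(ltW h0) ?(ltW L0)//.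
by rewrite ler_pdivrMr// mul1r.
Qed.

Let rate_le : 2 * (2 * E * eps) / tau + K * tau <= interp_rate * h ^+ 3.
Proof.
rewrite /interp_rate [leRHS]mulrDl; apply: lerD; last first.
  by rewrite le_eqVlt; apply/orP; left; apply/eqP; rewrite /tau; field; rewrite gt_eqF.
rewrite ler_pdivrMr//.
apply: (@le_trans _ _ (2 * (2 * E * (Lam * h ^+ 6)))).
  by rewrite ler_pM2l// ler_pM2l// mulr_gt0.
by rewrite le_eqVlt; apply/orP; left; apply/eqP; rewrite /tau; field; rewrite !gt_eqF.
Qed.

Section increments.
Variables (x y : R).
Hypotheses (xI : 0 < x < L) (yI : 0 < y < L).
Let xL : 0 <= x <= L. Proof. by case/andP: xI => *; rewrite !ltW. Qed.
Let yL : 0 <= y <= L. Proof. by case/andP: yI => *; rewrite !ltW. Qed.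

Lemma c_rate t t' : 0 <= t <= T -> 0 <= t' <= T ->
  `|c x y t' - c x y t| <= interp_rate * h ^+ 3 * `|t' - t|.
Proof.
move=> tT tT'; case: (sol) => cc _ _ cK _.
rewrite -[X in X <= _]mul1r.
apply: le_trans (scaled_time_rate (K := K) (A := 2 * E * eps) (b := cb) (th := 1)
  (classCW (isT : (4 <= 6)%N) cc) _ _ _ tau0 tauT tT tT') _.
- by move=> s sT; exact: (cK [:: Time; Time]).
- by rewrite ler01 lexx.
- by move=> s sT; rewrite mul1r; exact: (exact_dist hp hT sol).
- by rewrite ler_wpM2r.
Qed.

Lemma Q_rate t t' i j : 0 <= t <= T -> 0 <= t' <= T ->
  th * `|Q x y t' i j - Q x y t i j| <= interp_rate * h ^+ 3 * `|t' - t|.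
Proof.
move=> tT tT'; case: (sol) => _ cQ _ _ QK; have /andP[th0 _] := thI.
have /andP[b0 _] := cbM.
apply: le_trans (scaled_time_rate (u := tcomp Q i j) (K := K) (A := 2 * E * eps) (b := 0)
  (cQ i j) _ thI _ tau0 tauT tT tT') _.
- by move=> s sT; exact: (QK i j [:: Time; Time]).
- move=> s sT; have [_ [_ c2 _ _]] := exact_comparable hp hT sol xI yI sT.
  rewrite subr0 normrM (ger0_norm th0).
  have H : `|tcomp Q i j x y s| <= E * cb.
    apply: le_trans (exact_Q_le sol xI yI sT i j) _; apply: le_trans c2.
    have /andP[a0 _] := exact_c_in sol xI yI sT.
    by rewrite ler_pdivrMr// ler_peMr ?ler1n// ltW.
  apply: (@le_trans _ _ (th * (E * cb))); first by rewrite ler_wpM2l.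
  rewrite /th (_ : _ * _ = E * eps); last by field; rewrite gt_eqF.
  by rewrite -mulrA ler_peMl ?ler1n// mulr_ge0 ?(ltW E0)// ltW.
- by rewrite ler_wpM2r.
Qed.

End increments.

Let A_le : A <= 4 * E * Lam * h ^+ 6.
Proof. by rewrite /A -[leRHS]mulrA ler_pM2l// mulr_gt0. Qed.

Let power_le (k : R) (a b : nat) : 0 <= k -> k * h ^+ (a + b) <= k * L ^+ a * h ^+ b.
Proof.
move=> k0; rewrite exprD -mulrA ler_wpM2l// ler_wpM2r ?exprn_ge0 ?(ltW h0)//.
by rewrite lerXn2r ?nnegrE ?(ltW h0) ?(ltW L0).
Qed.

Let EL : 0 <= E * Lam. Proof. by rewrite mulr_ge0// ltW. Qed.
Let lnE0 : 0 <= ln E. Proof. by rewrite ln_ge0. Qed.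

Lemma interp_rate_ge0 : 0 <= interp_rate.
Proof.
have h1 : 0 <= 8 * E * Lam by rewrite -mulrA mulr_ge0.
have L3 : 0 <= L ^+ 3 by rewrite exprn_ge0// ltW.
apply: addr_ge0; first exact: divr_ge0 (mulr_ge0 h1 L3) (ltW hT).
by apply: divr_ge0 (mulr_ge0 K0 (ltW hT)) _; rewrite mulr_ge0.
Qed.

Let const_le : [/\ 4 * E * Lam * L ^+ 4 <= rescaling_const,
  7 * E ^+ 2 * interp_rate * L <= rescaling_const,
  32 * E * Lam * L ^+ 2 <= rescaling_const, 64 * (4 * E * Lam) <= rescaling_const &
  16 * ln E * E * Lam * L ^+ 2 <= rescaling_const].
Proof.
have t1 : 0 <= 4 * E * Lam * L ^+ 4.
  by apply: mulr_ge0; [rewrite -mulrA mulr_ge0|rewrite exprn_ge0// ltW].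
have t2 : 0 <= 7 * E ^+ 2 * interp_rate * L.
  apply: mulr_ge0 (ltW L0); apply: mulr_ge0 interp_rate_ge0.
  by rewrite mulr_ge0// sqr_ge0.
have t3 : 0 <= 32 * E * Lam * L ^+ 2.
  by apply: mulr_ge0; [rewrite -mulrA mulr_ge0|rewrite sqr_ge0].
have t4 : 0 <= 64 * (4 * E * Lam) by apply: mulr_ge0 => //; rewrite -mulrA mulr_ge0.
have t5 : 0 <= 16 * ln E * E * Lam * L ^+ 2.
  apply: mulr_ge0; last by rewrite sqr_ge0.
  by rewrite -mulrA; apply: mulr_ge0 EL; apply: mulr_ge0.
exact: le_sum5 t1 t2 t3 t4 t5.
Qed.

Let weaken (x y z : R) (n : nat) : x <= y * h ^+ n -> y <= z -> x <= z * h ^+ n.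
Proof. by move=> H yz; apply: le_trans H _; rewrite ler_wpM2r// exprn_ge0// ltW. Qed.

Let sizeA : A <= rescaling_const * h ^+ 2.
Proof.
have [k1 _ _ _ _] := const_le; apply: weaken k1; apply: le_trans A_le _.
by apply: (power_le 4 2); rewrite -mulrA mulr_ge0.
Qed.

Let DDA : 4 * A / h ^+ 2 <= 16 * E * Lam * L ^+ 2 * h ^+ 2.
Proof.
rewrite ler_pdivrMr ?exprn_gt0//.
apply: (@le_trans _ _ (4 * (4 * E * Lam * h ^+ 6))); first by rewrite ler_pM2l.
rewrite (_ : 4 * _ = 16 * E * Lam * h ^+ (2 + 4)); last by ring.
rewrite -[leRHS]mulrA -exprD; apply: power_le.
by rewrite -mulrA mulr_ge0.
Qed.

Let DD_const (x : R) : x <= 4 * A / h ^+ 2 -> x <= rescaling_const * h ^+ 2.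
Proof.
move=> xA; have [_ _ k3 _ _] := const_le; apply: weaken k3.
apply: le_trans xA _; apply: le_trans DDA _; rewrite ler_wpM2r ?sqr_ge0//.
by rewrite ler_wpM2r ?sqr_ge0// -!mulrA ler_wpM2r// ler_nat.
Qed.

Let ext (l a b : int) : 0 <= l <= N%:Z -> -1 <= a <= 1 -> -1 <= l + a <= N%:Z + 1.
Proof. by clear; lia. Qed.

Let ext2 (l m a b : int) : interior_node N l m -> -2 <= a <= 2 -> -2 <= b <= 2 ->
  -1 <= l + a <= N%:Z + 1 /\ -1 <= m + b <= N%:Z + 1.
Proof. by clear; rewrite /interior_node; lia. Qed.

Lemma rescaling_case : corrector p T rescaling_const h N c Q rescaling_w rescaling_W.
Proof.
have [k1 k2 k3 k4 k5] := const_le.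
have NB : 0 <= N%:Z - 1 <= N%:Z /\ 0 <= (1 : int) <= N%:Z.
  by move: N1; clear=> N1; split; lia.
have rm1 : reflect_index (-1) = 1 by [].
have r1 : reflect_index 1 = 1 by apply: reflect_index_id; case: NB.
have rN1 : reflect_index (N%:Z + 1) = N%:Z - 1.
  by rewrite /reflect_index eqxx; case: eqP => //; clear; lia.
have rN : reflect_index (N%:Z - 1) = N%:Z - 1 by apply: reflect_index_id; case: NB.
have sampleE t l m : sample h t c l m = c (l%:~R * h) (m%:~R * h) t by [].
have wW t l m : interior_node N l m -> 0 <= t <= T ->
  sample h t c l m + rescaling_w t l m = sample h 0 c l m /\
  sample h t Q l m + rescaling_W t l m
    = (sample h 0 c l m / sample h t c l m) *: sample h t Q l m.
  move=> lm tT; have [xI yI] := interior_mesh N1 L0 lm.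
  have /andP[a0 _] := exact_c_in sol xI yI tT.
  rewrite /rescaling_W wE ?interior_grid//; split; first by rewrite addrC subrK.
  rewrite -{1}[sample h t Q l m]scale1r -scalerDl; congr (_ *: _).
  by rewrite mulrBl divff ?gt_eqF// addrC subrK.
split.
- move=> t l m tT lm; rewrite /rescaling_W rescaling_boundary//.
  by rewrite mul0r scale0r.
- move=> t l m tT lB mI; rewrite /Dnx /rescaling_w rm1 r1 rN1 rN !subrr.
  by case: ifP; rewrite mul0r.
- move=> t l m tT lB mI; rewrite /Dny /rescaling_w rm1 r1 rN1 rN !subrr.
  by case: ifP; rewrite mul0r.
- move=> t tT; rewrite -sumPN; apply: eq_sumP => l m lm.
  by rewrite wE ?interior_grid// opprB.
- move=> l m lm; rewrite /rescaling_W wE// subrr mul0r scale0r//.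
- move=> t l m tT lm; have [xI yI] := interior_mesh N1 L0 lm.
  have [QT Qt] := exact_sym_traceless sol xI yI tT.
  by split; rewrite /rescaling_W; [rewrite linearZ/= QT|rewrite mxtraceZ Qt mulr0].
- move=> t l m tT lm; have lg := interior_grid lm.
  split=> [|i j]; apply: le_trans sizeA; last exact: rescaling_W_le.
  have [//|//|] := @ext2 l m 0 0 lm; rewrite !addr0 => lI mI.
  exact: rescaling_w_le.
- move=> t t' l m tT tT' lm; have [xI yI] := interior_mesh N1 L0 lm.
  have R3 : 7 * E ^+ 2 * (interp_rate * h ^+ 3 * `|t' - t|)
      <= rescaling_const * h ^+ 2 * `|t' - t|.
    rewrite (_ : _ * (_ * _) = 7 * E ^+ 2 * interp_rate * h ^+ 3 * `|t' - t|); last by ring.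
    rewrite ler_wpM2r//; apply: weaken k2.
    by apply: (power_le 1 2); apply: mulr_ge0 interp_rate_ge0; rewrite mulr_ge0// sqr_ge0.
  have D0 : 0 <= interp_rate * h ^+ 3 * `|t' - t|.
    exact: (mulr_ge0 (mulr_ge0 interp_rate_ge0 (exprn_ge0 3 (ltW h0))) (normr_ge0 _)).
  have cr := c_rate xI yI tT tT'.
  have wr : `|rescaling_w t' l m - rescaling_w t l m| <= interp_rate * h ^+ 3 * `|t' - t|.
    rewrite !wE ?interior_grid//.
    by rewrite (_ : _ - _ = sample h t c l m - sample h t' c l m); [rewrite distrC|ring].
  split=> [|i j].
    apply: le_trans wr _; apply: le_trans R3; rewrite ler_peMl//.
    by rewrite mulr_ege1 ?ler1n// exprn_ege1.
  apply: le_trans R3; rewrite !mxE.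
  have /andP[a0 _] := exact_c_in sol xI yI tT.
  have /andP[a0' _] := exact_c_in sol xI yI tT'.
  apply: (quotient_increment E1 thI a0 a0' (exact_Q_le sol xI yI tT i j)
    (exact_Q_le sol xI yI tT' i j) wr cr); last exact: Q_rate.
  have [_ [c1 _ _ _]] := exact_comparable hp hT sol xI yI tT'.
  rewrite ler_pdivrMr//.
  apply: (@le_trans _ _ A).
    have [//|//|] := @ext2 l m 0 0 lm; rewrite !addr0 => lI mI.
    exact: rescaling_w_le.
  have /andP[b0 _] := cbM.
  rewrite (_ : A = 4 * E * th * cb); last by rewrite /A /th; field; rewrite gt_eqF.
  rewrite (_ : 4 * E ^+ 2 * th * _ = 4 * E * th * (E * c (l%:~R * h) (m%:~R * h) t')); last by ring.
  by have /andP[th0 _] := thI; rewrite ler_wpM2l// mulr_ge0// mulr_ge0// ltW.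
- move=> t l m tT lm; split=> [i j|i j a b]; apply: DD_const; apply: bounded_DD => // a' b' aI bI.
    have [||lI mI] := @ext2 l m a' b' lm; [by move: aI; clear; lia|by move: bI; clear; lia|].
    exact: rescaling_w_le.
  by apply: rescaling_W_le => //; exact: interior_neighbour.
- move=> t l m tT lm; apply: weaken k4.
  apply: le_trans (@bounded_bilap _ h A _ _ _ h0 _) _.
    move=> a b aI bI; have [lI mI] := ext2 lm aI bI; exact: rescaling_w_le.
  rewrite ler_pdivrMr ?exprn_gt0// (_ : 64 * (4 * E * Lam) * _ * _ = 64 * (4 * E * Lam * h ^+ 6)).
    by rewrite ler_pM2l.
  by ring.
- move=> t l m tT /andP[/andP[lI mI] _]; rewrite lap_hE.
  apply: weaken k3; rewrite (_ : 32 * _ * _ * _ * _ = 16 * E * Lam * L ^+ 2 * h ^+ 2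
    + 16 * E * Lam * L ^+ 2 * h ^+ 2); last by ring.
  by apply: norm_add_le; apply: le_trans DDA; apply: bounded_DD => // a b aI bI;
    apply: rescaling_w_le => //; exact: ext.
- move=> t l m tT lm; have [xI yI] := interior_mesh N1 L0 lm.
  have [-> ->] := wW _ _ _ lm tT; have c0 := exact_c_in sol xI yI T0.
  have /andP[a0 _] := exact_c_in sol xI yI tT; have /andP[a0' _] := c0.
  by rewrite gap_scaled//; split=> //; exact: (exact_gap_gt0 sol xI yI tT).
- move=> t l m tT lm; have [xI yI] := interior_mesh N1 L0 lm.
  have [-> ->] := wW _ _ _ lm tT; have c0 := exact_c_in sol xI yI T0.
  have ct := exact_c_in sol xI yI tT.
  have /andP[a0 _] := ct; have /andP[a0' _] := c0.
  rewrite entropy_breg_scaled//; last exact: (exact_gap_gt0 sol xI yI tT).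
  rewrite mulr0 mulr0 addr0; apply: weaken k5.
  have [_ cmp] := exact_comparable hp hT sol xI yI tT.
  have [_ cmp0] := exact_comparable hp hT sol xI yI T0.
  have g1 := comparable_logit E1 cbM ct cmp; have g2 := comparable_logit E1 cbM c0 cmp0.
  have g3 : `|logit (mM p) (sample h t c l m) - logit (mM p) (sample h 0 c l m)|
      <= 2 * ln E + 2 * ln E.
    rewrite (_ : _ - _ = (logit (mM p) (sample h t c l m) - logit (mM p) cb)
      - (logit (mM p) (sample h 0 c l m) - logit (mM p) cb)); last by ring.
    exact: norm_sub_le.
  (* The logarithms differ by a merely bounded amount; the whole power of h comes from |w| =
     O(h^6). *)
  apply: (@le_trans _ _ ((2 * ln E + 2 * ln E) * (4 * E * Lam * h ^+ 6))).
    apply: ler_pM => //; apply: le_trans A_le.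
    have [//|//|] := @ext2 l m 0 0 lm; rewrite !addr0 => lI mI.
    exact: rescaling_w_le.
  rewrite (_ : _ * _ = 16 * ln E * E * Lam * h ^+ (2 + 4)); last by ring.
  apply: power_le; rewrite -mulrA; apply: mulr_ge0 EL; exact: mulr_ge0.
Qed.

End rescaling_case.

(** * Residuals and assembly *)

Lemma corrector_weaken (R : realType) (p : model R) (T C C' h : R) (N : nat)
    (c : R -> R -> R -> R) (Q : R -> R -> R -> 'M[R]_2)
    (w : R -> grid_fun R) (W : R -> grid_tens R) : 0 <= h -> C <= C' ->
  corrector p T C h N c Q w W -> corrector p T C' h N c Q w W.
Proof.
move=> h0 CC [f1 f2 f3 f4 f5 f6 f7 f8 f9 f10 f11 f12 f13].
have up (x : R) n : x <= C * h ^+ n -> x <= C' * h ^+ n.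
  by move=> H; apply: le_trans H _; rewrite ler_wpM2r// exprn_ge0.
have up' (x y : R) n : x <= C * h ^+ n * `|y| -> x <= C' * h ^+ n * `|y|.
  by move=> H; apply: le_trans H _; rewrite ler_wpM2r// up.
split=> //.
- by move=> t l m tT lm; have [a b] := f7 t l m tT lm; split=> [|i j]; apply: up.
- by move=> t t' l m tT tT' lm; have [a b] := f8 t t' l m tT tT' lm;
    split=> [|i j]; apply: up'.
- by move=> t l m tT lm; have [a b] := f9 t l m tT lm; split=> [i j|i j i' j']; apply: up.
- by move=> t l m tT lm; apply/up/f10.
- by move=> t l m tT lm; apply/up/f11.
- by move=> t l m tT lm; apply/up/f13.
Qed.

Lemma corrector_exists (R : realType) (p : model R) (T K : R) :
  model_ok p -> 0 < T ->
  exists C : R, forall (cbnd : R -> R -> R) (Qbnd : R -> R -> 'M[R]_2)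
    (c : R -> R -> R -> R) (Q : R -> R -> R -> 'M[R]_2) (N : nat),
    (1 < N)%N -> regular_solution p T K cbnd Qbnd c Q ->
    exists w W, corrector p T C (mL p / N%:R) N c Q w W.
Proof.
move=> hp hT; have [[L0 M0 _] _] := hp.
pose B := corr_width p K.
pose Lam1 := 32 * deriv6 K * B ^+ 4 / corr_kap p K.
(* Above [Lam1] the smallness condition of the bump holds. The second term is for coarse grids, 10 B
   h > L, on which the interpolation step does not fit: there eps <= M is itself at most Lam h^6,
   and the rescaling applies. *)
pose Lam := Num.max Lam1 (mM p * (10 * B / mL p) ^+ 6).
exists (Num.max (bump_const p T K) (rescaling_const p T K Lam)).
move=> cbnd Qbnd c Q N N1 sol; set h := mL p / N%:R.
have h0 : 0 < h := mesh_gt0 L0 (ltnW N1).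
have h6 : 0 < h ^+ 6 by rewrite exprn_gt0.
have E1 := osc_ratio_ge1 hp hT sol.
have kap0 : 0 < corr_kap p K.
  by rewrite divr_gt0 ?gap_bound_gt0// mulr_gt0// (lt_le_trans _ E1).
have small : sol_separation p cbnd <= Lam * h ^+ 6 ->
    exists w W, corrector p T (Num.max (bump_const p T K) (rescaling_const p T K Lam)) h N c Q w W.
  move=> eL; have H := rescaling_case hp hT N1 sol eL.
  do 2 eexists; apply: corrector_weaken H; [exact: ltW|by rewrite le_max lexx orbT].
case: (lerP (sol_separation p cbnd) (Lam * h ^+ 6)) => [//|eL].
have hE : 32 * deriv6 K * B ^+ 4 * h ^+ 6 <= corr_kap p K * sol_separation p cbnd.
  rewrite -ler_pdivrMl// mulrA [_^-1 * _]mulrC -/Lam1.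
  by apply: le_trans (ltW eL); rewrite ler_pM2r// /Lam le_max lexx.
case: (lerP (10 * (B * h)) (mL p)) => hB.
  have H := bump_case hp hT N1 sol hB hE.
  by do 2 eexists; apply: corrector_weaken H; [exact: ltW|rewrite le_max lexx].
apply: small; apply: le_trans (sol_separation_le hp hT sol) _.
apply: (@le_trans _ _ (mM p * (10 * B / mL p) ^+ 6 * h ^+ 6)); last first.
  by rewrite ler_pM2r// /Lam le_max lexx orbT.
rewrite -mulrA ler_peMr ?(ltW M0)// -exprMn exprn_ege1//.
by rewrite mulrAC ler_pdivlMr// mul1r -mulrA ltW.
Qed.

Section linearity.
Variables (R : realType) (p : model R) (h : R).
Hypothesis h0 : h != 0.
Implicit Types f g k : grid_fun R.

Lemma DD_comb (i j : 'I_2) f g k l m :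
  DD h i j (fun l m => f l m + g l m - k l m) l m
  = DD h i j f l m + DD h i j g l m - DD h i j k l m.
Proof. by rewrite /DD; case: ifP => _; [case: ifP => _|]; field. Qed.

Lemma lap_h_comb f g k l m :
  lap_h h (fun l m => f l m + g l m - k l m) l m
  = lap_h h f l m + lap_h h g l m - lap_h h k l m.
Proof. by rewrite !lap_hE !DD_comb; ring. Qed.

Lemma bilap_h_comb f g k l m :
  bilap_h h (fun l m => f l m + g l m - k l m) l m
  = bilap_h h f l m + bilap_h h g l m - bilap_h h k l m.
Proof.
have E i j : DD h i j (fun l m => f l m + g l m - k l m)
    = (fun l m => DD h i j f l m + DD h i j g l m - DD h i j k l m).
  by apply/funext => a; apply/funext => b; exact: DD_comb.
by rewrite /bilap_h !E !DD_comb; ring.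
Qed.

Lemma Dnx_comb (N : nat) f g k l m :
  Dnx h N (fun l m => f l m + g l m - k l m) l m
  = Dnx h N f l m + Dnx h N g l m - Dnx h N k l m.
Proof. by rewrite /Dnx; case: ifP => _; field. Qed.

Lemma Dny_comb (N : nat) f g k l m :
  Dny h N (fun l m => f l m + g l m - k l m) l m
  = Dny h N f l m + Dny h N g l m - Dny h N k l m.
Proof. by rewrite /Dny; case: ifP => _; field. Qed.

Section fields.
Variables (c w d : grid_fun R) (Q W B : grid_tens R) (l m : int).
Let e : grid_fun R := fun l m => c l m + w l m - d l m.
Let r : grid_tens R := fun l m => Q l m + W l m - B l m.

Let rE i j : gcomp r i j = (fun l m => gcomp Q i j l m + gcomp W i j l m - gcomp B i j l m).
Proof. by apply/funext => a; apply/funext => b; rewrite /gcomp !mxE. Qed.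

Lemma L_c_comb : L_c p h e r l m = L_c p h c Q l m + L_c p h w W l m - L_c p h d B l m.
Proof. by rewrite /L_c !sum_ord2 !rE bilap_h_comb !DD_comb /e; ring. Qed.

Lemma L_Q_comb i j : L_Q p h e r l m i j
  = L_Q p h c Q l m i j + L_Q p h w W l m i j - L_Q p h d B l m i j.
Proof. by rewrite /L_Q !mxE !sum_ord2 !rE !DD_comb; ring. Qed.

End fields.

Definition L_c_size : R := `|2 * mgamma p| + `|2 * c20 p| * 2 + `|c23 p| * 4 + `|2 * c40 p|.
Definition L_Q_size : R := `|2 * c21 p| * 2 + `|2 * c22 p| * 2 + `|c23 p|.

Section bounds.
Variables (w : grid_fun R) (W : grid_tens R) (l m : int) (b : R).
Hypotheses (wb : `|w l m| <= b) (Dw : forall i j, `|DD h i j w l m| <= b).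
Hypotheses (DW : forall i j a a', `|DD h i j (gcomp W a a') l m| <= b).

Lemma L_c_le : `|bilap_h h w l m| <= b -> `|L_c p h w W l m| <= L_c_size * b.
Proof.
move=> bw; rewrite (_ : L_c_size * b = `|2 * mgamma p| * b + `|2 * c20 p| * (2 * b)
  + `|c23 p| * (4 * b) + `|2 * c40 p| * b); last by rewrite /L_c_size; ring.
rewrite /L_c !sum_ord2.
have d2 (x y : R) : `|x| <= b -> `|y| <= b -> `|x + y| <= 2 * b.
  by move=> xb yb; rewrite mulr_natl mulr2n; exact: norm_add_le.
apply: norm_add_le; last by rewrite normrM ler_wpM2l.
apply: norm_sub_le; last first.
  rewrite normrM ler_wpM2l// (_ : 4 * b = 2 * b + 2 * b); last by ring.
  by apply: norm_add_le; exact: d2.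
apply: norm_sub_le; last by rewrite normrM ler_wpM2l//; exact: d2.
by rewrite normrM ler_wpM2l.
Qed.

Lemma L_Q_le i j : `|L_Q p h w W l m i j| <= L_Q_size * b.
Proof.
rewrite (_ : L_Q_size * b = `|2 * c21 p| * (2 * b) + `|2 * c22 p| * (2 * b)
  + `|c23 p| * b); last by rewrite /L_Q_size; ring.
rewrite /L_Q !mxE !sum_ord2.
have d2 (x y : R) : `|x| <= b -> `|y| <= b -> `|x + y| <= 2 * b.
  by move=> xb yb; rewrite mulr_natl mulr2n; exact: norm_add_le.
apply: norm_sub_le; last by rewrite normrM ler_wpM2l.
apply: norm_sub_le; last by rewrite normrM ler_wpM2l//; exact: d2.
by rewrite normrN normrM ler_wpM2l//; exact: d2.
Qed.

End bounds.

End linearity.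

Lemma inner_box (R : realFieldType) (h L x : R) : 0 < h -> h <= x -> x + h <= L ->
  (0 <= x - h /\ x + h <= L) /\
  [/\ - h <= x - h, x + h <= L + h, - h <= x - 2 * h & x + 2 * h <= L + h].
Proof. by move=> *; split; [split|split]; lra. Qed.

Lemma trunc_c_algebra (R : realFieldType) (g a2 a3 a4 b c K h2 Db Pb : R)
    (D P q s : 'I_2 -> 'I_2 -> R) :
  `|Db - Pb| <= 24 * K * h2 -> (forall i j, `|D i j - P i j| <= 2 * K * h2) ->
  (forall i j, `|q i j - s i j| <= 2 * K * h2) ->
  `|2 * g * c - 2 * a2 * (\sum_(k < 2) D k k)
     - a3 * (\sum_(i < 2) \sum_(j < 2) q i j) + 2 * a4 * Db + 2 * (b - g) * c
    - (2 * b * c - 2 * a2 * (\sum_(k < 2) P k k)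
       - a3 * (\sum_(i < 2) \sum_(j < 2) s i j) + 2 * a4 * Pb)|
  <= (`|2 * a2| * 4 + `|a3| * 8 + `|2 * a4| * 24) * K * h2.
Proof.
move=> hb hD hq; rewrite !sum_ord2.
rewrite (_ : _ - _ = - (2 * a2 * ((D 0 0 - P 0 0) + (D 1 1 - P 1 1)))
  - a3 * ((q 0 0 - s 0 0) + (q 0 1 - s 0 1) + ((q 1 0 - s 1 0) + (q 1 1 - s 1 1)))
  + 2 * a4 * (Db - Pb)); last by ring.
rewrite (_ : _ * K * h2 = `|2 * a2| * (2 * K * h2 + 2 * K * h2)
  + `|a3| * (2 * K * h2 + 2 * K * h2 + (2 * K * h2 + 2 * K * h2))
  + `|2 * a4| * (24 * K * h2)); last by ring.
apply: norm_add_le; last by rewrite normrM ler_wpM2l.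
apply: norm_sub_le; first by rewrite normrN normrM ler_wpM2l// norm_add_le.
by rewrite normrM ler_wpM2l// !norm_add_le.
Qed.

Lemma trunc_Q_algebra (R : realFieldType) (a1 a2 a3 b K h2 qc D P : R)
    (q s r u : 'I_2 -> R) :
  `|D - P| <= 2 * K * h2 -> (forall k, `|q k - s k| <= 2 * K * h2) ->
  (forall k, `|r k - u k| <= 2 * K * h2) ->
  `|- (2 * a1 * (\sum_(k < 2) q k)) - 2 * a2 * (\sum_(k < 2) r k) - a3 * D
     + 2 * b * qc
    - (2 * b * qc - 2 * a1 * (\sum_(k < 2) s k) - 2 * a2 * (\sum_(k < 2) u k)
       - a3 * P)|
  <= (`|2 * a1| * 4 + `|2 * a2| * 4 + `|a3| * 2) * K * h2.
Proof.
move=> hD hq hr; rewrite !sum_ord2.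
rewrite (_ : _ - _ = - (2 * a1 * ((q 0 - s 0) + (q 1 - s 1)))
  - 2 * a2 * ((r 0 - u 0) + (r 1 - u 1)) - a3 * (D - P)); last by ring.
rewrite (_ : _ * K * h2 = `|2 * a1| * (2 * K * h2 + 2 * K * h2)
  + `|2 * a2| * (2 * K * h2 + 2 * K * h2) + `|a3| * (2 * K * h2)); last by ring.
apply: norm_sub_le; last by rewrite normrM ler_wpM2l.
apply: norm_sub_le; first by rewrite normrN normrM ler_wpM2l// norm_add_le.
by rewrite normrM ler_wpM2l// norm_add_le.
Qed.

Section operator_truncation.
Variables (R : realType) (p : model R) (T K : R) (N : nat).
Variables (c : R -> R -> R -> R) (Q : R -> R -> R -> 'M[R]_2).
Let L := mL p.
Let h := L / N%:R.
Hypotheses (L0 : 0 < L) (N1 : (1 < N)%N).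
Hypotheses (cc : classC 6 c) (cQ : forall i j : 'I_2, classC 4 (tcomp Q i j)).
Hypothesis cK : derivs_le 6 c (- h) (L + h) T K.
Hypothesis QK : forall i j : 'I_2, derivs_le 4 (tcomp Q i j) 0 L T K.
Variables (l m : int) (t : R).
Hypotheses (lm : interior_node N l m) (tT : 0 <= t <= T).
Let h0 : 0 < h := mesh_gt0 L0 (ltnW N1).
Let x := l%:~R * h.
Let y := m%:~R * h.

(** From an interior node the two steps of the bilaplacian reach at most the ghost layer, while the
    single step used for Q stays in the closed square, where its derivative bounds are available. *)
Let step (k : int) : 0 < k < N%:Z ->
  (0 <= k%:~R * h - h /\ k%:~R * h + h <= L) /\
  [/\ - h <= k%:~R * h - h, k%:~R * h + h <= L + h,
      - h <= k%:~R * h - 2 * h & k%:~R * h + 2 * h <= L + h].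
Proof.
move=> /andP[k0 kN].
have k1 : h <= k%:~R * h by rewrite ler_peMl ?(ltW h0)// ler1z.
have k2 : k%:~R * h + h <= L.
  rewrite -(mesh_N L (ltnW N1)) -/h -[X in _ + X]mul1r -mulrDl ler_pM2r//.
  by rewrite -[X in _ + X](_ : 1%:~R = 1)// -rmorphD ler_int lezD1.
exact: inner_box h0 k1 k2.
Qed.

Definition trunc_c : R := (`|2 * c20 p| * 4 + `|c23 p| * 8 + `|2 * c40 p| * 24) * K.
Definition trunc_Q : R := (`|2 * c21 p| * 4 + `|2 * c22 p| * 4 + `|c23 p| * 2) * K.

Let DDc i j : `|DD h i j (sample h t c) l m
    - pd (Defs.Space i) (pd (Defs.Space j) c) x y t| <= 2 * K * h ^+ 2.
Proof.
have /andP[lI mI] := lm; have [_ [a1 a2 _ _]] := step lI; have [_ [b1 b2 _ _]] := step mI.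
exact: (DD_consistent cc cK h0 tT a1 a2 b1 b2 i j isT).
Qed.

Let DDQ i j a b : `|DD h i j (gcomp (sample h t Q) a b) l m
    - pd (Defs.Space i) (pd (Defs.Space j) (tcomp Q a b)) x y t| <= 2 * K * h ^+ 2.
Proof.
have /andP[lI mI] := lm; have [[a1 a2] _] := step lI; have [[b1 b2] _] := step mI.
exact: (DD_consistent (cQ a b) (QK a b) h0 tT a1 a2 b1 b2 i j isT).
Qed.

Lemma L_c_truncation :
  `|L_c p h (sample h t c) (sample h t Q) l m + 2 * (c00 p - mgamma p) * c x y t
    - lin_c p c Q x y t| <= trunc_c * h ^+ 2.
Proof.
have /andP[lI mI] := lm; have [_ [a1 a2 a3 a4]] := step lI.
have [_ [b1 b2 b3 b4]] := step mI.
have Bi := bilap_consistent cc cK h0 tT a1 a2 b1 b2 isT a3 a4 b3 b4.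
rewrite -/x -/y in Bi.
exact: (@trunc_c_algebra R (mgamma p) (c20 p) (c23 p) (c40 p) (c00 p) (c x y t) K (h ^+ 2)
  _ _ (fun i j => DD h i j (sample h t c) l m)
  (fun i j => pd (Defs.Space i) (pd (Defs.Space j) c) x y t)
  (fun i j => DD h i j (gcomp (sample h t Q) i j) l m)
  (fun i j => pd (Defs.Space i) (pd (Defs.Space j) (tcomp Q i j)) x y t)
  Bi (fun i j => DDc i j) (fun i j => DDQ i j i j)).
Qed.

Lemma L_Q_truncation i j :
  `|L_Q p h (sample h t c) (sample h t Q) l m i j + 2 * c02 p * Q x y t i j
    - lin_Q p c Q x y t i j| <= trunc_Q * h ^+ 2.
Proof.
rewrite /L_Q mxE.
exact: (@trunc_Q_algebra R (c21 p) (c22 p) (c23 p) (c02 p) K (h ^+ 2) (Q x y t i j)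
  _ _ (fun k => DD h k k (gcomp (sample h t Q) i j) l m)
  (fun k => pd (Defs.Space k) (pd (Defs.Space k) (tcomp Q i j)) x y t)
  (fun k => DD h i k (gcomp (sample h t Q) k j) l m)
  (fun k => pd (Defs.Space i) (pd (Defs.Space k) (tcomp Q k j)) x y t)
  (DDc i j) (fun k => DDQ k k i j) (fun k => DDQ i k k j)).
Qed.

End operator_truncation.

Section projection.
Variable R : realType.
Implicit Types A B : 'M[R]_2.

Lemma projPD A B : projP (A + B) = projP A + projP B.
Proof.
apply/matrixP => i j; rewrite /projP /mxtrace !mxE !sum_ord2 !mxE.
by case: (i == j); rewrite ?mulr1n ?mulr0n; ring.
Qed.

Lemma projPN A : projP (- A) = - projP A.
Proof.
apply/matrixP => i j; rewrite /projP /mxtrace !mxE !sum_ord2 !mxE.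
by case: (i == j); rewrite ?mulr1n ?mulr0n; ring.
Qed.

Lemma projP_le A (v : R) i j : (forall i j, `|A i j| <= v) -> `|projP A i j| <= 2 * v.
Proof.
move=> Av; have v0 : 0 <= v by apply: le_trans (Av 0 0).
have h1 : `|2^-1 * (A i j + A j i)| <= v by rewrite mulrC norm_half_add_le.
have h2 : `|2^-1 * (A 0 0 + A 1 1)| <= v by rewrite mulrC norm_half_add_le.
rewrite /projP /mxtrace !mxE sum_ord2 (_ : 2 * v = v + v); last by ring.
case: (i == j); rewrite ?mulr1n ?mulr0n; first exact: norm_sub_le.
by rewrite subr0; apply: le_trans h1 _; rewrite lerDl.
Qed.

End projection.

(** The entropy terms X and Y cancel, because the exact equation holds at the unshifted solution:
    the residual consists of linear truncation errors and contributions of the corrector. *)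
Lemma residual_c_algebra (R : realFieldType) (ct1 ct0 w1 w0 c1 c0 dt X Y Lc Lw L1 b g
    lin m mh pt : R) : dt != 0 ->
  (c1 - c0) / dt = - (Y + 2 * (b - g) * c0 + L1 - mh) -> pt = - (X + lin - m) ->
  (ct1 + w1 - c1 - (ct0 + w0 - c0)) / dt
    + (X - Y + 2 * (b - g) * (ct0 + w0 - c0) + (Lc + Lw - L1)) - (m - mh)
  = ((ct1 - ct0) / dt - pt) + (w1 - w0) / dt - 2 * (b - g) * (ct1 - ct0)
    + 2 * (b - g) * w0 + (Lc + 2 * (b - g) * ct1 - lin) + Lw.
Proof.
move=> dt0 E ->.
have -> : (ct1 + w1 - c1 - (ct0 + w0 - c0)) / dt
  = (ct1 - ct0) / dt + (w1 - w0) / dt - (c1 - c0) / dt by field.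
by rewrite E; ring.
Qed.

Lemma residual_Q_algebra (R : realType) (Qa Qb Wa Wb Q1 Q0 V V1 Vx Pt : 'M[R]_2) (dt : R) :
  dt^-1 *: (Q1 - Q0) = - projP V1 -> Pt = - projP Vx ->
  dt^-1 *: (Qa + Wa - Q1 - (Qb + Wb - Q0)) + projP V
  = dt^-1 *: (Qa - Qb) - Pt + dt^-1 *: (Wa - Wb) + projP (V1 - Vx + V).
Proof.
move=> E ->; rewrite !projPD projPN.
have -> : Qa + Wa - Q1 - (Qb + Wb - Q0) = (Qa - Qb) + (Wa - Wb) - (Q1 - Q0).
  by apply/matrixP => i j; rewrite !mxE; ring.
rewrite scalerBr scalerDr E.
move: (dt^-1 *: (Qa - Qb)) (dt^-1 *: (Wa - Wb)) (projP V) (projP V1) (projP Vx).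
by move=> A B a b d; apply/matrixP => i j; rewrite !mxE; ring.
Qed.

Lemma residual_entry_algebra (R : realFieldType) (d1 Q0 L1 ch G r0 Le : 'M[R]_2) i j
    (k dx lin qa qb wt LQ LW : R) :
  ch i j = dx + lin -> Le i j = LQ + LW - L1 i j -> r0 i j = qb + wt - Q0 i j ->
  G i j = dx - d1 i j ->
  (d1 + k *: Q0 + L1 - ch + (G + k *: r0 + Le)) i j
  = (LQ + k * qa - lin) - k * (qa - qb) + k * wt + LW.
Proof. by move=> h1 h2 h3 h4; rewrite !mxE h1 h2 h3 h4; ring. Qed.

(** * Residuals and energy inequality of one time step *)

Section step_residual.
Variables (R : realType) (p : model R) (T K Km C dt : R) (N : nat).
Variables (cbnd : R -> R -> R) (Qbnd : R -> R -> 'M[R]_2).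
Variables (c : R -> R -> R -> R) (Q : R -> R -> R -> 'M[R]_2).
Hypotheses (hp : model_ok p) (hT : 0 < T) (N1 : (1 < N)%N) (dt0 : 0 < dt).
Hypothesis sol : regular_solution p T K cbnd Qbnd c Q.
Local Notation L := (mL p).
Let h := L / N%:R.
Hypothesis cK : derivs_le 6 c (- h) (L + h) T Km.
Hypothesis QK : forall i j : 'I_2, derivs_le 4 (tcomp Q i j) 0 L T Km.
Hypothesis C0 : 0 <= C.
Variables (w : R -> grid_fun R) (W : R -> grid_tens R).
Hypothesis cor : corrector p T C h N c Q w W.
Variables (c0 c1 : grid_fun R) (Q0 Q1 : grid_tens R) (t : R).
Hypotheses (t0 : 0 <= t) (tT' : t + dt <= T).
Hypothesis step : scheme_step p N dt c0 Q0 c1 Q1.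

Let L0 : 0 < L. Proof. by case: hp => -[]. Qed.
Let h0 : 0 < h := mesh_gt0 L0 (ltnW N1).
Let tT : 0 <= t <= T. Proof. by rewrite t0 (le_trans _ tT')// lerDl ltW. Qed.
Let t1T : 0 <= t + dt <= T. Proof. by rewrite tT' addr_ge0// ltW. Qed.
Let dtN0 : dt != 0. Proof. by rewrite gt_eqF. Qed.
Let hN0 : h != 0. Proof. by rewrite gt_eqF. Qed.
Let cc : classC 6 c. Proof. by case: sol. Qed.
Let cQ i j : classC 4 (tcomp Q i j). Proof. by case: sol. Qed.
Let Km0 : 0 <= Km.
Proof.
have T00 : (0 : R) <= 0 <= T by rewrite lexx ltW.
have L00 : (0 : R) <= 0 <= L by rewrite lexx ltW.
exact: le_trans (normr_ge0 _) (QK 0 0 (s := [:: sx]) isT L00 L00 T00).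
Qed.

Definition shift_err (u : R) (d : grid_fun R) : grid_fun R :=
  fun l m => sample h u c l m + w u l m - d l m.
Definition shift_err_Q (u : R) (D : grid_tens R) : grid_tens R :=
  fun l m => sample h u Q l m + W u l m - D l m.

Let e1 := shift_err (t + dt) c1.
Let e0 := shift_err t c0.
Let r1 := shift_err_Q (t + dt) Q1.
Let r0 := shift_err_Q t Q0.

(** The exact derivative of the entropy is taken at the unshifted solution, although the error is
    measured from the shifted one; the mismatch is charged to the three-point inequality. *)
Definition entropy_gap : grid_fun R := fun l m =>
  dXi_dc p (sample h (t + dt) c l m) (sample h (t + dt) Q l m) - dXi_dc p (c1 l m) (Q1 l m).
Definition entropy_gap_Q : grid_tens R := fun l m =>
  dXi_dQ p (sample h (t + dt) c l m) (sample h (t + dt) Q l m) - dXi_dQ p (c1 l m) (Q1 l m).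

Definition res_c_const : R := Km + C + (`|2 * (c00 p - mgamma p)| * Km
  + `|2 * (c00 p - mgamma p)| * C) + trunc_c p Km + L_c_size p * C.
Definition res_Q_const : R := Km + C + 2 * (trunc_Q p Km + `|2 * c02 p| * Km
  + `|2 * c02 p| * C + L_Q_size p * C).
Definition res_const : R := res_c_const + res_Q_const + (5 * Km + C).

Let D := h ^+ 2 + dt.
Let hD : h ^+ 2 <= D. Proof. by rewrite lerDl ltW. Qed.
Let dtD : dt <= D. Proof. by rewrite lerDr sqr_ge0. Qed.

Let trunc_c0 : 0 <= trunc_c p Km.
Proof. by rewrite mulr_ge0// !addr_ge0// mulr_ge0. Qed.
Let trunc_Q0 : 0 <= trunc_Q p Km.
Proof. by rewrite mulr_ge0// !addr_ge0// mulr_ge0. Qed.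
Let size_c0 : 0 <= L_c_size p.
Proof. by rewrite !addr_ge0// mulr_ge0. Qed.
Let size_Q0 : 0 <= L_Q_size p.
Proof. by rewrite !addr_ge0// mulr_ge0. Qed.

Let res_c0 : 0 <= res_c_const.
Proof.
apply: addr_ge0 (mulr_ge0 size_c0 C0); apply: addr_ge0 trunc_c0.
by apply: addr_ge0; apply: addr_ge0 => //; exact: mulr_ge0.
Qed.

Let res_Q0 : 0 <= res_Q_const.
Proof.
apply: addr_ge0; first exact: addr_ge0.
rewrite mulr_ge0//; apply: addr_ge0 (mulr_ge0 size_Q0 C0).
by apply: addr_ge0; [apply: addr_ge0 trunc_Q0 _|]; exact: mulr_ge0.
Qed.

Let res_b0 : 0 <= 5 * Km + C. Proof. by rewrite addr_ge0// mulr_ge0. Qed.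
Let D0 : 0 <= D. Proof. by rewrite addr_ge0 ?sqr_ge0// ltW. Qed.

Let res_c_le : res_c_const * D <= res_const * D.
Proof. by apply: ler_wpM2r => //; rewrite /res_const -addrA lerDl addr_ge0. Qed.
Let res_Q_le : res_Q_const * D <= res_const * D.
Proof. by apply: ler_wpM2r => //; rewrite /res_const addrAC lerDr addr_ge0. Qed.
Let res_b_le : (5 * Km + C) * D <= res_const * D.
Proof. by apply: ler_wpM2r => //; rewrite /res_const lerDr addr_ge0. Qed.

Let byD (x k y : R) : 0 <= k -> y <= D -> x <= k * y -> x <= k * D.
Proof. by move=> k0 yD H; apply: le_trans H _; rewrite ler_wpM2l. Qed.

Let tdt : `|t + dt - t| = dt.
Proof. by rewrite addrC addKr gtr0_norm. Qed.

Section interior.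
Variables l m : int.
Hypothesis lm : interior_node N l m.
Let x := l%:~R * h.
Let y := m%:~R * h.
Let xI : 0 < x < L. Proof. by have [] := interior_mesh N1 L0 lm. Qed.
Let yI : 0 < y < L. Proof. by have [] := interior_mesh N1 L0 lm. Qed.
Let xL : 0 <= x <= L. Proof. by have [] := grid_mesh N1 L0 (interior_grid lm). Qed.
Let yL : 0 <= y <= L. Proof. by have [] := grid_mesh N1 L0 (interior_grid lm). Qed.

Let in_ext (z : R) : 0 <= z <= L -> - h <= z <= L + h.
Proof.
move=> /andP[z0 zL]; rewrite (le_trans _ z0) ?oppr_le0 ?(ltW h0)//=.
by rewrite (le_trans zL)// lerDl ltW.
Qed.

Let cK4 : derivs_le 4 c (- h) (L + h) T Km.
Proof. exact: derivs_leW cK. Qed.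

Lemma c_time_truncation :
  `|(c x y (t + dt) - c x y t) / dt - pd Time c x y (t + dt)| <= Km * dt /\
  `|c x y (t + dt) - c x y t| <= Km * dt.
Proof.
have c4 : classC 4 c by exact: classCW cc.
split; first exact: (time_consistent c4 cK4 dt0 t0 tT' (in_ext xL) (in_ext yL)).
exact: (time_lipschitz c4 cK4 dt0 t0 tT' (in_ext xL) (in_ext yL)).
Qed.

Lemma Q_time_truncation i j :
  `|(Q x y (t + dt) i j - Q x y t i j) / dt - pd Time (tcomp Q i j) x y (t + dt)| <= Km * dt /\
  `|Q x y (t + dt) i j - Q x y t i j| <= Km * dt.
Proof.
split; first exact: (time_consistent (cQ i j) (QK i j) dt0 t0 tT' xL yL).
exact: (time_lipschitz (cQ i j) (QK i j) dt0 t0 tT' xL yL).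
Qed.

Let rate_D (a : R) : `|a| <= C * h ^+ 2 * `|t + dt - t| -> `|a / dt| <= C * D.
Proof.
rewrite tdt => H; apply: byD C0 hD _.
by rewrite normrM normfV (gtr0_norm dt0) ler_pdivrMr.
Qed.

(** A constant in space whose size is not estimated: it becomes the multiplier [lam] of
    [energy_step]. *)
Definition mean_gap : R :=
  mean_square L (fun x' y' => chem_c p c Q x' y' (t + dt)) -
  sumP N (fun l' m' => dXi_dc p (c1 l' m') (Q1 l' m')
      + 2 * (c00 p - mgamma p) * c0 l' m' + L_c p h c1 Q1 l' m') / (N.-1 ^ 2)%:R.

Lemma residual_c_le :
  `|(e1 l m - e0 l m) / dt + (entropy_gap l m + 2 * (c00 p - mgamma p) * e0 l m
     + L_c p h e1 r1 l m) - mean_gap| <= res_const * D.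
Proof.
apply: le_trans res_c_le.
have [S _ _ _] := step; have Sc := S l m lm.
have [_ ex _ _ _] : exact_solution p T cbnd Qbnd c Q by case: sol.
have [_ Ex _] := ex _ _ _ xI yI t1T.
rewrite (L_c_comb p hN0).
have [T1 T2] := c_time_truncation.
have [ws1 _] := corrector_size cor t1T lm; have [ws0 _] := corrector_size cor tT lm.
have [wr _] := corrector_rate cor tT t1T lm.
have [Dw DW] := corrector_DD cor t1T lm; have Bw := corrector_bilap cor t1T lm.
have Lw := L_c_le p ws1 Dw DW Bw.
have Tr := L_c_truncation L0 N1 cc cQ cK QK lm t1T.
move: Ex; rewrite /projG (chem_cE p c Q) => Ex.
set X := (X in `|X| <= _).
have -> : X = _ := residual_c_algebra (sample h (t + dt) c l m) (sample h t c l m)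
  (w (t + dt) l m) (w t l m) (L_c p h (sample h (t + dt) c) (sample h (t + dt) Q) l m)
  (L_c p h (w (t + dt)) (W (t + dt)) l m) dtN0 Sc Ex.
have hC2 (a : R) : `|2 * (c00 p - mgamma p) * a| = `|2 * (c00 p - mgamma p)| * `|a|.
  by rewrite normrM.
rewrite (_ : res_c_const * D = Km * D + C * D + `|2 * (c00 p - mgamma p)| * Km * D
  + `|2 * (c00 p - mgamma p)| * C * D + trunc_c p Km * D + L_c_size p * C * D); last first.
  by rewrite /res_c_const; ring.
have n0 := normr_ge0 (2 * (c00 p - mgamma p)).
apply: norm_add_le; last by apply: byD hD _; [exact: mulr_ge0|rewrite -mulrA].
apply: norm_add_le; last by apply: byD hD Tr.
apply: norm_add_le; last first.
  by rewrite hC2; apply: byD hD _; [exact: mulr_ge0|rewrite -mulrA ler_wpM2l].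
apply: norm_sub_le; last first.
  by rewrite hC2; apply: byD dtD _; [exact: mulr_ge0|rewrite -mulrA ler_wpM2l].
apply: norm_add_le; last exact: rate_D.
exact: byD dtD T1.
Qed.

Lemma residual_Q_le i j :
  `|(dt^-1 *: (r1 l m - r0 l m) + projP (entropy_gap_Q l m
     + (2 * c02 p) *: r0 l m + L_Q p h e1 r1 l m)) i j| <= res_const * D.
Proof.
apply: le_trans res_Q_le.
have [_ S _ _] := step; have Sc := S l m lm.
have [_ ex _ _ _] : exact_solution p T cbnd Qbnd c Q by case: sol.
have [_ _ Ex] := ex _ _ _ xI yI t1T.
have [ws1 _] := corrector_size cor t1T lm; have [_ ws0] := corrector_size cor tT lm.
have [_ wr] := corrector_rate cor tT t1T lm.
have [Dw DW] := corrector_DD cor t1T lm.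
have -> : dt^-1 *: (r1 l m - r0 l m) + projP (entropy_gap_Q l m
     + (2 * c02 p) *: r0 l m + L_Q p h e1 r1 l m) = _ :=
  residual_Q_algebra (sample h (t + dt) Q l m) (sample h t Q l m)
  (W (t + dt) l m) (W t l m) (entropy_gap_Q l m
     + (2 * c02 p) *: r0 l m + L_Q p h e1 r1 l m) Sc Ex.
have Zle a b : `|(dXi_dQ p (c1 l m) (Q1 l m) + (2 * c02 p) *: Q0 l m + L_Q p h c1 Q1 l m
    - chem_Q p c Q x y (t + dt) + (entropy_gap_Q l m
     + (2 * c02 p) *: r0 l m + L_Q p h e1 r1 l m)) a b|
  <= (trunc_Q p Km + `|2 * c02 p| * Km + `|2 * c02 p| * C + L_Q_size p * C) * D.
  have Tr := L_Q_truncation L0 N1 cc cQ cK QK lm t1T a b.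
  have [_ Qd] := Q_time_truncation a b.
  have Lw := L_Q_le p Dw DW a b.
  pose LQ := L_Q p h (sample h (t + dt) c) (sample h (t + dt) Q) l m a b.
  have -> : (dXi_dQ p (c1 l m) (Q1 l m) + (2 * c02 p) *: Q0 l m + L_Q p h c1 Q1 l m
    - chem_Q p c Q x y (t + dt) + (entropy_gap_Q l m
     + (2 * c02 p) *: r0 l m + L_Q p h e1 r1 l m)) a b =
    (LQ + 2 * c02 p * Q x y (t + dt) a b - lin_Q p c Q x y (t + dt) a b)
    - 2 * c02 p * (Q x y (t + dt) a b - Q x y t a b)
    + 2 * c02 p * W t l m a b + L_Q p h (w (t + dt)) (W (t + dt)) l m a b.
    have chemE : chem_Q p c Q x y (t + dt) a b
        = dXi_dQ p (c x y (t + dt)) (Q x y (t + dt)) a b + lin_Q p c Q x y (t + dt) a b.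
      by rewrite /chem_Q !mxE.
    have LE := L_Q_comb p hN0 (sample h (t + dt) c) (w (t + dt)) c1
      (sample h (t + dt) Q) (W (t + dt)) Q1 l m a b.
    have rE : r0 l m a b = Q x y t a b + W t l m a b - Q0 l m a b by rewrite !mxE.
    have gE : entropy_gap_Q l m a b = dXi_dQ p (c x y (t + dt)) (Q x y (t + dt)) a b
        - dXi_dQ p (c1 l m) (Q1 l m) a b by rewrite !mxE.
    move: chemE LE rE gE; rewrite -/e1 -/r1 -/LQ.
    exact: residual_entry_algebra.
  have n0 := normr_ge0 (2 * c02 p).
  rewrite (_ : (trunc_Q p Km + _ + _ + _) * D = trunc_Q p Km * D
    + `|2 * c02 p| * Km * D + `|2 * c02 p| * C * D + L_Q_size p * C * D); last by ring.
  apply: norm_add_le; last by apply: byD hD _; [exact: mulr_ge0|rewrite -mulrA].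
  apply: norm_add_le; last first.
    by rewrite normrM; apply: byD hD _; [exact: mulr_ge0|rewrite -mulrA ler_wpM2l].
  apply: norm_sub_le; first by apply: byD hD Tr.
  by rewrite normrM; apply: byD dtD _; [exact: mulr_ge0|rewrite -mulrA ler_wpM2l].
have P2 := projP_le i j Zle.
have [T1 _] := Q_time_truncation i j.
have rD := rate_D (wr i j).
rewrite (_ : res_Q_const * D = Km * D + C * D + 2 * ((trunc_Q p Km + `|2 * c02 p| * Km
  + `|2 * c02 p| * C + L_Q_size p * C) * D)); last by rewrite /res_Q_const; ring.
rewrite mxE; apply: norm_add_le => //.
rewrite mxE; apply: norm_add_le; last by rewrite !mxE mulrC.
by rewrite !mxE mulrC; apply: byD dtD T1.
Qed.

End interior.

Let lap_boundary l m : boundary_node N l m ->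
  `|lap_h h (sample h (t + dt) c) l m - lap c (l%:~R * h) (m%:~R * h) (t + dt)|
    <= 4 * Km * h ^+ 2.
Proof.
move=> /andP[lm _]; have [/andP[x0 xL] /andP[y0 yL]] := grid_mesh N1 L0 lm.
by apply: (lap_consistent cc cK h0 t1T) => //; rewrite ?lerD2r// -[X in X <= _]add0r lerD2r.
Qed.

Let boundary_algebra (a a' b b' d1 d0 la lb lc P PL : R) :
  (d1 - d0) / dt = - lc -> P = - PL -> `|(a - a') / dt - P| <= Km * D ->
  `|la - PL| <= 4 * Km * h ^+ 2 -> `|lb| <= C * h ^+ 2 -> b = 0 -> b' = 0 ->
  `|(a + b - d1 - (a' + b' - d0)) / dt + (la + lb - lc)| <= res_const * D.
Proof.
move=> E1 E2 h1 h2 h3 -> ->; apply: le_trans res_b_le.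
have -> : (a + 0 - d1 - (a' + 0 - d0)) / dt = (a - a') / dt - (d1 - d0) / dt by field.
rewrite E1 (_ : _ + _ = ((a - a') / dt - P) + (la - PL) + lb); last by rewrite E2; ring.
rewrite (_ : (5 * Km + C) * D = Km * D + 4 * Km * D + C * D); last by ring.
apply: norm_add_le; last exact: byD C0 hD h3.
by apply: norm_add_le => //; apply: byD hD h2; rewrite mulr_ge0.
Qed.

Let side_eq (k : int) : (k == 0) || (k == N%:Z) -> (k%:~R * h == 0) || (k%:~R * h == L).
Proof.
by case/orP => /eqP ->; rewrite ?mul0r ?eqxx// (mesh_N L (ltnW N1)) eqxx orbT.
Qed.

Let cK4 : derivs_le 4 c (- h) (L + h) T Km.
Proof. exact: derivs_leW cK. Qed.
Let c4 : classC 4 c. Proof. exact: classCW cc. Qed.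
Let side_node (k : int) : (k == 0) || (k == N%:Z) -> 0 <= k <= N%:Z.
Proof. by case/orP => /eqP ->; rewrite lexx. Qed.

Lemma residual_x_le l m : (l == 0) || (l == N%:Z) -> 0 <= m <= N%:Z ->
  `|(Dnx h N e1 l m - Dnx h N e0 l m) / dt + lap_h h e1 l m| <= res_const * D.
Proof.
move=> lB mI; have [_ _ S _] := step; have lI := side_node lB.
have B : boundary_node N l m.
  by apply: int_boundary => //; case/orP: lB => ->; rewrite ?orbT.
have [_ _ _ ex _] : exact_solution p T cbnd Qbnd c Q by case: sol.
have Ex := ex _ _ _ (side_eq lB) (mesh_in L0 (ltnW N1) mI) t1T.
rewrite !(Dnx_comb hN0) (lap_h_comb hN0).
exact: (boundary_algebra (S l m lB mI) Ex
  (Dnx_time_consistent L0 (ltnW N1) c4 cK4 dt0 t0 tT' lB mI) (lap_boundary B)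
  (corrector_lap cor t1T B) (corrector_Dnx cor t1T lB mI) (corrector_Dnx cor tT lB mI)).
Qed.

Lemma residual_y_le l m : (m == 0) || (m == N%:Z) -> 0 <= l <= N%:Z ->
  `|(Dny h N e1 l m - Dny h N e0 l m) / dt + lap_h h e1 l m| <= res_const * D.
Proof.
move=> mB lI; have [_ _ _ S] := step; have mI := side_node mB.
have B : boundary_node N l m.
  by apply: int_boundary => //; case/orP: mB => ->; rewrite ?orbT.
have [_ _ _ _ ex] : exact_solution p T cbnd Qbnd c Q by case: sol.
have Ex := ex _ _ _ (side_eq mB) (mesh_in L0 (ltnW N1) lI) t1T.
rewrite !(Dny_comb hN0) (lap_h_comb hN0).
exact: (boundary_algebra (S l m mB lI) Ex
  (Dny_time_consistent L0 (ltnW N1) c4 cK4 dt0 t0 tT' mB lI) (lap_boundary B)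
  (corrector_lap cor t1T B) (corrector_Dny cor t1T mB lI) (corrector_Dny cor tT mB lI)).
Qed.

Hypothesis adm : forall l m, interior_node N l m -> admissible (mM p) (c1 l m) (Q1 l m).
Hypothesis st1 : forall l m, grid_node N l m -> sym_traceless (Q1 l m).
Hypothesis bnd1 : forall l m, boundary_node N l m ->
  c1 l m = cbnd (l%:~R * h) (m%:~R * h) /\ Q1 l m = Qbnd (l%:~R * h) (m%:~R * h).
Hypothesis mass1 : sumP N e1 = 0.

(** [entropy_three_point] with the exact, the discrete and the shifted exact solution in the roles
    of (c, Q), (b, B) and (c', Q'); its defect is the quantity bounded in [corrector_entropy]. *)
Lemma entropy_gap_monotone l m : interior_node N l m ->
  - (C * h ^+ 4) <= entropy_gap l m * e1 l m
    + \sum_(i < 2) \sum_(j < 2) entropy_gap_Q l m i j * r1 l m i j.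
Proof.
move=> lm; have [xI yI] := interior_mesh N1 L0 lm.
have nu0 : 0 < mnu p by case: hp => -[].
have st := exact_sym_traceless sol xI yI t1T.
have sW := corrector_traceless cor t1T lm; have s1 := st1 (interior_grid lm).
have sQW : sym_traceless (sample h (t + dt) Q l m + W (t + dt) l m).
  by case: st sW => a1 a2 [b1 b2]; split; rewrite ?linearD /= ?a1 ?b1 ?a2 ?b2 ?addr0.
have ci := exact_c_in sol xI yI t1T; have [c1i _] := adm lm.
have [cwi gwi] := corrector_domain cor t1T lm.
have X0 := exact_gap_gt0 sol xI yI t1T; have X1 := admissible_gap s1 (adm lm).
have := entropy_three_point st s1 sQW ci c1i cwi nu0 X0 X1 gwi.
have H := corrector_entropy cor t1T lm.
rewrite (_ : sample h (t + dt) c l m + w (t + dt) l m - c (l%:~R * h) (m%:~R * h) (t + dt)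
  = w (t + dt) l m); last by rewrite /sample addrC addKr.
move=> T3; apply: le_trans (le_trans _ T3) _; first by rewrite lerN2.
rewrite le_eqVlt; apply/orP; left; apply/eqP; congr (_ + _).
by apply: eq_bigr => i _; apply: eq_bigr => j _; rewrite !mxE.
Qed.

Let e1_boundary : vanish_bnd N e1.
Proof.
move=> l m lm; rewrite /e1 /shift_err; have [-> _] := corrector_boundary cor t1T lm.
have [lI mI b] := boundary_mesh N1 L0 lm; have [-> _] := bnd1 lm.
by rewrite /sample; have [-> _] := exact_boundary sol lI mI t1T b; rewrite addr0 subrr.
Qed.

Let r1_boundary i j : vanish_bnd N (gcomp r1 i j).
Proof.
move=> l m lm; rewrite /gcomp /r1 /shift_err_Q; have [_ ->] := corrector_boundary cor t1T lm.
have [lI mI b] := boundary_mesh N1 L0 lm; have [_ ->] := bnd1 lm.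
by rewrite /sample; have [_ ->] := exact_boundary sol lI mI t1T b; rewrite addr0 subrr mxE.
Qed.

Let r1_traceless l m : interior_node N l m -> sym_traceless (r1 l m).
Proof.
move=> lm; have [xI yI] := interior_mesh N1 L0 lm.
have [a1 a2] := exact_sym_traceless sol xI yI t1T.
have [b1 b2] := corrector_traceless cor t1T lm; have [d1 d2] := st1 (interior_grid lm).
rewrite /r1 /shift_err_Q; split.
  by rewrite linearB linearD /= a1 b1 d1.
by rewrite linearB linearD /= a2 b2 d2 addr0 subrr.
Qed.

Definition reaction_const : R := `|2 * (c00 p - mgamma p)| + `|2 * c02 p|.

Lemma shifted_energy_step :
  energy p N h e1 r1 <= (1 + dt) * (1 + reaction_const * dt) ^+ 2 * energy p N h e0 r0
  + dt * ((1 + dt) ^+ 2 * (res_const * D) ^+ 2 * (5 * L ^+ 2 + 8 * c40 p * L)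
          + 2 * (1 + dt) * (C * h ^+ 4) * L ^+ 2).
Proof.
have hNL : h * N%:R = L by rewrite mulrC; exact: (mesh_N L (ltnW N1)).
have G0 : 0 <= C * h ^+ 4 by rewrite mulr_ge0// exprn_ge0// ltW.
(* The residuals are defined as what the equations leave over, so the equations become identities
   and the content lies in the four residual bounds. *)
apply: (@energy_step _ p N h N1 h0 hp e0 e1 r0 r1 entropy_gap
  (fun l m => (e1 l m - e0 l m) / dt + (entropy_gap l m + 2 * (c00 p - mgamma p) * e0 l m
     + L_c p h e1 r1 l m) - mean_gap) entropy_gap_Q
  (fun l m => dt^-1 *: (r1 l m - r0 l m) + projP (entropy_gap_Q l m
     + (2 * c02 p) *: r0 l m + L_Q p h e1 r1 l m)) mean_gap dt (res_const * D)
  (C * h ^+ 4) reaction_const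
  (fun l m => (Dnx h N e1 l m - Dnx h N e0 l m) / dt + lap_h h e1 l m)
  (fun l m => (Dny h N e1 l m - Dny h N e0 l m) / dt + lap_h h e1 l m)) => //.
- by move=> l m _; ring.
- by move=> l m _; rewrite [RHS]addrC addrK.
- exact: entropy_gap_monotone.
- by move=> l m _ _; rewrite [RHS]addrC addrK.
- by move=> l m _ _; rewrite [RHS]addrC addrK.
- by move=> l m lm; exact: residual_c_le.
- by move=> l m i j lm; exact: residual_Q_le.
- exact: residual_x_le.
- exact: residual_y_le.
- by rewrite lerDl.
- by rewrite lerDr.
Qed.

End step_residual.

(** * Accumulation over the time steps *)

Lemma step_growth (R : realFieldType) (dt T a : R) : 0 < dt <= T -> 0 <= a ->
  (1 + dt) * (1 + a * dt) ^+ 2 <= 1 + (1 + (1 + T) * (2 * a + a ^+ 2 * T)) * dt.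
Proof.
move=> /andP[dt0 dtT] a0.
have -> : (1 + dt) * (1 + a * dt) ^+ 2
  = 1 + (1 + (1 + dt) * (2 * a + a ^+ 2 * dt)) * dt by ring.
rewrite lerD2l ler_pM2r// lerD2l; apply: ler_pM.
- by rewrite addr_ge0// ltW.
- by rewrite addr_ge0 ?mulr_ge0 ?sqr_ge0// ltW.
- by rewrite lerD2l.
- by rewrite lerD2l ler_wpM2l ?sqr_ge0.
Qed.

Lemma step_source (R : realFieldType) (dt T h tc S C L2 : R) : 0 < dt <= T ->
  0 <= S -> 0 <= C -> 0 <= L2 ->
  dt * ((1 + dt) ^+ 2 * (tc * (h ^+ 2 + dt)) ^+ 2 * S + 2 * (1 + dt) * (C * h ^+ 4) * L2)
  <= ((1 + T) ^+ 2 * (2 * tc ^+ 2) * S + 2 * (1 + T) * C * L2) * (dt ^+ 2 + h ^+ 4) * dt.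
Proof.
move=> /andP[dt0 dtT] S0 C0 L20; rewrite [leLHS]mulrC ler_pM2r// [leRHS]mulrDl.
have T1 : 0 <= 1 + dt by rewrite addr_ge0// ltW.
have h4 : 0 <= h ^+ 4 by rewrite (_ : h ^+ 4 = (h ^+ 2) ^+ 2) ?sqr_ge0// -exprM.
have D2 : (h ^+ 2 + dt) ^+ 2 <= 2 * (dt ^+ 2 + h ^+ 4).
  rewrite -subr_ge0 (_ : _ - _ = (h ^+ 2 - dt) ^+ 2) ?sqr_ge0//.
  by rewrite (_ : h ^+ 4 = (h ^+ 2) ^+ 2); [ring|rewrite -exprM].
have q : (1 + dt) ^+ 2 <= (1 + T) ^+ 2.
  by apply: lerXn2r; rewrite ?nnegrE ?lerD2l// addr_ge0// (le_trans (ltW dt0)).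
have t2 := sqr_ge0 tc.
apply: lerD.
  rewrite (_ : _ * S = (1 + dt) ^+ 2 * (tc ^+ 2 * S) * (h ^+ 2 + dt) ^+ 2); last by ring.
  rewrite (_ : _ * (dt ^+ 2 + _) = (1 + T) ^+ 2 * (tc ^+ 2 * S) * (2 * (dt ^+ 2 + h ^+ 4))); last by ring.
  have tS := mulr_ge0 t2 S0.
  by apply: ler_pM => //; [exact: mulr_ge0 (sqr_ge0 _) tS|exact: sqr_ge0|exact: ler_wpM2r].
rewrite (_ : 2 * (1 + dt) * _ * L2 = (1 + dt) * (2 * C * L2 * h ^+ 4)); last by ring.
rewrite (_ : 2 * (1 + T) * C * L2 * _ = (1 + T) * (2 * C * L2 * (dt ^+ 2 + h ^+ 4))); last by ring.
have CL : 0 <= 2 * C * L2 by rewrite !mulr_ge0.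
apply: ler_pM => //; first by rewrite mulr_ge0.
  by rewrite lerD2l.
by rewrite ler_wpM2l// lerDr sqr_ge0.
Qed.

Section energy_facts.
Variables (R : realType) (p : model R) (N : nat) (h : R).
Hypotheses (N1 : (1 < N)%N) (h0 : 0 < h) (hp : model_ok p).

Lemma sum_sigma_ge0 (e : grid_fun R) : 0 <= sum_sigma_Dn2 h N e.
Proof.
apply: sumr_ge0 => k _.
by rewrite !addr_ge0// divr_ge0// addr_ge0// sqr_ge0.
Qed.

Lemma sum_sigma_eq (e e' : grid_fun R) :
  (forall l m : int, (l == 0) || (l == N%:Z) -> 0 <= m <= N%:Z ->
     Dnx h N e l m = Dnx h N e' l m) ->
  (forall l m : int, (m == 0) || (m == N%:Z) -> 0 <= l <= N%:Z ->
     Dny h N e l m = Dny h N e' l m) ->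
  sum_sigma_Dn2 h N e = sum_sigma_Dn2 h N e'.
Proof.
move=> X Y; apply: eq_big_nat => k /andP[_ kN].
have k1 : 0 <= k%:Z <= N%:Z by rewrite lez_nat ltnW.
have k2 : 0 <= k.+1%:Z <= N%:Z by rewrite lez_nat.
by rewrite !X ?eqxx ?orbT// !Y ?eqxx ?orbT.
Qed.

Lemma energy_ge0 (e : grid_fun R) (r : grid_tens R) : 0 <= energy p N h e r.
Proof.
have c40p : 0 < c40 p by case: hp => _ [[]].
apply: addr_ge0.
  rewrite mulr_ge0 ?sqr_ge0//; apply: sumP_ge0 => l m _.
  by rewrite addr_ge0 ?sqr_ge0// sumr_ge0// => i _; rewrite sumr_ge0// => j _; exact: sqr_ge0.
by rewrite mulr_ge0 ?sum_sigma_ge0// mulr_ge0 ?(ltW h0)// mulr_ge0// ltW.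
Qed.

(** Return from the shifted to the true error. The factor 2 is that of (x - y)^2 <= 2 x^2 + 2 y^2, 1
    / (2 c40) undoes the boundary weight of [energy], and 10 is twice the number of components. The
    boundary sums agree since the corrector has no normal differences. *)
Lemma error_energy_le (C L : R) (e w eta : grid_fun R) (r W q : grid_tens R) :
  h * N%:R = L -> 0 <= C ->
  (forall l m, interior_node N l m -> eta l m = e l m - w l m) ->
  (forall l m i j, interior_node N l m -> q l m i j = r l m i j - W l m i j) ->
  (forall l m, interior_node N l m -> `|w l m| <= C * h ^+ 2) ->
  (forall l m i j, interior_node N l m -> `|W l m i j| <= C * h ^+ 2) ->
  sum_sigma_Dn2 h N eta = sum_sigma_Dn2 h N e ->
  error_energy h N eta q <= (2 + (2 * c40 p)^-1) * energy p N h e r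
    + 10 * L ^+ 2 * C ^+ 2 * h ^+ 4.
Proof.
move=> hN C0 etaE qE wb Wb Ds.
have c40p : 0 < c40 p by case: hp => _ [[]].
pose S := sumP N (fun l m => e l m ^+ 2 + \sum_(i < 2) \sum_(j < 2) r l m i j ^+ 2).
have sq (x y : R) : `|y| <= C * h ^+ 2 -> (x - y) ^+ 2 <= 2 * x ^+ 2 + 2 * (C ^+ 2 * h ^+ 4).
  move=> yb; have y2 : y ^+ 2 <= C ^+ 2 * h ^+ 4.
    rewrite -[y ^+ 2]real_normK ?num_real// (_ : _ * h ^+ 4 = (C * h ^+ 2) ^+ 2).
      by apply: lerXn2r => //; rewrite nnegrE// (le_trans _ yb).
    by rewrite exprMn -exprM.
  have : 0 <= (x + y) ^+ 2 by rewrite sqr_ge0.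
  rewrite (_ : (x - y) ^+ 2 = 2 * x ^+ 2 + 2 * y ^+ 2 - (x + y) ^+ 2); last by ring.
  by move: y2; lra.
have S1 : sumP N (fun l m => eta l m ^+ 2 + \sum_(i < 2) \sum_(j < 2) q l m i j ^+ 2)
    <= 2 * S + (N.-1 ^ 2)%:R * (10 * (C ^+ 2 * h ^+ 4)).
  rewrite -sumPZ -sumP_const -sumPD; apply: ler_sumP => l m lm.
  rewrite etaE// !sum_ord2 !qE//.
  have := sq (e l m) _ (wb _ _ lm).
  have := sq (r l m 0 0) _ (Wb _ _ 0 0 lm); have := sq (r l m 0 1) _ (Wb _ _ 0 1 lm).
  have := sq (r l m 1 0) _ (Wb _ _ 1 0 lm); have := sq (r l m 1 1) _ (Wb _ _ 1 1 lm).
  by rewrite !mulrDr; lra.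
have S0 : 0 <= S.
  apply: sumP_ge0 => l m _.
  by rewrite addr_ge0 ?sqr_ge0// sumr_ge0// => i _; rewrite sumr_ge0// => j _; exact: sqr_ge0.
have N2 : h ^+ 2 * (N.-1 ^ 2)%:R <= L ^+ 2.
  rewrite -hN exprMn natrX ler_pM2l ?exprn_gt0//.
  by apply: lerXn2r; rewrite ?nnegrE ?ler0n// ler_nat leq_pred.
have sg := sum_sigma_ge0 e.
rewrite /error_energy Ds /energy -/S.
have ch : 0 <= C ^+ 2 * h ^+ 4 by rewrite mulr_ge0 ?sqr_ge0// exprn_ge0// ltW.
have h1 : h ^+ 2 * sumP N (fun l m => eta l m ^+ 2 + \sum_(i < 2) \sum_(j < 2) q l m i j ^+ 2)
    <= 2 * (h ^+ 2 * S) + 10 * L ^+ 2 * C ^+ 2 * h ^+ 4.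
  apply: (@le_trans _ _ (h ^+ 2 * (2 * S + (N.-1 ^ 2)%:R * (10 * (C ^+ 2 * h ^+ 4))))).
    by rewrite ler_pM2l// exprn_gt0.
  rewrite mulrDr mulrCA lerD2l mulrA (_ : 10 * L ^+ 2 * _ * _ = L ^+ 2 * (10 * (C ^+ 2 * h ^+ 4))).
    by rewrite ler_wpM2r// mulr_ge0.
  by ring.
have c2 : 0 < 2 * c40 p by rewrite mulr_gt0.
rewrite (_ : (2 + (2 * c40 p)^-1) * _ = 2 * (h ^+ 2 * S) + (2 * c40 p)^-1 * (h ^+ 2 * S)
  + 2 * (2 * c40 p * h * sum_sigma_Dn2 h N e) + h * sum_sigma_Dn2 h N e); last first.
  by field; rewrite gt_eqF.
have n1 : 0 <= (2 * c40 p)^-1 * (h ^+ 2 * S).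
  by rewrite mulr_ge0 ?invr_ge0 ?(ltW c2)// mulr_ge0// sqr_ge0.
have n2 : 0 <= 2 * (2 * c40 p * h * sum_sigma_Dn2 h N e).
  by rewrite mulr_ge0// mulr_ge0// mulr_ge0// ltW.
by move: h1 n1 n2; lra.
Qed.

Lemma scheme_mass (dt : R) (c0 c1 : grid_fun R) (Q0 Q1 : grid_tens R) : dt != 0 ->
  scheme_step p N dt c0 Q0 c1 Q1 -> sumP N c1 = sumP N c0.
Proof.
move=> dt0 [S _ _ _]; apply/eqP; rewrite -subr_eq0 -sumPB; apply/eqP.
rewrite (eq_sumP (v := fun l m => - dt * projG_h N (fun l' m' =>
   dXi_dc p (c1 l' m') (Q1 l' m') + 2 * (c00 p - mgamma p) * c0 l' m'
   + L_c p (mL p / N%:R) c1 Q1 l' m') l m)).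
  by rewrite sumPZ sumP_projG_h// mulr0.
move=> l m lm; have := S l m lm => /(congr1 (fun z => z * dt)).
by rewrite divfK// => ->; rewrite mulNr mulrC mulNr.
Qed.

End energy_facts.

Section error_sequence.
Variables (R : realType) (p : model R) (T K Km C dt : R) (N : nat).
Variables (cbnd : R -> R -> R) (Qbnd : R -> R -> 'M[R]_2).
Variables (c : R -> R -> R -> R) (Q : R -> R -> R -> 'M[R]_2).
Variables (cn : nat -> grid_fun R) (Qn : nat -> grid_tens R).
Hypotheses (hp : model_ok p) (hT : 0 < T) (N1 : (1 < N)%N) (dt0 : 0 < dt).
Hypothesis sol : regular_solution p T K cbnd Qbnd c Q.
Local Notation L := (mL p).
Let h := L / N%:R.
Hypothesis cK : derivs_le 6 c (- h) (L + h) T Km.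
Hypothesis QK : forall i j : 'I_2, derivs_le 4 (tcomp Q i j) 0 L T Km.
Hypothesis C0 : 0 <= C.
Variables (w : R -> grid_fun R) (W : R -> grid_tens R).
Hypothesis cor : corrector p T C h N c Q w W.
Hypothesis dsol : discrete_solution p T cbnd Qbnd c Q N dt cn Qn.

Let L0 : 0 < L. Proof. by case: hp => -[]. Qed.
Let h0 : 0 < h := mesh_gt0 L0 (ltnW N1).
Let hNL : h * N%:R = L. Proof. by rewrite mulrC; exact: (mesh_N L (ltnW N1)). Qed.
Let hN0 : h != 0. Proof. by rewrite gt_eqF. Qed.
Let dtN0 : dt != 0. Proof. by rewrite gt_eqF. Qed.
Let e (n : nat) : grid_fun R := shift_err p N c w (n%:R * dt) (cn n).
Let r (n : nat) : grid_tens R := shift_err_Q p N Q W (n%:R * dt) (Qn n).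

Let time_in n : n%:R * dt <= T -> 0 <= n%:R * dt <= T.
Proof. by move=> ->; rewrite mulr_ge0 ?(ltW dt0). Qed.

Let timeS n : n.+1%:R * dt = n%:R * dt + dt.
Proof. by rewrite -natr1 mulrDl mul1r. Qed.

Let time_pred n : n.+1%:R * dt <= T -> n%:R * dt <= T.
Proof. by move=> nT; apply: le_trans nT; rewrite timeS lerDl ltW. Qed.

Let discrete_mass n : n%:R * dt <= T -> sumP N (cn n) = sumP N (sample h 0 c).
Proof.
case: dsol => -[I _] _ _ _ S.
elim: n => [_|n IH nT].
  by apply: eq_sumP => l m /interior_grid lm; have [] := I l m lm.
by rewrite (scheme_mass N1 dtN0 (S n nT)) IH// time_pred.
Qed.

Let error_mass n : n%:R * dt <= T -> sumP N (e n) = 0.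
Proof.
move=> nT; rewrite /e /shift_err -/h sumPB sumPD (corrector_sum cor (time_in nT)) discrete_mass//.
rewrite sumPB.
by move: (sumP _ _) (sumP _ _) => a b; ring.
Qed.

Let initial_energy : energy p N h (e 0%N) (r 0%N) <= 0.
Proof.
case: dsol => -[I [X Y]] _ _ _ _.
have T0 : (0 : R) <= 0 <= T by rewrite lexx ltW.
have e0E : e 0%N = shift_err p N c w 0 (cn 0%N) by rewrite /e mul0r.
have z l m : interior_node N l m -> e 0%N l m = 0 /\ r 0%N l m = 0.
  move=> /interior_grid lm; rewrite /e /r /shift_err /shift_err_Q mul0r -/h.
  have [-> ->] := I l m lm; have [-> ->] := corrector_init cor lm.
  by rewrite !addr0 !subrr.
rewrite /energy (@eq_sumP _ _ _ (fun _ _ => 0)); last first.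
  move=> l m lm; have [-> ->] := z l m lm.
  by rewrite !sum_ord2 !mxE expr0n /= !addr0.
rewrite sumP_const !mulr0 add0r (@sum_sigma_eq _ _ _ _ (fun _ _ => 0)).
- rewrite /sum_sigma_Dn2 /Dnx /Dny !if_same !subrr !mul0r expr0n /= addr0 mul0r !addr0.
  by rewrite big1// mulr0.
- move=> l m lB mI; rewrite e0E (Dnx_comb hN0) (corrector_Dnx cor T0 lB mI) X//.
  by rewrite addr0 subrr /Dnx !if_same subrr mul0r.
- move=> l m mB lI; rewrite e0E (Dny_comb hN0) (corrector_Dny cor T0 mB lI) Y//.
  by rewrite addr0 subrr /Dny !if_same subrr mul0r.
Qed.

Definition growth_const : R := 1 + (1 + T) * (2 * reaction_const p + reaction_const p ^+ 2 * T).
Definition source_const : R :=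
  (1 + T) ^+ 2 * (2 * res_const p Km C ^+ 2) * (5 * L ^+ 2 + 8 * c40 p * L)
  + 2 * (1 + T) * C * L ^+ 2.

Let c40p : 0 < c40 p. Proof. by case: hp => _ [[]]. Qed.
Let reaction0 : 0 <= reaction_const p. Proof. exact: addr_ge0. Qed.
Let S0 : 0 <= 5 * L ^+ 2 + 8 * c40 p * L.
Proof.
by rewrite addr_ge0 ?mulr_ge0 ?sqr_ge0 ?(ltW L0)// ltW.
Qed.
Let source0 : 0 <= source_const.
Proof.
have T1 : 0 <= 1 + T by rewrite addr_ge0// ltW.
apply: addr_ge0.
  by apply: mulr_ge0 S0; rewrite mulr_ge0 ?sqr_ge0// mulr_ge0// sqr_ge0.
by apply: mulr_ge0 (sqr_ge0 _); apply: mulr_ge0 C0; rewrite mulr_ge0.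
Qed.
Let growth0 : 0 <= growth_const.
Proof.
rewrite addr_ge0// mulr_ge0 ?addr_ge0// ?(ltW hT)// mulr_ge0// ?sqr_ge0// ltW//.
Qed.

Let energy_growth n : n.+1%:R * dt <= T ->
  energy p N h (e n.+1) (r n.+1) <= (1 + growth_const * dt) * energy p N h (e n) (r n)
    + source_const * (dt ^+ 2 + h ^+ 4) * dt.
Proof.
move=> nT; have nT0 := time_pred nT; have /andP[t0 _] := time_in nT0.
case: dsol => _ st ad bd S.
have dtT : 0 < dt <= T.
  by rewrite dt0 (le_trans _ nT)// timeS lerDr.
have tT' : n%:R * dt + dt <= T by rewrite -timeS.
have mass : sumP N (shift_err p N c w (n%:R * dt + dt) (cn n.+1)) = 0.
  by rewrite -timeS; exact: error_mass.
have H := shifted_energy_step hp hT N1 dt0 sol cK QK C0 cor t0 tT' (S n nT)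
  (fun l m => ad n.+1 l m nT) (fun l m => st n.+1 l m nT) (fun l m => bd n.+1 l m nT) mass.
rewrite /e /r timeS; apply: le_trans H _; apply: lerD.
  by rewrite ler_wpM2r ?energy_ge0// step_growth.
by apply: step_source => //; exact: sqr_ge0.
Qed.

Lemma error_bound n : n%:R * dt <= T ->
  error_energy h N (fun l m => sample h (n%:R * dt) c l m - cn n l m)
    (fun l m => sample h (n%:R * dt) Q l m - Qn n l m)
  <= ((2 + (2 * c40 p)^-1) * (source_const * T * expR (growth_const * T))
      + 10 * L ^+ 2 * C ^+ 2) * (dt ^+ 2 + h ^+ 4).
Proof.
move=> nT; have tT := time_in nT; have D0 : 0 <= dt ^+ 2 + h ^+ 4.
  by rewrite addr_ge0 ?sqr_ge0// exprn_ge0// ltW.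
have H : error_energy h N (fun l m => sample h (n%:R * dt) c l m - cn n l m)
    (fun l m => sample h (n%:R * dt) Q l m - Qn n l m)
    <= (2 + (2 * c40 p)^-1) * energy p N h (e n) (r n) + 10 * L ^+ 2 * C ^+ 2 * h ^+ 4.
  apply: (@error_energy_le _ p N h h0 hp C L (e n) (w (n%:R * dt)) _ (r n) (W (n%:R * dt))) => //.
  - by move=> l m lm; rewrite /e /shift_err -/h; ring.
  - by move=> l m i j lm; rewrite /r /shift_err_Q -/h !mxE; ring.
  - by move=> l m lm; have [] := corrector_size cor tT lm.
  - by move=> l m i j lm; have [_] := corrector_size cor tT lm.
  - apply: sum_sigma_eq => l m B I.
      rewrite /e /shift_err (Dnx_comb hN0) (corrector_Dnx cor tT B I) -/h.
      by rewrite addr0 /Dnx; case: ifP => _; ring.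
    rewrite /e /shift_err (Dny_comb hN0) (corrector_Dny cor tT B I) -/h.
    by rewrite addr0 /Dny; case: ifP => _; ring.
apply: le_trans H _; rewrite [leRHS]mulrDl; apply: lerD; last first.
  apply: ler_wpM2l; last by rewrite lerDr sqr_ge0.
  by apply: mulr_ge0 (sqr_ge0 _); rewrite mulr_ge0 ?sqr_ge0.
have k0 : 0 <= 2 + (2 * c40 p)^-1 by rewrite addr_ge0// invr_ge0 mulr_ge0// ltW.
rewrite -[leRHS]mulrA; apply: ler_wpM2l => //.
have b0 : 0 <= source_const * (dt ^+ 2 + h ^+ 4) by rewrite mulr_ge0.
have G := @gronwall R (fun n => energy p N h (e n) (r n)) growth_const
  (source_const * (dt ^+ 2 + h ^+ 4)) dt T n growth0 b0 dt0 nT initial_energy.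
apply: le_trans (G _) _.
  move=> k kn; apply: energy_growth; apply: le_trans nT.
  by rewrite ler_pM2r// ler_nat.
by rewrite le_eqVlt; apply/orP; left; apply/eqP; ring.
Qed.

End error_sequence.

Theorem theorem3p12 (R : realType) (p : model R) (T K kappa : R)
    (hp : model_ok p) (hT : 0 < T) :
  exists C : R,
  forall (cbnd : R -> R -> R) (Qbnd : R -> R -> 'M[R]_2)
    (c : R -> R -> R -> R) (Q : R -> R -> R -> 'M[R]_2),
    classC 6 c ->
    (forall i j : 'I_2, classC 4 (tcomp Q i j)) ->
    exact_solution p T cbnd Qbnd c Q ->
    derivs_le 6 c 0 (mL p) T K ->
    (forall i j : 'I_2, derivs_le 4 (tcomp Q i j) 0 (mL p) T K) ->
  forall (N : nat) (dt : R) (cn : nat -> grid_fun R) (Qn : nat -> grid_tens R),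
    (1 < N)%N -> 0 < dt ->
    let h := mL p / N%:R in
    derivs_le 6 c (- h) (mL p + h) T (kappa * K) ->
    discrete_solution p T cbnd Qbnd c Q N dt cn Qn ->
  forall n : nat, n%:R * dt <= T ->
    error_energy h N
      (fun l m => sample h (n%:R * dt) c l m - cn n l m)
      (fun l m => sample h (n%:R * dt) Q l m - Qn n l m)
    <= C * (dt ^+ 2 + h ^+ 4).
Proof.
have [C' corH] := corrector_exists K hp hT.
(* [C'] comes from estimates on the square itself and depends on the model, T and K; kappa enters
   only through [Km], the derivative bound behind the truncation errors on the extended square. The
   maximum with 0 gives the sign that the residual constants need. *)
pose C := Num.max C' 0; pose Km := Num.max K (kappa * K).
exists ((2 + (2 * c40 p)^-1) * (source_const p T Km C * T * expR (growth_const p T * T))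
  + 10 * mL p ^+ 2 * C ^+ 2).
move=> cbnd Qbnd c Q cc cQ ex cK QK N dt cn Qn N1 dt0 h cKh dsol n nT.
have sol : regular_solution p T K cbnd Qbnd c Q by [].
have [w [W cor']] := corH _ _ _ _ _ N1 sol.
have [[L0 _ _] _] := hp.
have h0 : 0 <= h := ltW (mesh_gt0 L0 (ltnW N1)).
have CC : C' <= C by rewrite /C le_max lexx.
have cor := corrector_weaken h0 CC cor'.
have C0 : 0 <= C by rewrite /C le_max lexx orbT.
have cKm : derivs_le 6 c (- h) (mL p + h) T Km.
  by apply: derivs_leW cKh => //; rewrite le_max lexx orbT.
have QKm i j : derivs_le 4 (tcomp Q i j) 0 (mL p) T Km.
  by apply: derivs_leW (QK i j) => //; rewrite le_max lexx.
exact: (error_bound hp hT N1 dt0 sol cKm QKm C0 cor dsol nT).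
Qed.
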